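(* Let $H=H(C_\Phi,D_\Phi,c)$ be the GLS path algebra over a field $K$ attached to a finite root system $\Phi$ of Dynkin type, a symmetrizer $D_\Phi$ of its Cartan matrix and a Coxeter element $c$. Let $D=\mathrm{Hom}_K(-,K)\colon\mathrm{mod}\,H\to\mathrm{mod}\,H^{\mathrm{op}}$ be the standard duality. (1) $D$ gives a bijection between (isomorphism classes of basic) support $\tau$-tilting modules of $H$ and of $H^{\mathrm{op}}$. (2) This bijection is an isomorphism between the underlying graphs of the support $\tau$-tilting quivers of $H$ and of $H^{\mathrm{op}}$. (3) Suppose there is an arrow $M\to M'$ in the support $\tau$-tilting quiver of $H$. Then (i) $|M|\ne|M'|$ if and only if there is an arrow $DM\to DM'$ in the support $\tau$-tilting quiver of $H^{\mathrm{op}}$; (ii) $|M|=|M'|$ if and only if there is an arrow $DM'\to DM$ in the support $\tau$-tilting quiver of $H^{\mathrm{op}}$. Here $|M|$ is the number of isomorphism classes of indecomposable direct summands of $M$.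
   Context: $\Phi$ has rank $n$, simple reflections $s_1,\dots,s_n$ and Cartan matrix $C_\Phi=(C_{ij})$. A Coxeter element is a product $c$ of all simple reflections, each once, in some order; $c=\cdots s_i\cdots s_j\cdots$ means $s_i$ occurs before $s_j$. $D_\Phi=\mathrm{diag}(d_1,\dots,d_n)$, $d_i$ positive integers, with $D_\Phi C_\Phi$ symmetric. $Q^c$ is the quiver with vertices $1,\dots,n$, arrows $\alpha_{ij}\colon i\to j$ whenever $c=\cdots s_i\cdots s_j\cdots$ and $s_is_j\neq s_js_i$, and loops $\varepsilon_i\colon i\to i$. $H=KQ^c/I$, with $I$ generated by $\varepsilon_i^{d_i}$ (all $i$) and $\varepsilon_i^{|C_{ji}|}\alpha_{ij}-\alpha_{ij}\varepsilon_j^{|C_{ij}|}$ (all arrows $\alpha_{ij}$); paths are composed from left to right. $\mathrm{mod}$ denotes finitely generated right modules. For a finite dimensional algebra $A$ with Auslander-Reiten translation $\tau$, $M\in\mathrm{mod}\,A$ is $\tau$-rigid if $\mathrm{Hom}_A(M,\tau M)=0$. A pair $(M,P)$ with $P$ projective is $\tau$-tilting if $M$ is $\tau$-rigid, $\mathrm{Hom}_A(P,M)=0$ and $|M|+|P|=|A|$. $M$ is support $\tau$-tilting if such a $P$ exists; a basic such $P$ is then determined by $M$. Modules and pairs are taken basic and up to isomorphism. The support $\tau$-tilting quiver of $A$ has the basic support $\tau$-tilting modules as vertices, with an arrow $M\to M'$ if $\mathrm{Fac}\,M\supsetneq\mathrm{Fac}\,M'$ and there is no support $\tau$-tilting $M''$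 with $\mathrm{Fac}\,M\supsetneq\mathrm{Fac}\,M''\supsetneq\mathrm{Fac}\,M'$; $\mathrm{Fac}\,M$ is the class of quotients of finite direct sums of copies of $M$. *)

(* Defs.v *)
From HB Require Import structures.
From mathcomp Require Import all_boot all_order all_algebra all_field.
From mathcomp Require Import boolp classical_sets.
From mathcomp Require Import finmap monalg.

Set Implicit Arguments.
Unset Strict Implicit.
Unset Printing Implicit Defensive.

Import Order.TTheory GRing.Theory Num.Theory.
Local Open Scope ring_scope.

Record quiver := Quiver {
  vertex : finType;
  arrow : finType;
  source : arrow -> vertex;
  target : arrow -> vertex }.

Section Paths.
Variable Q : quiver.

Fixpoint composable (x : vertex Q) (s : seq (arrow Q)) : bool :=
  if s is a :: s' then (source a == x) && composable (target a) s' else true.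

Definition walk_end (x : vertex Q) (s : seq (arrow Q)) : vertex Q :=
  last x (map (@target Q) s).

(* A path is a starting vertex with a composable sequence of arrows, read from
   left to right; the empty sequences give the trivial paths. *)
Record qpath := QPath {
  qpath_val :> vertex Q * seq (arrow Q);
  qpath_ok : composable qpath_val.1 qpath_val.2 }.

HB.instance Definition _ := [isSub for qpath_val].
HB.instance Definition _ := [Choice of qpath by <:].

Definition qstart (p : qpath) : vertex Q := (val p).1.
Definition qend (p : qpath) : vertex Q := walk_end (val p).1 (val p).2.

Lemma composable_cat x s t :
  composable x (s ++ t) = composable x s && composable (walk_end x s) t.
Proof.
by elim: s x => [|a s IHs] x //=; rewrite IHs andbA.
Qed.

Lemma walk_end_cat x s t : walk_end x (s ++ t) = walk_end (walk_end x s) t.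
Proof. by rewrite /walk_end map_cat last_cat. Qed.

Definition vertex_path (x : vertex Q) : qpath := @QPath (x, [::]) isT.

Fact arrow_path_ok (a : arrow Q) : composable (source a) [:: a].
Proof. by rewrite /= eqxx. Qed.

Definition arrow_path (a : arrow Q) : qpath :=
  @QPath (source a, [:: a]) (arrow_path_ok a).

(* [None] when the two paths cannot be composed *)
Definition qcomp (p q : qpath) : option qpath :=
  if qend p == qstart q then insub (qstart p, (val p).2 ++ (val q).2) else None.

Lemma qcompE p q : qend p = qstart q ->
  exists2 r, qcomp p q = Some r & val r = (qstart p, (val p).2 ++ (val q).2).
Proof.
move=> epq; rewrite /qcomp epq eqxx.
case: insubP => [r _ <-|/negP[]]; first by exists r.
rewrite /= composable_cat (qpath_ok p) /=.
by have := qpath_ok q; rewrite -/(qend p) epq.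
Qed.

Lemma qcomp_some p q r : qcomp p q = Some r ->
  [/\ qend p = qstart q, qstart r = qstart p & qend r = qend q].
Proof.
rewrite /qcomp; case: eqP => // epq; case: insubP => // u _ uE [<-].
split=> //; first by rewrite /qstart uE.
by rewrite /qend uE /= walk_end_cat -/(qend p) epq.
Qed.

Lemma qcompA p q r :
  obind (qcomp p) (qcomp q r) = obind (qcomp^~ r) (qcomp p q).
Proof.
have [epq|npq] := eqVneq (qend p) (qstart q); last first.
  have -> : qcomp p q = None by rewrite /qcomp (negPf npq).
  case qr: (qcomp q r) => [u|] //=; have [_ su _] := qcomp_some qr.
  by rewrite /qcomp su (negPf npq).
have [v pqE vE] := qcompE epq; have [_ sv ev] := qcomp_some pqE.
have [eqr|nqr] := eqVneq (qend q) (qstart r); last first.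
  have -> : qcomp q r = None by rewrite /qcomp (negPf nqr).
  by rewrite pqE /= /qcomp ev (negPf nqr).
have [u qrE uE] := qcompE eqr; have [_ su eu] := qcomp_some qrE.
rewrite pqE qrE /=.
have [|w -> wE] := @qcompE p u; first by rewrite su.
have [|z -> zE] := @qcompE v r; first by rewrite ev.
by congr Some; apply: val_inj; rewrite wE zE sv uE vE catA.
Qed.

Lemma qcomp_vl x p :
  qcomp (vertex_path x) p = if x == qstart p then Some p else None.
Proof.
rewrite /qcomp /qend /walk_end /=; case: eqP => // xp.
have -> : (qstart (vertex_path x), (val p).2) = val p.
  by rewrite [RHS]surjective_pairing -[(val p).1]xp.
by rewrite valK.
Qed.

Lemma qcomp_vr x p :
  qcomp p (vertex_path x) = if qend p == x then Some p else None.
Proof.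
rewrite /qcomp; case: eqP => // _; rewrite cats0.
have -> : (qstart p, (val p).2) = val p by rewrite [RHS]surjective_pairing.
by rewrite valK.
Qed.

End Paths.

Definition path_algebra (K : fieldType) (Q : quiver) : Type :=
  {malg K[qpath Q]}.

Section PathAlgebra.
Variables (K : fieldType) (Q : quiver).
Local Notation KQ := (path_algebra K Q).

HB.instance Definition _ := GRing.Lmodule.copy KQ {malg K[qpath Q]}.

Definition kq_basis (p : qpath Q) : KQ := << p >>.
Definition kq_opt (o : option (qpath Q)) : KQ :=
  if o is Some p then kq_basis p else 0.

Definition kq_mul (x y : KQ) : KQ :=
  \sum_(p <- msupp x) \sum_(q <- msupp y)
    (x@_p * y@_q) *: kq_opt (qcomp p q).

Definition kq_one : KQ := \sum_(v : vertex Q) kq_basis (vertex_path v).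

Lemma kq_mulw (d1 d2 : {fset qpath Q}) (x y : KQ) :
  (msupp x `<=` d1)%fset -> (msupp y `<=` d2)%fset ->
  kq_mul x y =
    \sum_(p <- d1) \sum_(q <- d2) (x@_p * y@_q) *: kq_opt (qcomp p q).
Proof.
move=> le_d1 le_d2; rewrite /kq_mul (big_fset_incl _ le_d1) /=.
  apply/eq_bigr=> k1 _; apply/big_fset_incl => // k _ /mcoeff_outdom ->.
  by rewrite mulr0 scale0r.
move=> k _ /mcoeff_outdom g1k.
by rewrite big1 // => k' _; rewrite g1k mul0r scale0r.
Qed.

Lemma kq_mulDl : left_distributive kq_mul +%R.
Proof.
move=> x y z; have le_x := fsubsetUl (msupp x) (msupp y).
have le_y := fsubsetUr (msupp x) (msupp y); have le_z := fsubset_refl (msupp z).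
rewrite (kq_mulw le_x le_z) (kq_mulw le_y le_z) (kq_mulw (msuppD_le _ _) le_z).
rewrite -big_split /=; apply/eq_bigr=> p _.
rewrite -big_split /=; apply/eq_bigr=> q _.
by rewrite mcoeffD mulrDl scalerDl.
Qed.

Lemma kq_mulDr : right_distributive kq_mul +%R.
Proof.
move=> z x y; have le_x := fsubsetUl (msupp x) (msupp y).
have le_y := fsubsetUr (msupp x) (msupp y); have le_z := fsubset_refl (msupp z).
rewrite (kq_mulw le_z le_x) (kq_mulw le_z le_y) (kq_mulw le_z (msuppD_le _ _)).
rewrite -big_split /=; apply/eq_bigr=> p _.
rewrite -big_split /=; apply/eq_bigr=> q _.
by rewrite mcoeffD mulrDr scalerDl.
Qed.

Lemma kq_mulZl c (x y : KQ) : kq_mul (c *: x) y = c *: kq_mul x y.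
Proof.
rewrite (kq_mulw (msuppZ_le c x) (fsubset_refl (msupp y))).
rewrite /kq_mul scaler_sumr; apply/eq_bigr=> p _.
rewrite scaler_sumr; apply/eq_bigr=> q _.
by rewrite [(c *: x)@_p]mcoeffZ scalerA mulrA.
Qed.

Lemma kq_mulZr c (x y : KQ) : kq_mul x (c *: y) = c *: kq_mul x y.
Proof.
rewrite (kq_mulw (fsubset_refl (msupp x)) (msuppZ_le c y)).
rewrite /kq_mul scaler_sumr; apply/eq_bigr=> p _.
rewrite scaler_sumr; apply/eq_bigr=> q _.
by rewrite [(c *: y)@_q]mcoeffZ scalerA mulrCA.
Qed.

Lemma kq_mul0l (x : KQ) : kq_mul 0 x = 0.
Proof. by have := kq_mulZl 0 0 x; rewrite !scale0r. Qed.

Lemma kq_mul0r (x : KQ) : kq_mul x 0 = 0.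
Proof. by have := kq_mulZr 0 x 0; rewrite !scale0r. Qed.

Lemma kq_suml I (r : seq I) P (F : I -> KQ) y :
  kq_mul (\sum_(i <- r | P i) F i) y = \sum_(i <- r | P i) kq_mul (F i) y.
Proof.
exact: (big_morph (kq_mul^~ y) (fun _ _ => kq_mulDl _ _ _) (kq_mul0l y)).
Qed.

Lemma kq_sumr I (r : seq I) P (F : I -> KQ) x :
  kq_mul x (\sum_(i <- r | P i) F i) = \sum_(i <- r | P i) kq_mul x (F i).
Proof.
exact: (big_morph (kq_mul x) (fun _ _ => kq_mulDr _ _ _) (kq_mul0r x)).
Qed.

Lemma kq_mulBB p q :
  kq_mul (kq_basis p) (kq_basis q) = kq_opt (qcomp p q).
Proof.
rewrite (kq_mulw (d1 := [fset p]%fset) (d2 := [fset q]%fset)) ?msuppU_le //.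
by rewrite !big_seq_fset1 !mcoeffUU mulr1 scale1r.
Qed.

Lemma malg_scaleU (T : choiceType) (c : K) (k : T) :
  c *: << k >> = << c *g k >> :> {malg K[T]}.
Proof. by apply/malgP => k'; rewrite mcoeffZ !mcoeffU mulrnAr mulr1. Qed.

Lemma kq_expand (x : KQ) : x = \sum_(p <- msupp x) x@_p *: kq_basis p.
Proof.
apply: etrans (monalgE x) _; apply: eq_bigr => p _.
exact: (esym (malg_scaleU x@_p p)).
Qed.

Lemma kq_ext (f g : KQ -> KQ) : linear f -> linear g ->
  (forall p, f (kq_basis p) = g (kq_basis p)) -> f =1 g.
Proof.
move=> lf lg fg x.
pose f' : {linear KQ -> KQ} := HB.pack f (GRing.isLinear.Build K KQ KQ _ f lf).
pose g' : {linear KQ -> KQ} := HB.pack g (GRing.isLinear.Build K KQ KQ _ g lg).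
have E p : f' (kq_basis p) = g' (kq_basis p) by exact: fg.
suff: f' x = g' x by [].
rewrite (kq_expand x) !linear_sum; apply: eq_bigr => p _.
by rewrite !linearZ E.
Qed.

Lemma kq_linl y : linear (kq_mul^~ y).
Proof.
move=> c u v.
exact: (etrans (kq_mulDl (c *: u) v y) (congr1 (+%R^~ _) (kq_mulZl c u y))).
Qed.

Lemma kq_linr x : linear (kq_mul x).
Proof.
move=> c u v.
exact: (etrans (kq_mulDr x (c *: u) v) (congr1 (+%R^~ _) (kq_mulZr c x u))).
Qed.

Lemma linear_compose (f g : KQ -> KQ) :
  linear f -> linear g -> linear (fun x => f (g x)).
Proof.
by move=> lf lg c u v; apply: etrans (congr1 f (lg c u v)) (lf c _ _).
Qed.

Lemma kq_mulA : associative kq_mul.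
Proof.
move=> x y z; move: x; apply: kq_ext => [||p].
- exact: kq_linl.
- exact: linear_compose (kq_linl z) (kq_linl y).
move: y; apply: kq_ext => [||q].
- exact: linear_compose (kq_linr _) (kq_linl z).
- exact: linear_compose (kq_linl z) (kq_linr _).
move: z; apply: kq_ext => [||r].
- exact: linear_compose (kq_linr _) (kq_linr _).
- exact: kq_linr.
transitivity (kq_opt (obind (qcomp p) (qcomp q r))).
  apply: etrans (congr1 (kq_mul _) (kq_mulBB q r)) _.
  by case: (qcomp q r) => [u|]; [apply: kq_mulBB|apply: kq_mul0r].
rewrite qcompA; apply/esym.
apply: etrans (congr1 (kq_mul^~ _) (kq_mulBB p q)) _.
by case: (qcomp p q) => [u|]; [apply: kq_mulBB|apply: kq_mul0l].
Qed.

Lemma kq_mul1l : left_id kq_one kq_mul.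
Proof.
apply: kq_ext => [||p]; [exact: kq_linr|by []|].
apply: etrans (kq_suml _ _ _ _) _; rewrite (bigD1 (qstart p)) //=.
rewrite kq_mulBB qcomp_vl eqxx big1 ?addr0 // => v vp.
by rewrite kq_mulBB qcomp_vl (negPf vp).
Qed.

Lemma kq_mul1r : right_id kq_one kq_mul.
Proof.
apply: (@kq_ext (kq_mul^~ kq_one)) => [||p]; [exact: kq_linl|by []|].
apply: etrans (kq_sumr _ _ _ _) _; rewrite (bigD1 (qend p)) //=.
rewrite kq_mulBB qcomp_vr eqxx big1 ?addr0 // => v vp.
by rewrite kq_mulBB qcomp_vr eq_sym (negPf vp).
Qed.

HB.instance Definition _ := GRing.Zmodule_isPzRing.Build KQ
  kq_mulA kq_mul1l kq_mul1r kq_mulDl kq_mulDr.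

Lemma kq_scaleAl (c : K) (x y : KQ) : c *: (x * y) = (c *: x) * y.
Proof. by rewrite [RHS]kq_mulZl. Qed.

Lemma kq_scaleAr (c : K) (x y : KQ) : c *: (x * y) = x * (c *: y).
Proof. by rewrite [RHS]kq_mulZr. Qed.

End PathAlgebra.

Section Ideals.
Variable B : pzRingType.

Definition two_sided_ideal (J : B -> Prop) : Prop :=
  [/\ J 0, forall x y, J x -> J y -> J (x + y)
    & forall x y z, J y -> J (x * y * z)].

Definition ideal_generated (S : B -> Prop) (x : B) : Prop :=
  forall J, two_sided_ideal J -> (forall s, S s -> J s) -> J x.

End Ideals.

(* A is (isomorphic to) the quotient algebra KQ / J; the path algebra is not
   packaged as an [algType], whose instances are nontrivial rings, since the
   quiver may be empty *)
Definition is_path_algebra_quotient (K : fieldType) (Q : quiver)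
    (J : path_algebra K Q -> Prop) (A : falgType K) : Prop :=
  exists pi : {rmorphism path_algebra K Q -> A},
    [/\ scalable pi, forall a, exists x, pi x = a
      & forall x, pi x = 0 <-> J x].

Section RootSystems.
Variables (R : realFieldType) (n : nat).

Definition bilin (G : 'M[R]_n) (x y : 'cV[R]_n) : R := (x^T *m G *m y) 0 0.

Definition reflection (G : 'M[R]_n) (a : 'cV[R]_n) : 'M[R]_n :=
  1%:M - (2 / bilin G a a) *: (a *m a^T *m G).

(* The ambient Euclidean space is R^n with the inner product of Gram matrix
   [gram]; endomorphisms are matrices acting on column vectors, so that matrix
   product is composition of maps. *)
Record root_system := RootSystem {
  gram : 'M[R]_n;
  roots : seq 'cV[R]_n;
  gram_sym : gram^T = gram;
  gram_pos : forall x, x != 0 -> 0 < bilin gram x x;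
  roots_span : (<<roots>> = fullv)%VS;
  roots_neq0 : 0 \notin roots;
  roots_stable : {in roots &, forall a b, reflection gram a *m b \in roots};
  roots_integral : {in roots &, forall a b,
    exists z : int, z%:~R = 2 * bilin gram a b / bilin gram a a};
  roots_reduced : {in roots, forall a t,
    t *: a \in roots -> t = 1 \/ t = -1} }.

Definition is_base (Phi : root_system) (alpha : 'I_n -> 'cV[R]_n) : Prop :=
  [/\ forall i, alpha i \in roots Phi,
      basis_of fullv (codom alpha)
    & {in roots Phi, forall b, exists k : 'I_n -> nat,
        b = \sum_i alpha i *+ k i \/ b = - \sum_i alpha i *+ k i}].

Definition is_cartan_matrix (Phi : root_system) (alpha : 'I_n -> 'cV[R]_n)
    (C : 'M[int]_n) : Prop :=
  forall i j, (C i j)%:~R = 2 * bilin (gram Phi) (alpha i) (alpha j) /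
                            bilin (gram Phi) (alpha i) (alpha i).

Definition is_symmetrizer (C : 'M[int]_n) (d : 'I_n -> nat) : Prop :=
  (forall i, (0 < d i)%N) /\
  (diag_mx (\row_i (d i)%:Z) *m C)^T = diag_mx (\row_i (d i)%:Z) *m C.

Section Coxeter.
Variables (Phi : root_system) (alpha : 'I_n -> 'cV[R]_n).

Definition simple_reflection (i : 'I_n) : 'M[R]_n :=
  reflection (gram Phi) (alpha i).

(* w is an expression of c as a product of all simple reflections, each
   occurring once *)
Definition coxeter_expression (c : 'M[R]_n) (w : seq 'I_n) : bool :=
  perm_eq w (enum 'I_n) &&
  (c == \big[mulmx/1%:M]_(i <- w) simple_reflection i).

Definition is_coxeter_element (c : 'M[R]_n) : Prop :=
  exists w, coxeter_expression c w.

(* c = ... s_i ... s_j ...; for simple reflections that do not commute, the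
   order is the same in all expressions of c *)
Definition precedes (c : 'M[R]_n) (i j : 'I_n) : bool :=
  [exists w : n.-tuple 'I_n,
    coxeter_expression c w && (index i w < index j w)%N].

Definition coxeter_arrow (c : 'M[R]_n) (i j : 'I_n) : bool :=
  precedes c i j &&
  (simple_reflection i *m simple_reflection j
     != simple_reflection j *m simple_reflection i).

(* [inl i] is the loop at i and [inr (i, j)] the arrow from i to j *)
Definition gls_quiver (c : 'M[R]_n) : quiver :=
  @Quiver 'I_n
    ('I_n + {u : 'I_n * 'I_n | coxeter_arrow c u.1 u.2})%type
    (fun a => match a with inl i => i | inr u => (val u).1 end)
    (fun a => match a with inl i => i | inr u => (val u).2 end).

Variables (K : fieldType) (c : 'M[R]_n).
Local Notation KQ := (path_algebra K (gls_quiver c)).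

Definition gls_loop (i : 'I_n) : KQ :=
  kq_basis K (arrow_path (inl i : arrow (gls_quiver c))).

Definition gls_arrow (i j : 'I_n) (h : coxeter_arrow c i j) : KQ :=
  kq_basis K (arrow_path (inr (exist _ (i, j) h) : arrow (gls_quiver c))).

Inductive gls_relation (C : 'M[int]_n) (d : 'I_n -> nat) : KQ -> Prop :=
| gls_nilpotency i : gls_relation C d (gls_loop i ^+ d i)
| gls_commutation i j (h : coxeter_arrow c i j) :
    gls_relation C d (gls_loop i ^+ `|C j i|%N * gls_arrow h
                      - gls_arrow h * gls_loop j ^+ `|C i j|%N).

Definition is_gls_algebra (C : 'M[int]_n) (d : 'I_n -> nat) (H : falgType K) :
    Prop :=
  is_path_algebra_quotient (ideal_generated (gls_relation C d)) H.

End Coxeter.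
End RootSystems.

Section Opposite.
Variables (K : fieldType) (A : falgType K).

HB.instance Definition _ := GRing.Lmodule.copy A^c A.

Fact opp_scaleAl (k : K) (x y : A^c) :
  k *: (x * y : A^c) = (k *: x : A^c) * y :> A^c.
Proof. exact: (@scalerAr K A k y x). Qed.

HB.instance Definition _ :=
  GRing.Lmodule_isLalgebra.Build K A^c opp_scaleAl.

Fact opp_scaleAr (k : K) (x y : A^c) :
  k *: (x * y : A^c) = x * (k *: y : A^c) :> A^c.
Proof. exact: (@scalerAl K A k y x). Qed.

HB.instance Definition _ := GRing.Lalgebra_isAlgebra.Build K A^c opp_scaleAr.

HB.instance Definition _ := Vector.copy A^c A.

End Opposite.

Lemma opp_mulE (K : fieldType) (A : falgType K) (x y : A) :
  @GRing.mul (A^c : falgType K) x y = y * x.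
Proof. by []. Qed.

(* Finitely generated right A-modules, i.e. finite dimensional K-vector spaces
   with a right action of A; mod A^op is [rmodule A^c]. *)
Record rmodule (K : fieldType) (A : falgType K) := RModule {
  rcarrier :> vectType K;
  ract : rcarrier -> A -> rcarrier;
  ract_linearl : forall a, linear (ract^~ a);
  ract_linearr : forall v, linear (ract v);
  ract1 : forall v, ract v 1 = v;
  ractM : forall v a b, ract v (a * b) = ract (ract v a) b }.

Section Modules.
Variables (K : fieldType) (A : falgType K).
Implicit Types M N P X Y : rmodule A.

Definition is_hom M N (f : 'Hom(M, N)) : Prop :=
  forall v a, f (ract v a) = ract (f v) a.

Definition iso M N : Prop :=
  exists f : 'Hom(M, N),
    [/\ is_hom f, lker f = 0%VS & limg f = fullv].

Definition no_hom M N : Prop := forall f : 'Hom(M, N), is_hom f -> f = 0.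

Definition is_zero M : Prop := forall v : M, v = 0.

Definition act_lfun M (a : A) : 'End(M) := linfun (fun v => ract v a).

Lemma act_lfunE M a v : act_lfun M a v = ract v a.
Proof.
pose f : {linear M -> M} := HB.pack (fun v : M => ract v a)
  (GRing.isLinear.Build K M M _ (fun v : M => ract v a) (ract_linearl a)).
exact: (lfunE f).
Qed.

Definition zero_act (v : 'rV[K]_0) (a : A) : 'rV[K]_0 := v.

Definition zero_module : rmodule A.
Proof.
exists ('rV[K]_0 : vectType K) zero_act => //= v k x y.
by rewrite [LHS]thinmx0 [RHS]thinmx0.
Defined.

Definition dsum_act M N (v : (M * N)%type) (a : A) : (M * N)%type :=
  (ract v.1 a, ract v.2 a).

Definition dsum M N : rmodule A.
Proof.
exists ((M * N)%type : vectType K) (@dsum_act M N).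
- by move=> a k u v; rewrite /dsum_act /= !ract_linearl.
- by move=> v k a b; rewrite /dsum_act /= !ract_linearr.
- by case=> u v; rewrite /dsum_act /= !ract1.
- by move=> v a b; rewrite /dsum_act /= !ractM.
Defined.

Definition regular_module : rmodule A.
Proof.
exists (A : vectType K) (fun v a => v * a).
- by move=> a k u v; rewrite mulrDl -scalerAl.
- by move=> v k a b; rewrite mulrDr -scalerAr.
- exact: mulr1.
- exact: mulrA.
Defined.

Definition indecomposable M : Prop :=
  ~ is_zero M /\
  forall X Y, iso M (dsum X Y) -> is_zero X \/ is_zero Y.

Definition indec_summand X M : Prop :=
  indecomposable X /\ exists Y, iso M (dsum X Y).

(* |M|, the number of isomorphism classes of indecomposable direct summands:
   the size of a complete list of representatives *)
Definition nsummands M : nat :=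
  xget 0%N [set k | exists X : 'I_k -> rmodule A,
    [/\ forall i, indec_summand (X i) M,
        forall i j, iso (X i) (X j) -> i = j
      & forall Y, indec_summand Y M -> exists i, iso Y (X i)]]%classic.

Definition basic M : Prop :=
  exists k (X : 'I_k -> rmodule A),
    [/\ forall i, indecomposable (X i),
        forall i j, iso (X i) (X j) -> i = j
      & iso M (\big[dsum/zero_module]_(i < k) X i)].

Definition projective P : Prop :=
  forall M N (g : 'Hom(M, N)) (f : 'Hom(P, N)),
    is_hom g -> limg g = fullv -> is_hom f ->
    exists2 h : 'Hom(P, M), is_hom h & (g \o h)%VF = f.

Definition Fac M N : Prop :=
  exists k (f : 'Hom(\big[dsum/zero_module]_(i < k) M, N)),
    is_hom f /\ limg f = fullv.

(* f : P -> M is a projective cover of its image *)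
Definition cover_of_image P M (f : 'Hom(P, M)) : Prop :=
  [/\ projective P, is_hom f
    & forall X (g : 'Hom(X, P)), is_hom g ->
        limg (f \o g)%VF = limg f -> limg g = fullv].

(* f1 : P1 -> P0 and f0 : P0 -> M form a minimal projective presentation *)
Definition minimal_presentation P1 P0 M (f1 : 'Hom(P1, P0))
    (f0 : 'Hom(P0, M)) : Prop :=
  [/\ cover_of_image f0, limg f0 = fullv, cover_of_image f1
    & limg f1 = lker f0].

(* The subspace Hom_A(M, N) of Hom_K(M, N), see [mem_hom_space]. *)
Definition hom_defect M N (a : A) (f : 'Hom(M, N)) : 'Hom(M, N) :=
  ((f \o act_lfun M a) - (act_lfun N a \o f))%VF.

Definition hom_space M N : {vspace 'Hom(M, N)} :=
  (\bigcap_(i < \dim {:A}) lker (linfun (hom_defect (vbasis {:A})`_i)))%VS.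

Lemma mem_hom_space M N (f : 'Hom(M, N)) : f \in hom_space M N <-> is_hom f.
Proof.
have lin a : linear (@hom_defect M N a).
  move=> k g h; rewrite /hom_defect comp_lfunDl comp_lfunDr -comp_lfunZl.
  by rewrite -comp_lfunZr opprD addrACA scalerBr.
have defE a g : linfun (@hom_defect M N a) g = hom_defect a g.
  pose d : {linear 'Hom(M, N) -> 'Hom(M, N)} := HB.pack (@hom_defect M N a)
    (GRing.isLinear.Build K _ _ _ (@hom_defect M N a) (lin a)).
  exact: (lfunE d).
have defP a : hom_defect a f = 0 <-> forall v, f (ract v a) = ract (f v) a.
  split=> [/lfunP d0 v|fa].
    apply/eqP; rewrite -subr_eq0; have := d0 v.
    by rewrite add_lfunE opp_lfunE !comp_lfunE !act_lfunE lfunE /= => ->.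
  apply/lfunP=> v; rewrite add_lfunE opp_lfunE !comp_lfunE !act_lfunE lfunE /=.
  by rewrite fa subrr.
rewrite memvE; split=> [/subv_bigcapP fH v a|fh]; last first.
  apply/subv_bigcapP=> i _; rewrite -memvE memv_ker defE; apply/eqP/defP=> v.
  exact: fh.
rewrite (coord_vbasis (memvf a)).
pose ra (N' : rmodule A) (w : N') : {linear A -> N'} := HB.pack (ract w)
  (GRing.isLinear.Build K A N' _ (ract w) (ract_linearr w)).
rewrite [ract v _](linear_sum (ra _ v)) [ract (f v) _](linear_sum (ra _ (f v))).
rewrite linear_sum; apply: eq_bigr => i _.
rewrite (linearZ_LR (ra _ v)) (linearZ_LR (ra _ (f v))) linearZ /=.
congr (_ *: _); move: v; apply/defP; apply/eqP.
by rewrite -defE -memv_ker memvE fH.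
Qed.

End Modules.

Section Duality.
Variables (K : fieldType) (A : falgType K).

Lemma dual_act_linear (B : falgType K) (M : rmodule B) :
  (forall a, linear (fun f : 'Hom(M, K^o) => (f \o act_lfun M a)%VF)) *
  (forall f : 'Hom(M, K^o), linear (fun a => (f \o act_lfun M a)%VF)).
Proof.
split=> [a k f g|f k a b]; first by rewrite comp_lfunDl -comp_lfunZl.
apply/lfunP=> v; rewrite add_lfunE scale_lfunE !comp_lfunE !act_lfunE.
by rewrite ract_linearr linearP.
Qed.

(* The standard duality D = Hom_K(-, K) from mod A to mod A^op. *)
Definition dual (M : rmodule A) : rmodule A^c.
Proof.
refine (@RModule K A^c ('Hom(M, K^o) : vectType K)
  (fun f (a : A^c) => (f \o @act_lfun K A M a)%VF) _ _ _ _).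
- exact: (@dual_act_linear A M).1.
- exact: (@dual_act_linear A M).2.
- by move=> f; apply/lfunP=> v; rewrite comp_lfunE act_lfunE ract1.
- move=> f a b; apply/lfunP=> v.
  by rewrite !comp_lfunE !act_lfunE -ractM.
Defined.

(* The standard duality from mod A^op to mod A. *)
Definition dual_op (M : rmodule A^c) : rmodule A.
Proof.
refine (@RModule K A ('Hom(M, K^o) : vectType K)
  (fun f (a : A) => (f \o @act_lfun K A^c M a)%VF) _ _ _ _).
- exact: (@dual_act_linear A^c M).1.
- exact: (@dual_act_linear A^c M).2.
- by move=> f; apply/lfunP=> v; rewrite comp_lfunE act_lfunE ract1.
- move=> f a b; apply/lfunP=> v.
  by rewrite !comp_lfunE !act_lfunE -ractM.
Defined.

(* Hom_A(P, A) with the action (h a)(p) = a h(p) of A^op. *)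
Lemma regular_dual_subproof (P : rmodule A)
    (h : subvs_of (hom_space P (regular_module A))) (a : A) :
  (amull a \o vsval h)%VF \in hom_space P (regular_module A).
Proof.
apply/mem_hom_space => v b; rewrite !comp_lfunE.
have /mem_hom_space -> := subvsP h.
by rewrite !lfunE /= mulrA.
Qed.

Definition regular_dual (P : rmodule A) : rmodule A^c.
Proof.
refine (@RModule K A^c
  (subvs_of (hom_space P (regular_module A)) : vectType K)
  (fun h (a : A^c) => Subvs (@regular_dual_subproof P h a)) _ _ _ _).
- move=> a k f g; apply/val_inj=> /=.
  by rewrite comp_lfunDr -comp_lfunZr.
- move=> f k a b; apply/val_inj=> /=.
  by rewrite linearP comp_lfunDl -comp_lfunZl.
- by move=> f; apply/val_inj=> /=; rewrite amull1 comp_lfun1l.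
- by move=> f a b; apply/val_inj=> /=; rewrite amullM comp_lfunA.
Defined.

(* X = Tr M is the cokernel of Hom_A(f1, A) : Hom_A(P0, A) -> Hom_A(P1, A) for a
   minimal projective presentation P1 -> P0 -> M -> 0. *)
Definition is_transpose (M : rmodule A) (X : rmodule A^c) : Prop :=
  exists (P1 P0 : rmodule A) (f1 : 'Hom(P1, P0)) (f0 : 'Hom(P0, M)),
    minimal_presentation f1 f0 /\
    exists q : 'Hom(regular_dual P1, X),
      [/\ is_hom q, limg q = fullv
        & forall h : regular_dual P1, q h = 0 <->
            exists g : regular_dual P0, vsval h = (vsval g \o f1)%VF].

(* N is the Auslander-Reiten translate D Tr M of M. *)
Definition is_ar_translate (M N : rmodule A) : Prop :=
  exists2 X, is_transpose M X & iso N (dual_op X).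

End Duality.

Section TauTilting.
Variables (K : fieldType) (A : falgType K).
Implicit Types M N P : rmodule A.

Definition tau_rigid M : Prop :=
  exists2 N, is_ar_translate M N & no_hom M N.

Definition tau_tilting_pair M P : Prop :=
  [/\ projective P, tau_rigid M, no_hom P M
    & (nsummands M + nsummands P = nsummands (regular_module A))%N].

Definition support_tau_tilting M : Prop := exists P, tau_tilting_pair M P.

(* a vertex of the support tau-tilting quiver *)
Definition basic_stt M : Prop := basic M /\ support_tau_tilting M.

Definition Fac_gt M N : Prop :=
  (forall X, Fac N X -> Fac M X) /\ ~ (forall X, Fac M X -> Fac N X).

Definition stt_arrow M N : Prop :=
  [/\ basic_stt M, basic_stt N, Fac_gt M N
    & ~ exists L, [/\ support_tau_tilting L, Fac_gt M L & Fac_gt L N]].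

End TauTilting.

(* Main.v *)
Require Import Defs.
From HB Require Import structures.
From mathcomp Require Import all_boot all_order all_algebra all_field.
From mathcomp Require Import boolp finmap monalg.
From mathcomp Require Import ring lra zify.

Set Implicit Arguments.
Unset Strict Implicit.
Unset Printing Implicit Defensive.

Import Order.TTheory GRing.Theory Num.Theory.
Local Open Scope ring_scope.

(** Tau-rigidity of M amounts to Ext^1(M, Fac M) = 0 (Auslander-Smalo), and the
    support tau-tilting modules are the modules that are maximal with this property
    among those with the same support.  Over a GLS algebra, a tau-rigid module M and
    its dual both have projective dimension at most one: by induction along the
    acyclic quiver one splits off the part of M at a sink i, which is a submodule
    whose Ext^1 with its own quotients vanishes, hence is free over the local algebra
    K[eps_i]/(eps_i^d_i); and this local algebra has projective dimension at most one
    over H on both sides.  Consequently Ext^1(M, M) = 0 already characterises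
    tau-rigidity, which is therefore preserved by D.  Two support tau-tilting modules
    with the same support satisfy Fac M >= Fac M' if and only if Ext^1(M, M') = 0,
    and D reverses this relation.  Along an arrow M -> M' with |M| <> |M'|, on the
    other hand, M' is a direct summand of M, and D preserves such arrows.

    The projective dimension of the local algebras follows from the freeness of the
    bimodules of arrows, proved by letting the path algebra act on an explicit free
    module, and from |C_ij| |C_ji| < 4.  The quiver is acyclic because c determines
    the order of noncommuting simple reflections: if c x = x - alpha_j, then
    (alpha_i, x) is (alpha_i, alpha_j) or 0 according as s_i precedes s_j or not. *)

(** * Modules and extensions *)

(** Of Ext^1 only the vanishing and, for projective dimension at most one, the right exactness ever
    matter; so classes are cocycles, and neither Ext^2 nor long exact sequences are formed. Modules
    are compared through add and Fac. The bound |M| + |P| <= |A| and its sharpness come from linear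
    algebra over the rationals: for N in Fac M, dim Hom(M, N) is a combination of the dim Hom(G, N)
    over the projectives G in the support of M, with the g-vector as coefficients, and suitable
    pairs of test modules N make a matrix of differences diagonal. Hence |M| counts the supported
    projectives when M is support tau-tilting, and along an arrow |M| = |M'| means that the supports
    agree. If they differ, M has up to isomorphism a single indecomposable summand X outside add M'.
    The obstacle is a support tau-tilting module strictly between DM and DM' whose support is still
    that of M: for its dual Z, the vanishing of Ext^1(X, Z) follows from a Nakayama argument on a
    minimal system of generators over End(X). Duality is taken along a pair of inverse
    anti-isomorphisms, so that each lemma on D applies again on the way back. *)

Section LinearAlgebra.
Variable K : fieldType.
Implicit Types U V W : vectType K.

(** Noetherian and Artinian arguments become the choice of a candidate of extreme dimension. The
    candidates are subspaces, lists of maps or indexed families, hence the arbitrary type. *)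
Lemma exists_maximal (T : Type) (P : T -> Prop) (m : T -> nat) (b : nat) x0 :
  P x0 -> (forall x, P x -> (m x <= b)%N) ->
  exists2 x, P x & forall y, P y -> (m y <= m x)%N.
Proof.
move=> Px0 bP; pose p k := `[< exists2 x, P x & m x = k >].
have p0 : exists k, p k by exists (m x0); apply/asboolP; exists x0.
have pb k : p k -> (k <= b)%N by move=> /asboolP[x Px <-]; apply: bP.
have [k /asboolP[x Px <-] kmax] := ex_maxnP p0 pb.
by exists x => // y Py; apply: kmax; apply/asboolP; exists y.
Qed.

Lemma exists_minimal (T : Type) (P : T -> Prop) (m : T -> nat) x0 :
  P x0 -> exists2 x, P x & forall y, P y -> (m x <= m y)%N.
Proof.
move=> Px0; pose p k := `[< exists2 x, P x & m x = k >].
have p0 : exists k, p k by exists (m x0); apply/asboolP; exists x0.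
have [k /asboolP[x Px <-] kmin] := ex_minnP p0.
by exists x => // y Py; apply: kmin; apply/asboolP; exists y.
Qed.

Lemma lfun_exists U V (f : U -> V) :
  linear f -> exists g : 'Hom(U, V), forall x, g x = f x.
Proof.
move=> lf; pose f' : {linear U -> V} := HB.pack f (GRing.isLinear.Build K U V _ f lf).
by exists (linfun f') => x; rewrite lfunE.
Qed.

Lemma bilin_exists U V W (f : U -> V -> W) :
  (forall v, linear (f^~ v)) -> (forall u, linear (f u)) ->
  exists g : 'Hom(U, 'Hom(V, W)), forall u v, g u v = f u v.
Proof.
move=> ll lr.
have H u : exists g : 'Hom(V, W), forall v, g v = f u v by apply: lfun_exists.
have [h hE] := choice H.
have [|g gE] := @lfun_exists U _ h.
  move=> k x y; apply/lfunP=> v; rewrite add_lfunE scale_lfunE !hE.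
  exact: (ll v).
by exists g => u v; rewrite gE hE.
Qed.

Lemma injP U V (f : 'Hom(U, V)) : lker f = 0%VS <-> forall u, f u = 0 -> u = 0.
Proof.
split=> [f0 u fu|f0]; first by apply/eqP; rewrite -memv0 -f0 memv_ker fu.
apply/eqP; rewrite -subv0; apply/subvP => u; rewrite memv_ker memv0.
by move=> /eqP /f0 ->.
Qed.

Lemma surjP U V (f : 'Hom(U, V)) :
  limg f = fullv <-> forall v, exists u, v = f u.
Proof.
split=> [f1 v|f1].
  have /memv_imgP[u _ ->] : v \in limg f by rewrite f1 memvf.
  by exists u.
apply/eqP; rewrite eqEsubv subvf; apply/subvP=> v _.
by have [u ->] := f1 v; rewrite memv_img ?memvf.
Qed.

Lemma surj_section U V (f : 'Hom(U, V)) :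
  limg f = fullv -> exists s : 'Hom(V, U), forall v, f (s v) = v.
Proof.
by move=> f1; exists (f^-1)%VF => v; apply: limg_lfunVK; rewrite f1 memvf.
Qed.

Lemma inj_retract U V (f : 'Hom(U, V)) :
  lker f = 0%VS -> exists s : 'Hom(V, U), forall u, s (f u) = u.
Proof. by move=> /eqP f0; exists (f^-1)%VF => u; apply: lker0_lfunK. Qed.

Lemma vspace_exists V (P : V -> Prop) :
  P 0 -> (forall k u v, P u -> P v -> P (k *: u + v)) ->
  exists U : {vspace V}, forall v, v \in U <-> P v.
Proof.
move=> P0 PL.
have [||U PU Umax] := @exists_maximal {vspace V}
  (fun U : {vspace V} => forall v, v \in U -> P v) (fun U : {vspace V} => \dim U) (dim V) 0%VS.
- by move=> v; rewrite memv0 => /eqP ->.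
- by move=> U _; rewrite -dimvf dimvS ?subvf.
exists U => v; split=> [/PU //|Pv].
(* Adding to U a vector that satisfies P keeps all of U inside P, so a largest U already contains
   it. *)
have /Umax dU : forall w, w \in (U + <[v]>)%VS -> P w.
  move=> w /memv_addP[u uU [_ /vlineP[k ->] ->]].
  by rewrite addrC; apply: PL => //; apply: PU.
have : (U + <[v]> <= U)%VS.
  by rewrite -(geq_leqif (dimv_leqif_sup (addvSl U <[v]>))).
by move=> /subvP; apply; apply: (subvP (addvSr U <[v]>%VS)); apply: memv_line.
Qed.

(** The intersection of all subspaces containing P. Traces and radicals, spanned by infinitely many
    images, are handled through this universal property. *)
Lemma span_exists V (P : V -> Prop) :
  exists2 U : {vspace V}, (forall v, P v -> v \in U)
    & forall W : {vspace V}, (forall v, P v -> v \in W) -> (U <= W)%VS.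
Proof.
have [||U UP] := @vspace_exists V (fun v => forall W : {vspace V}, (forall v, P v -> v \in W) -> v \in W).
- by move=> W _; apply: mem0v.
- by move=> k u v Hu Hv W PW; rewrite memvD ?memvZ // ?Hu ?Hv.
exists U => [v Pv|W PW]; first by apply/UP => W; apply.
by apply/subvP=> v /UP; apply.
Qed.

Lemma separate V (U : {vspace V}) v : v \notin U ->
  exists2 l : 'Hom(V, K^o), (U <= lker l)%VS & l v != 0.
Proof.
move=> vU; pose w := v - projv U v.
have w0 : w != 0.
  by apply: contra vU; rewrite subr_eq0 => /eqP ->; rewrite memv_proj.
pose f := (projv <[w]> \o (\1 - projv U))%VF.
have fE x : f x = projv <[w]> (x - projv U x).
  by rewrite comp_lfunE add_lfunE opp_lfunE id_lfunE.
have [|l lE] := @lfun_exists V K^o (fun x => coord [tuple w] ord0 (f x)).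
  by move=> k x y; rewrite !linearP.
exists l; first by apply/subvP=> u uU; rewrite memv_ker lE fE (projv_id uU) subrr !linear0.
rewrite lE fE projv_id ?memv_line //.
have fw : free [tuple w] by rewrite seq1_free.
have := coord_free ord0 ord0 fw.
by rewrite (_ : [tuple w]`_(@ord0 0) = w) // => ->; rewrite oner_neq0.
Qed.

Lemma reflexive_ev V (l : 'Hom('Hom(V, K^o), K^o)) :
  exists v : V, forall f, l f = f v.
Proof.
pose e := vbasis {:V}.
have H i : exists c : 'Hom(V, K^o), forall v, c v = coord e i v.
  by apply: lfun_exists => k x y; rewrite linearP.
have [c cE] := choice H.
exists (\sum_i l (c i) *: e`_i) => f.
have {1}-> : f = \sum_(i < \dim {:V}) f e`_i *: c i.
  apply/lfunP=> v; rewrite {1}(coord_vbasis (memvf v)) linear_sum sum_lfunE.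
  by apply: eq_bigr => i _; rewrite linearZ scale_lfunE cE [LHS]mulrC.
by rewrite !linear_sum; apply: eq_bigr => i _; rewrite !linearZ [LHS]mulrC.
Qed.

End LinearAlgebra.

Lemma pair_ext (T U : Type) (p q : T * U) : p.1 = q.1 -> p.2 = q.2 -> p = q.
Proof. by case: p q => [a b] [c d] /= -> ->. Qed.

(** * Submodules, quotients, and extensions given by cocycles *)

Section ModuleBasics.
Variables (K : fieldType) (A : falgType K).
Implicit Types L M N P X Y Z E : rmodule A.

Section Action.
Variable M : rmodule A.
Implicit Types (v : M) (a : A).

Lemma ractDl v w a : ract (v + w) a = ract v a + ract w a.
Proof. by rewrite -!act_lfunE linearD. Qed.
Lemma ractZl k v a : ract (k *: v) a = k *: ract v a.
Proof. by rewrite -!act_lfunE linearZ. Qed.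
Lemma ract0l a : ract (0 : M) a = 0.
Proof. by rewrite -!act_lfunE linear0. Qed.
Lemma ractNl v a : ract (- v) a = - ract v a.
Proof. by rewrite -!act_lfunE linearN. Qed.
Lemma ractBl v w a : ract (v - w) a = ract v a - ract w a.
Proof. by rewrite ractDl ractNl. Qed.
Lemma ract_suml I (r : seq I) (P : pred I) (F : I -> M) a :
  ract (\sum_(i <- r | P i) F i) a = \sum_(i <- r | P i) ract (F i) a.
Proof.
rewrite -act_lfunE linear_sum; apply: eq_bigr => i _; exact: act_lfunE.
Qed.

Lemma ract_lfun v : exists f : 'Hom(A, M), forall a, f a = ract v a.
Proof. exact/lfun_exists/ract_linearr. Qed.

Lemma ractDr v a b : ract v (a + b) = ract v a + ract v b.
Proof. by have [f fE] := ract_lfun v; rewrite -!fE linearD. Qed.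
Lemma ractZr k v a : ract v (k *: a) = k *: ract v a.
Proof. by have [f fE] := ract_lfun v; rewrite -!fE linearZ. Qed.
Lemma ract0r v : ract v (0 : A) = 0.
Proof. by have [f fE] := ract_lfun v; rewrite -!fE linear0. Qed.
Lemma ract_sumr I (r : seq I) (P : pred I) (F : I -> A) v :
  ract v (\sum_(i <- r | P i) F i) = \sum_(i <- r | P i) ract v (F i).
Proof.
have [f fE] := ract_lfun v; rewrite -fE linear_sum.
by apply: eq_bigr => i _; exact: fE.
Qed.
End Action.

Lemma hom_id M : is_hom (\1%VF : 'Hom(M, M)).
Proof. by move=> v a; rewrite !id_lfunE. Qed.
Lemma hom_comp M N P (g : 'Hom(N, P)) (f : 'Hom(M, N)) :
  is_hom g -> is_hom f -> is_hom (g \o f)%VF.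
Proof. by move=> hg hf v a; rewrite !comp_lfunE hf hg. Qed.
Lemma hom0 M N : is_hom (0 : 'Hom(M, N)).
Proof. by move=> v a; rewrite !zero_lfunE ract0l. Qed.
Lemma homD M N (f g : 'Hom(M, N)) : is_hom f -> is_hom g -> is_hom (f + g).
Proof. by move=> hf hg v a; rewrite !add_lfunE hf hg ractDl. Qed.
Lemma homN M N (f : 'Hom(M, N)) : is_hom f -> is_hom (- f).
Proof. by move=> hf v a; rewrite !opp_lfunE hf ractNl. Qed.
Lemma homB M N (f g : 'Hom(M, N)) : is_hom f -> is_hom g -> is_hom (f - g).
Proof. by move=> hf hg; apply/homD/homN. Qed.
Lemma homZ M N k (f : 'Hom(M, N)) : is_hom f -> is_hom (k *: f).
Proof. by move=> hf v a; rewrite !scale_lfunE hf ractZl. Qed.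
Lemma hom_sum M N I (r : seq I) (P : pred I) (F : I -> 'Hom(M, N)) :
  (forall i, is_hom (F i)) -> is_hom (\sum_(i <- r | P i) F i).
Proof.
move=> hF v a; rewrite !sum_lfunE ract_suml.
by apply: eq_bigr => i _; rewrite hF.
Qed.

Definition stable M (U : {vspace M}) := forall v a, v \in U -> ract v a \in U.

Definition ses N E X (i : 'Hom(N, E)) (p : 'Hom(E, X)) : Prop :=
  [/\ is_hom i, is_hom p, lker i = 0%VS, limg p = fullv
    & forall e, p e = 0 <-> exists n, e = i n].

Lemma submod_exists M (U : {vspace M}) : stable U ->
  exists (N : rmodule A) (i : 'Hom(N, M)), [/\ is_hom i, lker i = 0%VS & limg i = U].
Proof.
move=> sU; pose act (v : subvs_of U) (a : A) : subvs_of U := Subvs (sU _ a (subvsP v)).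
have actE v a : vsval (act v a) = ract (vsval v) a by [].
have l1 a : linear (act^~ a).
  by move=> k u v; apply/val_inj; rewrite /= ractDl ractZl.
have l2 v : linear (act v).
  by move=> k a b; apply/val_inj; rewrite /= ractDr ractZr.
have l3 v : act v 1 = v by apply/val_inj; rewrite /= ract1.
have l4 v a b : act v (a * b) = act (act v a) b by apply/val_inj; rewrite /= ractM.
pose N := RModule l1 l2 l3 l4.
have [i iE] := @lfun_exists K (subvs_of U) M vsval (fun k u v => erefl).
exists N, i; split.
- by move=> v a; rewrite !iE.
- by apply/injP=> u; rewrite iE => u0; apply/val_inj.
apply/vspaceP=> v; apply/memv_imgP/idP => [[u _ ->]|vU].
  by rewrite iE subvsP.
by exists (Subvs vU); rewrite ?memvf // iE.
Qed.

Lemma ker_stable M N (f : 'Hom(M, N)) : is_hom f -> stable (lker f).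
Proof. by move=> hf v a; rewrite !memv_ker hf => /eqP ->; rewrite ract0l. Qed.

Lemma img_stable M N (f : 'Hom(M, N)) U : is_hom f -> stable U -> stable (f @: U)%VS.
Proof.
by move=> hf sU _ a /memv_imgP[u uU ->]; rewrite -hf memv_img ?sU.
Qed.

Lemma full_stable M : stable (fullv : {vspace M}).
Proof. by move=> v a _; rewrite memvf. Qed.

(** The quotient is carried by a complement of U, with the action of M followed by the projection;
    stability of U makes this compatible with products. *)
Lemma quot_exists M (U : {vspace M}) : stable U ->
  exists (Q : rmodule A) (p : 'Hom(M, Q)), [/\ is_hom p, limg p = fullv & lker p = U].
Proof.
move=> sU; pose pi := daddv_pi U^C U; pose pi' := daddv_pi U U^C.
have cap0 : (U^C :&: U = 0)%VS by rewrite capvC capv_compl.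
have piE v : pi v + pi' v = v.
  by rewrite daddv_pi_add // addvC addv_complf memvf.
pose q v : subvs_of U^C := Subvs (memv_pi U^C U v).
have [p pE] : exists p : 'Hom(M, subvs_of U^C), forall v, p v = q v.
  by apply: lfun_exists => k u v; apply/val_inj; rewrite /= linearP.
have pv (v : subvs_of U^C) : p (vsval v) = v.
  by apply/val_inj; rewrite pE /= daddv_pi_id ?subvsP.
have kerp v : (p v == 0) = (v \in U).
  rewrite pE; apply/eqP/idP => [/(congr1 vsval)/= pi0|vU].
    by rewrite -[v]piE /pi pi0 add0r memv_pi.
  apply/val_inj => /=; apply: (addIr (pi' v)).
  by rewrite [LHS]piE add0r /pi' daddv_pi_id // capvC.
have surj_p : limg p = fullv by apply/surjP => v; exists (vsval v); rewrite pv.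
have pact v w a : p v = p w -> p (ract v a) = p (ract w a).
  move=> /eqP; rewrite -subr_eq0 -linearB kerp => /sU => /(_ a).
  by rewrite ractBl -kerp linearB subr_eq0 => /eqP.
pose act (v : subvs_of U^C) (a : A) := p (ract (vsval v) a).
have actE v a : act (p v) a = p (ract v a) by apply: pact; rewrite pv.
have l1 a : linear (act^~ a) by move=> k u v; rewrite /act /= ractDl ractZl linearP.
have l2 v : linear (act v) by move=> k a b; rewrite /act /= ractDr ractZr linearP.
have l3 v : act v 1 = v by rewrite /act ract1 pv.
have l4 v a b : act v (a * b) = act (act v a) b by rewrite [RHS]actE -ractM.
exists (RModule l1 l2 l3 l4), p; split=> //.
by apply/vspaceP=> v; rewrite memv_ker kerp.
Qed.

Lemma ses_sub M (U : {vspace M}) : stable U ->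
  exists (N Q : rmodule A) (i : 'Hom(N, M)) (p : 'Hom(M, Q)), ses i p /\ limg i = U.
Proof.
move=> sU; have [N [i [hi i0 iU]]] := submod_exists sU.
have [Q [p [hp p1 pU]]] := quot_exists sU.
exists N, Q, i, p; split=> //; split=> // e; split=> [pe|[n ->]].
  have /memv_imgP[n _ ->] : e \in limg i by rewrite iU -pU memv_ker pe.
  by exists n.
by apply/eqP; rewrite -memv_ker pU -iU memv_img ?memvf.
Qed.

Lemma ses_ker M N (f : 'Hom(M, N)) : is_hom f -> limg f = fullv ->
  exists (L : rmodule A) (i : 'Hom(L, M)), ses i f.
Proof.
move=> hf f1; have [L [i [hi i0 iU]]] := submod_exists (ker_stable hf).
exists L, i; split=> // e; split=> [fe|[n ->]].
  have /memv_imgP[n _ ->] : e \in limg i by rewrite iU memv_ker fe.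
  by exists n.
by apply/eqP; rewrite -memv_ker -iU memv_img ?memvf.
Qed.

(* Such a [D] is an extension of X by N: [D x a] measures the failure of a K-linear
   section to be A-linear, and [ext0 X N] says that Ext^1(X, N) = 0. *)
Definition cocycle X N (D : 'Hom(X, 'Hom(A, N))) : Prop :=
  forall x a b, D x (a * b) = ract (D x a) b + D (ract x a) b.

Definition coboundary X N (D : 'Hom(X, 'Hom(A, N))) : Prop :=
  exists t : 'Hom(X, N), forall x a, D x a = t (ract x a) - ract (t x) a.

Definition ext0 X N : Prop :=
  forall D : 'Hom(X, 'Hom(A, N)), cocycle D -> coboundary D.

(** The middle term is N * X with the action twisted by D: the cocycle identity is associativity,
    and it forces [D x 1 = 0], the unit law. *)
Lemma extension_exists X N (D : 'Hom(X, 'Hom(A, N))) : cocycle D ->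
  exists (E : rmodule A) (i : 'Hom(N, E)) (p : 'Hom(E, X)) (s : 'Hom(X, E)),
    [/\ ses i p, forall x, p (s x) = x, forall n, p (i n) = 0
      & forall x a, ract (s x) a = s (ract x a) + i (D x a)].
Proof.
move=> cD; pose act (v : (N * X)%type) (a : A) : (N * X)%type :=
  (ract v.1 a + D v.2 a, ract v.2 a).
have D1 x : D x 1 = 0.
  have := cD x 1 1; rewrite mulr1 !ract1 => /eqP.
  by rewrite -subr_eq0 opprD addrA subrr sub0r oppr_eq0 => /eqP.
have l1 a : linear (act^~ a).
  move=> k [n x] [n' x']; rewrite /act /= !ractDl !ractZl linearP.
  by rewrite add_lfunE scale_lfunE; apply: pair_ext; rewrite //= scalerDr addrACA.
have l2 v : linear (act v).
  move=> k a b; rewrite /act !ractDr !ractZr linearP; apply: pair_ext => //=.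
  by rewrite scalerDr addrACA.
have l3 v : act v 1 = v by case: v => n x; rewrite /act /= !ract1 D1 addr0.
have l4 v a b : act v (a * b) = act (act v a) b.
  by case: v => n x; rewrite /act /= !ractM ractDl cD addrA.
pose E := RModule l1 l2 l3 l4.
have [i iE] : exists i : 'Hom(N, E), forall n, i n = (n, 0) :> (N * X)%type.
  by apply: lfun_exists => k n n'; apply: pair_ext; rewrite /= ?scaler0 ?addr0.
have [p pE] : exists p : 'Hom(E, X), forall v, p v = v.2.
  by apply: lfun_exists.
have [s sE] : exists s : 'Hom(X, E), forall x, s x = (0, x) :> (N * X)%type.
  by apply: lfun_exists => k n n'; apply: pair_ext; rewrite /= ?scaler0 ?addr0.
exists E, i, p, s; split.
- split.
  + by move=> v a; rewrite !iE /= /act /= linear0 zero_lfunE addr0 ract0l.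
  + by move=> v a; rewrite !pE.
  + by apply/injP => u; rewrite iE => -[].
  + by apply/surjP => v; exists (s v); rewrite pE sE.
  + move=> [n x]; split=> [|[m]]; rewrite pE /=; last by rewrite iE => -[].
    by move=> ->; exists n; rewrite iE.
- by move=> x; rewrite pE sE.
- by move=> x; rewrite pE iE.
- move=> x a; rewrite !sE iE /= /act /= ract0l add0r.
  by apply: pair_ext; rewrite /= ?add0r ?addr0.
Qed.

Lemma power_exists M k : exists (P : rmodule A) (inn : 'I_k -> 'Hom(M, P))
    (pr : 'I_k -> 'Hom(P, M)),
  [/\ forall i, is_hom (inn i), forall i, is_hom (pr i),
      forall i j m, pr i (inn j m) = if i == j then m else 0
    & forall v, v = \sum_i inn i (pr i v)].
Proof.
pose act (v : {ffun 'I_k -> M}) (a : A) := [ffun i => ract (v i) a].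
have l1 a : linear (act^~ a).
  by move=> c u v; apply/ffunP=> i; rewrite !ffunE ractDl ractZl.
have l2 v : linear (act v).
  by move=> c a b; apply/ffunP=> i; rewrite !ffunE ractDr ractZr.
have l3 v : act v 1 = v by apply/ffunP=> i; rewrite !ffunE ract1.
have l4 v a b : act v (a * b) = act (act v a) b.
  by apply/ffunP=> i; rewrite !ffunE ractM.
pose P := RModule l1 l2 l3 l4.
have H1 i : exists f : 'Hom(M, P), forall m, f m = [ffun j => if j == i then m else 0].
  apply: lfun_exists => c u v; apply/ffunP=> j; rewrite !ffunE.
  by case: eqP; rewrite // scaler0 addr0.
have H2 i : exists f : 'Hom(P, M), forall v, f v = (v : {ffun 'I_k -> M}) i.
  by apply: lfun_exists => c u v; rewrite !ffunE.
have [inn innE] := choice H1; have [pr prE] := choice H2.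
exists P, inn, pr; split.
- move=> i m a; rewrite !innE; apply/ffunP=> j; rewrite !ffunE.
  by case: eqP; rewrite // ract0l.
- by move=> i v a; rewrite !prE /= ffunE.
- by move=> i j m; rewrite prE innE ffunE.
move=> v; apply/ffunP=> j; rewrite sum_ffunE (bigD1 j) //= innE ffunE eqxx prE.
by rewrite big1 ?addr0 // => i ij; rewrite innE ffunE eq_sym (negPf ij).
Qed.

Section DirectSum.
Variables M N : rmodule A.

Lemma dsum_maps : exists (i1 : 'Hom(M, dsum M N)) (i2 : 'Hom(N, dsum M N))
    (p1 : 'Hom(dsum M N, M)) (p2 : 'Hom(dsum M N, N)),
  [/\ is_hom i1, is_hom i2, is_hom p1 & is_hom p2] /\
  [/\ (forall m, p1 (i1 m) = m) /\ (forall m, p2 (i1 m) = 0),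
      (forall n, p1 (i2 n) = 0) /\ (forall n, p2 (i2 n) = n)
    & forall v, v = i1 (p1 v) + i2 (p2 v)].
Proof.
have [i1 i1E] : exists i : 'Hom(M, dsum M N), forall n, i n = (n, 0) :> (M * N)%type.
  by apply: lfun_exists => k n n'; apply: pair_ext; rewrite /= ?scaler0 ?addr0.
have [i2 i2E] : exists i : 'Hom(N, dsum M N), forall n, i n = (0, n) :> (M * N)%type.
  by apply: lfun_exists => k n n'; apply: pair_ext; rewrite /= ?scaler0 ?addr0.
have [p1 p1E] : exists p : 'Hom(dsum M N, M), forall v, p v = v.1 by apply: lfun_exists.
have [p2 p2E] : exists p : 'Hom(dsum M N, N), forall v, p v = v.2 by apply: lfun_exists.
exists i1, i2, p1, p2; split; split.
- by move=> v a; rewrite !i1E /= /dsum_act /= ract0l.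
- by move=> v a; rewrite !i2E /= /dsum_act /= ract0l.
- by move=> v a; rewrite !p1E.
- by move=> v a; rewrite !p2E.
- by split=> m; rewrite ?p1E ?p2E i1E.
- by split=> m; rewrite ?p1E ?p2E i2E.
- by move=> [u v]; rewrite i1E i2E p1E p2E /=; apply: pair_ext; rewrite /= ?addr0 ?add0r.
Qed.
End DirectSum.

End ModuleBasics.

(** * Exactness of Ext^1, the classes add and Fac, projective dimension at most one *)

Section Extensions.
Variables (K : fieldType) (A : falgType K).
Implicit Types L M N P X Y Z E Q U R B V W S T : rmodule A.

Lemma ses_retraction N E X (i : 'Hom(N, E)) (p : 'Hom(E, X)) (s : 'Hom(X, E)) :
  ses i p -> (forall x, p (s x) = x) ->
  exists r : 'Hom(E, N), [/\ forall n, r (i n) = n, forall n, p (i n) = 0,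
      forall x, r (s x) = 0 & forall e, e = i (r e) + s (p e)].
Proof.
move=> [hi hp i0 p1 ker] sE.
have [t tE] := inj_retract i0.
have pi n : p (i n) = 0 by apply/ker; exists n.
pose r := (t \o (\1 - (s \o p)))%VF.
have rE e : r e = t (e - s (p e)).
  by rewrite comp_lfunE add_lfunE opp_lfunE id_lfunE comp_lfunE.
exists r; split=> //.
- by move=> n; rewrite rE pi linear0 subr0 tE.
- by move=> x; rewrite rE sE subrr linear0.
move=> e; have [|n nE] := (ker (e - s (p e))).1; first by rewrite linearB /= sE subrr.
by rewrite rE nE tE -nE subrK.
Qed.

Lemma ses_split N E X (i : 'Hom(N, E)) (p : 'Hom(E, X)) : ses i p ->
  exists (s : 'Hom(X, E)) (r : 'Hom(E, N)),
  [/\ forall x, p (s x) = x, forall n, r (i n) = n, forall n, p (i n) = 0,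
      forall x, r (s x) = 0 & forall e, e = i (r e) + s (p e)].
Proof.
move=> sip; have [_ _ _ p1 _] := sip; have [s sE] := surj_section p1.
by have [r [ri pi rs e_id]] := ses_retraction sip sE; exists s, r.
Qed.

Lemma cocycle_map X Y N N' (D : 'Hom(X, 'Hom(A, N))) (f : 'Hom(Y, X)) (g : 'Hom(N, N')) :
  is_hom f -> is_hom g -> cocycle D ->
  exists2 D' : 'Hom(Y, 'Hom(A, N')), cocycle D' & forall y a, D' y a = g (D (f y) a).
Proof.
move=> hf hg cD; have [||D' DE] := @bilin_exists K Y A N' (fun y a => g (D (f y) a)).
- by move=> a k u v; rewrite !linearP add_lfunE scale_lfunE linearP.
- by move=> y k u v; rewrite !linearP.
by exists D' => // y a b; rewrite !DE cD hf linearD /= hg.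
Qed.

Lemma cocycleD X N (D D' : 'Hom(X, 'Hom(A, N))) :
  cocycle D -> cocycle D' -> cocycle (D + D').
Proof.
move=> cD cD' x a b; rewrite !add_lfunE cD cD' ractDl.
by rewrite addrACA.
Qed.

Lemma cocycleZ X N k (D : 'Hom(X, 'Hom(A, N))) : cocycle D -> cocycle (k *: D).
Proof. by move=> cD x a b; rewrite !scale_lfunE cD ractZl scalerDr. Qed.

Lemma cocycle0 X N : cocycle (0 : 'Hom(X, 'Hom(A, N))).
Proof. by move=> x a b; rewrite !zero_lfunE ract0l addr0. Qed.

Lemma cocycleB X N (D D' : 'Hom(X, 'Hom(A, N))) :
  cocycle D -> cocycle D' -> cocycle (D - D').
Proof. by move=> cD cD'; rewrite -scaleN1r; apply/cocycleD/cocycleZ. Qed.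

Lemma cocycle_sum X N (I : finType) (D : I -> 'Hom(X, 'Hom(A, N))) :
  (forall i, cocycle (D i)) -> cocycle (\sum_i D i).
Proof.
move=> cD; apply: (big_ind (@cocycle K A X N)) => //; first exact: cocycle0.
exact: cocycleD.
Qed.

Lemma delta_exists X N (t : 'Hom(X, N)) :
  exists2 D : 'Hom(X, 'Hom(A, N)), cocycle D
    & forall x a, D x a = t (ract x a) - ract (t x) a.
Proof.
have [||D DE] := @bilin_exists K X A N (fun x a => t (ract x a) - ract (t x) a).
- move=> a k u v; rewrite /= ractDl ractZl !linearP ractDl ractZl.
  by rewrite scalerBr opprD addrACA.
- move=> x k a b; rewrite /= !ractDr !ractZr linearP.
  by rewrite scalerBr opprD addrACA.
exists D => // x a b; rewrite !DE !ractM ractBl.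
by rewrite [RHS]addrC addrA subrK.
Qed.

Lemma cocycle_descend U M Q (i : 'Hom(U, M)) (p : 'Hom(M, Q)) N
    (D : 'Hom(M, 'Hom(A, N))) :
  ses i p -> cocycle D -> (forall u a, D (i u) a = 0) ->
  exists2 D' : 'Hom(Q, 'Hom(A, N)), cocycle D' & forall m a, D' (p m) a = D m a.
Proof.
move=> sip cD D0; have [s [r [ps ri pi rs e_id]]] := ses_split sip.
have [hi hp _ _ _] := sip.
have Ds m a : D (s (p m)) a = D m a.
  by rewrite [in RHS](e_id m) linearD add_lfunE D0 add0r.
exists (D \o s)%VF; last by move=> m a; rewrite comp_lfunE Ds.
move=> x a b; rewrite !comp_lfunE cD; congr (_ + _).
by rewrite -Ds hp ps.
Qed.

Lemma ext0_ses_r N' N N'' X (i : 'Hom(N', N)) (p : 'Hom(N, N'')) :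
  ses i p -> ext0 X N' -> ext0 X N'' -> ext0 X N.
Proof.
move=> sip e' e'' D cD; have [s [r [ps ri pi rs e_id]]] := ses_split sip.
have [hi hp _ _ ker] := sip.
have [D2 cD2 D2E] := cocycle_map (@hom_id _ _ X) hp cD.
have [t tE] := e'' _ cD2.
have [T cT TE] := delta_exists (s \o t)%VF.
have cDT := cocycleB cD cT.
pose F := (D - T).
have [F' F'E cF'] : exists2 F' : 'Hom(X, 'Hom(A, N')), (forall x a, i (F' x a) = F x a) & cocycle F'.
  have [||F' F'E] := @bilin_exists K X A N' (fun x a => r (F x a)).
  - by move=> a k u v; rewrite !linearP add_lfunE scale_lfunE linearP.
  - by move=> x k u v; rewrite !linearP.
  have iF x a : i (F' x a) = F x a.
    rewrite F'E [RHS]e_id.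
    have -> : p (F x a) = 0.
      rewrite /F !add_lfunE !opp_lfunE TE linearB /= linearB /= hp !comp_lfunE !ps.
      by have := D2E x a; rewrite id_lfunE tE => <-; rewrite subrr.
    by rewrite linear0 addr0.
  exists F' => // x a b; apply/eqP; rewrite -subr_eq0; apply/eqP.
  have [_ _ /injP i0 _ _] := sip; apply: i0.
  by rewrite linearB linearD /= hi !iF /F cDT subrr.
have [t' t'E] := e' _ cF'.
exists ((s \o t) + (i \o t'))%VF => x a.
have : D x a = F x a + T x a by rewrite /F add_lfunE opp_lfunE add_lfunE opp_lfunE subrK.
rewrite -F'E TE t'E => ->; rewrite linearB /= hi !add_lfunE !comp_lfunE ractDl.
by rewrite addrC opprD addrACA.
Qed.

Lemma ext0_ses_l U M Q (i : 'Hom(U, M)) (p : 'Hom(M, Q)) N :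
  ses i p -> ext0 U N -> ext0 Q N -> ext0 M N.
Proof.
move=> sip eU eQ D cD; have [s [r [ps ri pi rs e_id]]] := ses_split sip.
have [hi hp _ _ ker] := sip.
have [D1 cD1 D1E] := cocycle_map hi (@hom_id _ _ N) cD.
have [t tE] := eU _ cD1.
have [T cT TE] := delta_exists (t \o r)%VF.
have [|D2 cD2 D2E] := cocycle_descend sip (cocycleB cD cT).
  move=> u a; rewrite !add_lfunE !opp_lfunE TE !comp_lfunE -hi !ri -tE D1E id_lfunE.
  by rewrite subrr.
have [t2 t2E] := eQ _ cD2.
exists ((t \o r) + (t2 \o p))%VF => m a.
have : D m a = D2 (p m) a + T m a by rewrite D2E !add_lfunE !opp_lfunE subrK.
rewrite t2E TE => ->; rewrite -hp !add_lfunE !comp_lfunE ractDl.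
by rewrite addrC opprD addrACA.
Qed.

(* X belongs to add M. *)
Definition inadd M X : Prop :=
  exists (I : finType) (f : I -> 'Hom(X, M)) (g : I -> 'Hom(M, X)),
  [/\ forall i, is_hom (f i), forall i, is_hom (g i)
    & forall x, x = \sum_i g i (f i x)].

Lemma ext0_inadd_l M X N : inadd M X -> ext0 M N -> ext0 X N.
Proof.
move=> [I [f [g [hf hg fg]]]] eM D cD.
have H i : exists t : 'Hom(M, N), forall m a, D (g i m) a = t (ract m a) - ract (t m) a.
  have [D' cD' D'E] := cocycle_map (hg i) (@hom_id _ _ N) cD.
  have [t tE] := eM _ cD'.
  by exists t => m a; rewrite -tE D'E id_lfunE.
have [t tE] := choice H.
exists (\sum_i (t i \o f i))%VF => x a.
rewrite {1}(fg x) linear_sum sum_lfunE !sum_lfunE ract_suml -sumrB.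
by apply: eq_bigr => i _; rewrite /= tE !comp_lfunE hf.
Qed.

Lemma ext0_inadd_r N N' X : inadd N N' -> ext0 X N -> ext0 X N'.
Proof.
move=> [I [f [g [hf hg fg]]]] eM D cD.
have H i : exists t : 'Hom(X, N), forall x a, f i (D x a) = t (ract x a) - ract (t x) a.
  have [D' cD' D'E] := cocycle_map (@hom_id _ _ X) (hf i) cD.
  have [t tE] := eM _ cD'.
  by exists t => m a; rewrite -tE D'E id_lfunE.
have [t tE] := choice H.
exists (\sum_i (g i \o t i))%VF => x a.
rewrite {1}(fg (D x a)) !sum_lfunE ract_suml -sumrB.
by apply: eq_bigr => i _; rewrite /= tE !comp_lfunE linearB /= hg.
Qed.

(** For a K-linear section s of p, the defect of A-linearity of [s \o f] is the cocycle of the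
    pullback of the sequence along f; a primitive t of it corrects [s \o f] to a homomorphism. *)
Lemma hom_lift N E X Y (i : 'Hom(N, E)) (p : 'Hom(E, X)) (f : 'Hom(Y, X)) :
  ses i p -> ext0 Y N -> is_hom f ->
  exists2 h : 'Hom(Y, E), is_hom h & (p \o h)%VF = f.
Proof.
move=> sip eY hf; have [s [r [ps ri pi rs e_id]]] := ses_split sip.
have [hi hp /injP i0 _ ker] := sip.
have [||D DE] := @bilin_exists K Y A N (fun y a => r (ract (s (f y)) a)).
- by move=> a k u v; rewrite !linearP ractDl ractZl linearP.
- by move=> y k u v; rewrite ractDr ractZr linearP.
have sfE y a : ract (s (f y)) a = i (D y a) + s (f (ract y a)).
  by rewrite DE [LHS]e_id hp ps hf.
have [|t tE] := eY D.
  move=> y a b; rewrite DE ractM sfE ractDl linearD /= -hi ri; congr (_ + _).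
  by rewrite sfE linearD /= ri rs addr0.
exists ((s \o f) + (i \o t))%VF.
  move=> y a; rewrite !add_lfunE !comp_lfunE ractDl sfE tE -hi.
  by rewrite linearB /= addrAC subrK addrC.
by apply/lfunP=> y; rewrite comp_lfunE add_lfunE !comp_lfunE linearD /= ps pi addr0.
Qed.

(** As u vanishes on ker f1 it induces a map t on im f1 = ker p, and D is the class of the pushout
    of ker p -> P0 -> X along t. Its vanishing extends t to P0. *)
Lemma hom_extend P1 P0 X N (f1 : 'Hom(P1, P0)) (p : 'Hom(P0, X)) (u : 'Hom(P1, N)) :
  is_hom f1 -> is_hom p -> limg p = fullv -> limg f1 = lker p ->
  is_hom u -> (forall x, f1 x = 0 -> u x = 0) -> ext0 X N ->
  exists2 v : 'Hom(P0, N), is_hom v & (v \o f1)%VF = u.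
Proof.
move=> hf1 hp p1 f1p hu u0 eX.
have [s ps] := surj_section p1.
pose t := (u \o f1^-1)%VF.
have tf x : t (f1 x) = u x.
  rewrite comp_lfunE; apply/eqP; rewrite -subr_eq0 -linearB; apply/eqP/u0.
  by rewrite linearB /= limg_lfunVK ?subrr // memv_img ?memvf.
have inker y : p y = 0 -> exists x, y = f1 x.
  move=> py; have /memv_imgP[x _ ->] : y \in limg f1 by rewrite f1p memv_ker py.
  by exists x.
have th y a : p y = 0 -> t (ract y a) = ract (t y) a.
  by move=> /inker[x ->]; rewrite -hf1 !tf hu.
have [||D DE] := @bilin_exists K X A N (fun x a => t (ract (s x) a - s (ract x a))).
- move=> a k x y; rewrite /= -linearP; congr (t _).
  by rewrite !(linearP, ractDl, ractZl) /= scalerDr addrACA.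
- move=> x k a b; rewrite /= -linearP; congr (t _).
  by rewrite !(ractDr, ractZr, linearP) /= scalerDr addrACA.
have pD x a : p (ract (s x) a - s (ract x a)) = 0.
  by rewrite linearB /= hp !ps subrr.
have [|q qE] := eX D.
  move=> x a b; rewrite !DE -th ?pD // -linearD; congr (t _).
  by rewrite ractBl !ractM addrA subrK.
pose v := ((t \o (\1 - (s \o p))) - (q \o p))%VF.
have vE y : v y = t (y - s (p y)) - q (p y).
  by rewrite add_lfunE opp_lfunE !comp_lfunE add_lfunE opp_lfunE id_lfunE comp_lfunE.
exists v; last first.
  apply/lfunP=> x; rewrite comp_lfunE vE.
  have -> : p (f1 x) = 0 by apply/eqP; rewrite -memv_ker -f1p memv_img ?memvf.
  by rewrite !(linear0, subr0, addr0) tf.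
move=> y a; rewrite !vE ractBl hp -th; last by rewrite linearB /= ps subrr.
have := qE (p y) a; rewrite DE => /eqP; rewrite eq_sym subr_eq => /eqP ->.
rewrite opprD addrA -linearB; congr (t _ - _).
by rewrite ractBl opprB addrA subrK.
Qed.

Lemma section_coboundary N E X (i : 'Hom(N, E)) (p : 'Hom(E, X)) (s h : 'Hom(X, E))
    (D : 'Hom(X, 'Hom(A, N))) :
  ses i p -> (forall x, p (s x) = x) ->
  (forall x a, ract (s x) a = s (ract x a) + i (D x a)) ->
  is_hom h -> (forall x, p (h x) = x) -> coboundary D.
Proof.
move=> [hi hp i0 p1 ker] ps sE hh ph.
have [r rE] := inj_retract i0.
pose t := (r \o (h - s))%VF.
have itE y : i (t y) = h y - s y.
  rewrite comp_lfunE add_lfunE opp_lfunE.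
  have [|n ->] := (ker (h y - s y)).1; first by rewrite linearB /= ph ps subrr.
  by rewrite rE.
exists t => x a.
move/injP: i0 => i0; apply/eqP; rewrite -subr_eq0; apply/eqP/i0.
rewrite 2!linearB /= hi !itE ractBl hh sE.
by rewrite [- (s _ + _)]opprD addrA subKr subrr.
Qed.

Lemma projective_ext0 P N : projective P -> ext0 P N.
Proof.
move=> pP D cD; have [E [i [p [s [sip ps pi sE]]]]] := extension_exists cD.
have [_ hp _ p1 _] := sip.
have [h hh phE] := pP _ _ _ _ hp p1 (@hom_id _ _ P).
apply: (section_coboundary sip ps sE hh) => y.
by rewrite -comp_lfunE phE id_lfunE.
Qed.

(* N belongs to Fac M, see [FacP]. *)
Definition gen M N : Prop :=
  forall U : {vspace N}, (forall f : 'Hom(M, N), is_hom f -> (limg f <= U)%VS) ->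
  U = fullv.

(* This is tau-rigidity, see [tau_rigidP]. *)
Definition rig M : Prop := forall N, gen M N -> ext0 M N.

Lemma inadd_refl M : inadd M M.
Proof.
exists 'I_1, (fun _ => \1%VF), (fun _ => \1%VF).
by split=> [_|_|x]; rewrite ?big_ord1 ?id_lfunE //; apply: hom_id.
Qed.

Lemma inadd_zero M Z : (forall z : Z, z = 0) -> inadd M Z.
Proof.
move=> Z0; exists 'I_0, (fun _ => 0), (fun _ => 0).
by split=> [_|_|x]; [apply: hom0|apply: hom0|rewrite big_ord0 (Z0 x)].
Qed.

Lemma inadd_trans L M N : inadd L M -> inadd M N -> inadd L N.
Proof.
move=> [I [f [g [hf hg fg]]]] [J [f' [g' [hf' hg' fg']]]].
exists (J * I)%type, (fun x => f x.2 \o f' x.1)%VF, (fun x => g' x.1 \o g x.2)%VF.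
split=> [x|x|x]; try exact: hom_comp.
rewrite [LHS]fg'; transitivity (\sum_j \sum_i g' j (g i (f i (f' j x)))).
  by apply: eq_bigr => j _; rewrite {1}[f' j x]fg linear_sum.
rewrite pair_big /=; apply: eq_bigr => -[j i] _ /=.
by rewrite !comp_lfunE.
Qed.

Lemma retract_inadd M X (f : 'Hom(X, M)) (g : 'Hom(M, X)) :
  is_hom f -> is_hom g -> (forall x, g (f x) = x) -> inadd M X.
Proof.
move=> hf hg gf; exists 'I_1, (fun _ => f), (fun _ => g).
by split=> // x; rewrite big_ord1 gf.
Qed.

Lemma inadd_dsum L M N : inadd L M -> inadd L N -> inadd L (dsum M N).
Proof.
move=> [I [f [g [hf hg fg]]]] [J [f' [g' [hf' hg' fg']]]].
have [i1 [i2 [p1 [p2 [[h1 h2 k1 k2] [_ _ e]]]]]] := dsum_maps M N.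
exists (I + J)%type,
  (fun x => match x with inl i => f i \o p1 | inr j => f' j \o p2 end)%VF,
  (fun x => match x with inl i => i1 \o g i | inr j => i2 \o g' j end)%VF.
split=> [[i|j]|[i|j]|x]; try exact: hom_comp.
rewrite big_sumType /= [LHS]e {1}[p1 x]fg {1}[p2 x]fg' !linear_sum.
by congr (_ + _); apply: eq_bigr => i _; rewrite /= !comp_lfunE.
Qed.

Lemma inadd_dsuml M N : inadd (dsum M N) M.
Proof.
have [i1 [i2 [p1 [p2 [[h1 h2 k1 k2] [[a b] [c d] e]]]]]] := dsum_maps M N.
exact: (retract_inadd h1 k1).
Qed.

Lemma inadd_dsumr M N : inadd (dsum M N) N.
Proof.
have [i1 [i2 [p1 [p2 [[h1 h2 k1 k2] [[a b] [c d] e]]]]]] := dsum_maps M N.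
exact: (retract_inadd h2 k2).
Qed.

Lemma iso_inadd M N : iso M N -> inadd M N /\ inadd N M.
Proof.
move=> [f [hf /eqP f0 f1]].
have fV x : f (f^-1%VF x) = x by apply: limg_lfunVK; rewrite f1 memvf.
have hfV : is_hom (f^-1)%VF.
  by move=> x a; move/lker0P: (f0) => fi; apply: fi; rewrite hf !fV.
split; first by apply: (retract_inadd hfV hf).
by apply: (retract_inadd hf hfV) => x; rewrite lker0_lfunK.
Qed.

Lemma gen_refl M : gen M M.
Proof.
move=> U HU; apply/eqP; rewrite eqEsubv subvf.
by have := HU _ (@hom_id _ _ M); rewrite lim1g.
Qed.

Lemma gen_surj M N N' (p : 'Hom(N, N')) :
  is_hom p -> limg p = fullv -> gen M N -> gen M N'.
Proof.
move=> hp p1 MN U HU; have pU : (p @^-1: U = fullv)%VS.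
  apply: MN => f hf; apply/subvP=> _ /memv_imgP[x _ ->].
  rewrite -memv_preim -comp_lfunE; apply: (subvP (HU _ (hom_comp hp hf))).
  by rewrite memv_img ?memvf.
apply/eqP; rewrite eqEsubv subvf -p1; apply/subvP=> _ /memv_imgP[x _ ->].
by rewrite memv_preim pU memvf.
Qed.

Lemma gen_trans L M N : gen L M -> gen M N -> gen L N.
Proof.
move=> LM MN U HU; apply: MN => f hf.
have fU : (f @^-1: U = fullv)%VS.
  apply: LM => g hg; apply/subvP=> _ /memv_imgP[x _ ->].
  rewrite -memv_preim -comp_lfunE; apply: (subvP (HU _ (hom_comp hf hg))).
  by rewrite memv_img ?memvf.
by apply/subvP=> _ /memv_imgP[x _ ->]; rewrite memv_preim fU memvf.
Qed.

Lemma gen_inadd M N : inadd M N -> gen M N.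
Proof.
move=> [I [f [g [hf hg fg]]]] U HU.
apply/eqP; rewrite eqEsubv subvf; apply/subvP=> x _; rewrite [x]fg memv_suml // => i _.
by apply: (subvP (HU _ (hg i))); rewrite memv_img ?memvf.
Qed.

Lemma gen_finite M N : gen M N -> exists s : seq 'Hom(M, N),
  (forall f, f \in s -> is_hom f) /\ (\sum_(f <- s) limg f)%VS = fullv.
Proof.
move=> MN.
have [||s hs smax] := @exists_maximal (seq 'Hom(M, N))
  (fun s => forall f, f \in s -> is_hom f)
  (fun s => \dim (\sum_(f <- s) limg f)%VS) (dim N) [::] _ _ => //.
  by move=> s _; rewrite -dimvf dimvS ?subvf.
exists s; split=> //; apply: MN => f hf.
have /smax : forall g, g \in f :: s -> is_hom g.
  by move=> g; rewrite inE => /predU1P[->|/hs].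
rewrite big_cons (geq_leqif (dimv_leqif_sup (addvSr _ _))).
by apply: subv_trans; apply: addvSl.
Qed.

Lemma power_inadd M k P (inn : 'I_k -> 'Hom(M, P)) (pr : 'I_k -> 'Hom(P, M)) :
  (forall i, is_hom (inn i)) -> (forall i, is_hom (pr i)) ->
  (forall v, v = \sum_i inn i (pr i v)) -> inadd M P.
Proof. by move=> h1 h2 h3; exists 'I_k, pr, inn. Qed.

Lemma gen_cover M N : gen M N ->
  exists Y (p : 'Hom(Y, N)), [/\ inadd M Y, is_hom p & limg p = fullv].
Proof.
move=> /gen_finite[s [hs s1]].
have [P [inn [pr [hi hp pi v_id]]]] := power_exists M (size s).
exists P, (\sum_(i < size s) (s`_i \o pr i))%VF; split.
- exact: power_inadd v_id.
- by apply: hom_sum => i; apply: hom_comp => //; apply: hs; rewrite mem_nth.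
apply/eqP; rewrite eqEsubv subvf -s1 /= (big_nth 0) big_mkord; apply/subv_sumP => i _.
apply/subvP=> _ /memv_imgP[x _ ->]; apply/memv_imgP; exists (inn i x); rewrite ?memvf //.
rewrite sum_lfunE (bigD1 i) //= comp_lfunE pi eqxx big1 ?addr0 // => j ji.
by rewrite comp_lfunE pi (negPf ji) linear0.
Qed.

Lemma gen_dsum L M N : gen L M -> gen L N -> gen L (dsum M N).
Proof.
have [i1 [i2 [p1 [p2 [[h1 h2 k1 k2] [[a b] [c d] e]]]]]] := dsum_maps M N.
move=> LM LN U HU.
have U1 : (i1 @^-1: U = fullv)%VS.
  apply: LM => g hg; apply/subvP=> _ /memv_imgP[x _ ->].
  rewrite -memv_preim -comp_lfunE; apply: (subvP (HU _ (hom_comp h1 hg))).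
  by rewrite memv_img ?memvf.
have U2 : (i2 @^-1: U = fullv)%VS.
  apply: LN => g hg; apply/subvP=> _ /memv_imgP[x _ ->].
  rewrite -memv_preim -comp_lfunE; apply: (subvP (HU _ (hom_comp h2 hg))).
  by rewrite memv_img ?memvf.
apply/eqP; rewrite eqEsubv subvf; apply/subvP=> v _; rewrite [v]e memvD //.
  by rewrite memv_preim U1 memvf.
by rewrite memv_preim U2 memvf.
Qed.

(** Maps M -> N'' lift to N because Ext^1(M, N') = 0, so the images of M cover N modulo N'. *)
Lemma gen_ses M N' N N'' (i : 'Hom(N', N)) (p : 'Hom(N, N'')) :
  ses i p -> gen M N' -> gen M N'' -> ext0 M N' -> gen M N.
Proof.
move=> sip g' g'' eM U HU; have [hi hp _ p1 ker] := sip.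
have Ui : (i @^-1: U = fullv)%VS.
  apply: g' => g hg; apply/subvP=> _ /memv_imgP[x _ ->].
  rewrite -memv_preim -comp_lfunE; apply: (subvP (HU _ (hom_comp hi hg))).
  by rewrite memv_img ?memvf.
have Up : (p @: U = fullv)%VS.
  apply: g'' => g hg; have [h hh <-] := hom_lift sip eM hg.
  by rewrite limg_comp limgS // HU.
apply/eqP; rewrite eqEsubv subvf; apply/subvP=> v _.
have /memv_imgP[u uU pvu] : p v \in (p @: U)%VS by rewrite Up memvf.
have [|n nE] := (ker (v - u)).1; first by rewrite linearB /= pvu subrr.
by rewrite -[v](subrK u) memvD // nE memv_preim Ui memvf.
Qed.

(* Right exactness of Ext^1(X, -). *)
Definition pd1 X : Prop := forall E N (g : 'Hom(E, N)) (D : 'Hom(X, 'Hom(A, N))),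
  is_hom g -> limg g = fullv -> cocycle D ->
  exists2 D' : 'Hom(X, 'Hom(A, E)), cocycle D' & forall x a, g (D' x a) = D x a.

Lemma pd1_ext0 X E N (g : 'Hom(E, N)) :
  pd1 X -> is_hom g -> limg g = fullv -> ext0 X E -> ext0 X N.
Proof.
move=> pX hg g1 eX D cD; have [D' cD' D'E] := pX _ _ _ _ hg g1 cD.
have [t tE] := eX _ cD'; exists (g \o t)%VF => x a.
by rewrite -D'E tE linearB /= !comp_lfunE hg.
Qed.

Lemma pd1_gen M U N : pd1 M -> ext0 M U -> gen U N -> ext0 M N.
Proof.
move=> pM eM /gen_cover[Y [p [UY hp p1]]].
exact: pd1_ext0 pM hp p1 (ext0_inadd_r UY eM).
Qed.

Lemma pd1_inadd M X : inadd M X -> pd1 M -> pd1 X.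
Proof.
move=> [I [f [h [hf hh fh]]]] pM E N g D hg g1 cD.
have H i : exists D' : 'Hom(X, 'Hom(A, E)), cocycle D' /\
    forall x a, g (D' x a) = D (h i (f i x)) a.
  have [D1 cD1 D1E] := cocycle_map (hh i) (@hom_id _ _ N) cD.
  have [D2 cD2 D2E] := pM _ _ _ _ hg g1 cD1.
  have [D3 cD3 D3E] := cocycle_map (hf i) (@hom_id _ _ E) cD2.
  by exists D3; split=> // x a; rewrite D3E id_lfunE D2E D1E id_lfunE.
have [D' D'E] := choice H.
exists (\sum_i D' i).
  by apply: cocycle_sum => i; have [] := D'E i.
move=> x a; rewrite {2}[x]fh !sum_lfunE !linear_sum sum_lfunE /=.
by apply: eq_bigr => i _; have [_ ->] := D'E i.
Qed.

(** The obstruction lives in Ext^2(Q, N). It is circumvented by lifting the class C of the sequence,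
    in Ext^1(Q, U), along the surjection onto U of the extension defined by D; right exactness of
    Ext^1(Q, -) provides the lift. *)
Lemma cocycle_coextend U M Q N (i : 'Hom(U, M)) (p : 'Hom(M, Q)) (D : 'Hom(U, 'Hom(A, N))) :
  ses i p -> pd1 Q -> cocycle D ->
  exists2 D' : 'Hom(M, 'Hom(A, N)), cocycle D' & forall u a, D' (i u) a = D u a.
Proof.
move=> sip pQ cD; have [s [r [ps ri pi rs e_id]]] := ses_split sip.
have [hi hp _ _ _] := sip.
have [||C CE] := @bilin_exists K Q A U (fun x a => r (ract (s x) a)).
- by move=> a k x y; rewrite linearP ractDl ractZl linearP.
- by move=> x k a b; rewrite ractDr ractZr linearP.
have sE x a : ract (s x) a = i (C x a) + s (ract x a).
  by rewrite CE [LHS]e_id hp ps.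
have cC : cocycle C.
  move=> x a b; rewrite CE ractM sE ractDl linearD /= -hi ri; congr (_ + _).
  by rewrite sE linearD /= ri rs addr0.
have [E [iE [pE [s2 [sesE ps2 _ sEE]]]]] := extension_exists cD.
have [r2 [ri2 pi2 rs2 e2]] := ses_retraction sesE ps2.
have [hiE hpE _ pE1 _] := sesE.
have [C' cC' C'E] := pQ _ _ _ _ hpE pE1 cC.
have r2E e a : r2 (ract e a) = ract (r2 e) a + D (pE e) a.
  by rewrite {1}[e]e2 ractDl sEE !linearD /= -hiE !ri2 rs2 add0r.
have rE m a : r (ract m a) = ract (r m) a + C (p m) a.
  by rewrite {1}[m]e_id ractDl linearD /= -hi ri CE.
have [||D' D'E] := @bilin_exists K M A N (fun m a => D (r m) a + r2 (C' (p m) a)).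
- move=> a k x y; rewrite !(linearP, add_lfunE, scale_lfunE) /=.
  by rewrite scalerDr addrACA.
- by move=> x k a b; rewrite !linearP /= scalerDr addrACA.
exists D'; last by move=> u a; rewrite D'E ri pi !linear0 zero_lfunE linear0 addr0.
move=> m a b; rewrite !D'E cD cC' linearD /= r2E ractDl C'E hp rE linearD add_lfunE.
by rewrite -!addrA; congr (_ + _); exact: addrCA.
Qed.

(** A lift over U extends to M; the difference that remains vanishes on U, so it descends to Q and
    is lifted there. *)
Lemma pd1_ses U M Q (i : 'Hom(U, M)) (p : 'Hom(M, Q)) :
  ses i p -> pd1 U -> pd1 Q -> pd1 M.
Proof.
move=> sip pU pQ E N g D hg g1 cD; have [hi hp _ _ _] := sip.
have [D1 cD1 D1E] := cocycle_map hi (@hom_id _ _ N) cD.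
have [D2 cD2 D2E] := pU _ _ _ _ hg g1 cD1.
have [D3 cD3 D3E] := cocycle_coextend sip pQ cD2.
have [D4 cD4 D4E] := cocycle_map (@hom_id _ _ M) hg cD3.
have [|D5 cD5 D5E] := cocycle_descend sip (cocycleB cD cD4).
  move=> u a; rewrite !add_lfunE !opp_lfunE D4E id_lfunE D3E D2E D1E id_lfunE.
  by rewrite subrr.
have [D6 cD6 D6E] := pQ _ _ _ _ hg g1 cD5.
have [D7 cD7 D7E] := cocycle_map hp (@hom_id _ _ E) cD6.
exists (D7 + D3); first exact: cocycleD.
move=> x a; rewrite !add_lfunE linearD /= D7E id_lfunE D6E D5E.
by rewrite !add_lfunE !opp_lfunE D4E id_lfunE subrK.
Qed.

Lemma pd1_projective_kernel R P X (i : 'Hom(R, P)) (p : 'Hom(P, X)) :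
  ses i p -> projective R -> projective P -> pd1 X.
Proof.
move=> sip pR pP E N g D hg g1 cD; have [s [r [ps ri pi rs e_id]]] := ses_split sip.
have [hi hp i0 p1 ker] := sip.
have [D1 cD1 D1E] := cocycle_map hp (@hom_id _ _ N) cD.
have [t tE] := projective_ext0 pP cD1.
have hti : is_hom (t \o i)%VF.
  move=> u a; rewrite !comp_lfunE hi; apply/eqP; rewrite -subr_eq0 -tE D1E pi.
  by rewrite linear0 zero_lfunE linear0.
have [h hh ghE] := pR _ _ _ _ hg g1 hti.
have gh u : g (h u) = t (i u) by rewrite -comp_lfunE ghE comp_lfunE.
have [sg gsg] := surj_section g1.
(* A linear lift of t along g that agrees on R with the homomorphism h, so that its coboundary
   descends to X. *)
pose t' := ((sg \o t) + ((h - (sg \o (t \o i))) \o r))%VF.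
have t'E y : t' y = sg (t y) + (h (r y) - sg (t (i (r y)))).
  by rewrite !(add_lfunE, opp_lfunE, comp_lfunE).
have gt' y : g (t' y) = t y by rewrite t'E linearD linearB /= gh !gsg subrr addr0.
have t'i u : t' (i u) = h u by rewrite t'E ri addrC subrK.
have [T cT TE] := delta_exists t'.
have [|D' cD' D'E] := cocycle_descend sip cT.
  by move=> u a; rewrite TE -hi !t'i hh subrr.
exists D' => // x a.
by rewrite -(ps x) D'E TE linearB /= hg !gt' -tE D1E id_lfunE.
Qed.

Lemma coboundaryD X N (D D' : 'Hom(X, 'Hom(A, N))) :
  coboundary D -> coboundary D' -> coboundary (D + D').
Proof.
move=> [t tE] [t' t'E]; exists (t + t') => x a.
by rewrite !add_lfunE tE t'E ractDl opprD addrACA.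
Qed.

Lemma coboundary_comp X Y N (D : 'Hom(X, 'Hom(A, N))) (f : 'Hom(Y, X)) :
  is_hom f -> coboundary D -> coboundary (D \o f)%VF.
Proof.
move=> hf [t tE]; exists (t \o f)%VF => x a.
by rewrite !comp_lfunE tE hf.
Qed.

(* The cocycles [d j] generate Ext^1(M, B) as a right End(M)-module. *)
Definition ext_generators B M k (d : 'I_k -> 'Hom(M, 'Hom(A, B))) : Prop :=
  (forall j, cocycle (d j)) /\
  forall C : 'Hom(M, 'Hom(A, B)), cocycle C ->
    exists2 phi : 'I_k -> 'Hom(M, M), (forall j, is_hom (phi j))
      & coboundary (C - \sum_j (d j \o phi j))%VF.

Lemma ext_generators_exist B M : exists k (d : 'I_k -> 'Hom(M, 'Hom(A, B))),
  ext_generators d.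
Proof.
have [||Z ZE] := @vspace_exists K _ (fun D : 'Hom(M, 'Hom(A, B)) => cocycle D).
- exact: cocycle0.
- by move=> k u v cu cv; apply/cocycleD/cv/cocycleZ.
exists (\dim Z), (fun j => (vbasis Z)`_j); split=> [j|C /ZE/coord_vbasis CE].
  by apply/ZE; rewrite vbasis_mem // mem_nth ?size_tuple.
exists (fun j => coord (vbasis Z) j C *: \1%VF); first by move=> j; apply/homZ/hom_id.
rewrite {1}CE; exists 0 => x a.
rewrite !zero_lfunE ract0l subr0 -sumrB !sum_lfunE big1 // => j _.
rewrite !add_lfunE !opp_lfunE comp_lfunE !scale_lfunE id_lfunE linearZ.
by rewrite scale_lfunE subrr.
Qed.

(** The extension of M^k by B with classes d. The connecting map from Hom(M, P) hits all of Ext^1(M,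
    B), so Ext^1(M, E) = 0. The last clause is exactness at Hom(M, P): a map M -> P that lifts to E
    yields a relation between the [d j] over End(M). *)
Lemma generated_extension B M k (d : 'I_k -> 'Hom(M, 'Hom(A, B))) :
  ext0 M M -> ext_generators d ->
  exists E P (i : 'Hom(B, E)) (p : 'Hom(E, P)) (pr : 'I_k -> 'Hom(P, M)),
  [/\ ses i p, inadd M P, ext0 M E,
      forall j, is_hom (pr j) /\ limg (pr j) = fullv
    & forall h : 'Hom(M, E), is_hom h -> coboundary (\sum_j (d j \o (pr j \o (p \o h))))%VF].
Proof.
move=> eM [cd gd].
have [P [inn [pr [hi hp pri v_id]]]] := power_exists M k.
have PM : inadd M P by apply: power_inadd v_id.
have [D DE] : exists D : 'Hom(P, 'Hom(A, B)), D = (\sum_j (d j \o pr j))%VF by exists (\sum_j (d j \o pr j))%VF.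
have DP y a : D y a = \sum_j d j (pr j y) a.
  by rewrite DE !sum_lfunE; apply: eq_bigr => j _; rewrite comp_lfunE.
have cD : cocycle D.
  move=> x a b; rewrite !DP ract_suml -big_split; apply: eq_bigr => j _ /=.
  by rewrite cd hp.
have [E [i [p [s [sip ps pi sE]]]]] := extension_exists cD.
have [r [ri _ rs e_id]] := ses_retraction sip ps.
have [hie hpe i0 _ ker] := sip.
exists E, P, i, p, pr; split=> //.
- move=> C cC.
  have [C1 cC1 C1E] := cocycle_map (@hom_id _ _ M) hpe cC.
  have [t tE] := ext0_inadd_r PM eM cC1.
  have [T cT TE] := delta_exists (s \o t)%VF.
  have cCT := cocycleB cC cT; pose F0 := C - T.
  have [||F FE] := @bilin_exists K M A B (fun x a => r (F0 x a)).
  + by move=> a c u v; rewrite !linearP add_lfunE scale_lfunE linearP.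
  + by move=> x c u v; rewrite !linearP.
  have iF x a : i (F x a) = (C - T) x a.
    rewrite FE [RHS]e_id /F0.
    have -> : p ((C - T) x a) = 0.
      rewrite !add_lfunE !opp_lfunE TE linearB /= linearB /= hpe !comp_lfunE !ps.
      by have := C1E x a; rewrite id_lfunE tE => <-; rewrite subrr.
    by rewrite linear0 addr0.
  have cF : cocycle F.
    move=> x a b; apply/eqP; rewrite -subr_eq0; apply/eqP; move/injP: (i0); apply.
    by rewrite linearB linearD /= hie !iF cCT subrr.
  have [phi hphi [w wE]] := gd _ cF.
  have [u uE] : exists u : 'Hom(M, P), u = (\sum_j (inn j \o phi j))%VF by exists (\sum_j (inn j \o phi j))%VF.
  have prux j x : pr j (u x) = phi j x.
    rewrite uE sum_lfunE linear_sum (bigD1 j) //= comp_lfunE pri eqxx.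
    by rewrite big1 ?addr0 // => l lj; rewrite comp_lfunE pri eq_sym (negPf lj).
  have hu : is_hom u by rewrite uE; apply: hom_sum => j; apply: hom_comp.
  exists ((s \o t) - (s \o u) + (i \o w))%VF => x a.
  have -> : C x a = i (F x a) + T x a by rewrite iF !add_lfunE !opp_lfunE subrK.
  have DuE : D (u x) a = (\sum_j (d j \o phi j))%VF x a.
    by rewrite DP !sum_lfunE; apply: eq_bigr => j _; rewrite comp_lfunE prux.
  have -> : F x a = D (u x) a + (w (ract x a) - ract (w x) a).
    by rewrite -wE DuE !add_lfunE !opp_lfunE addrC subrK.
  rewrite TE !(add_lfunE, opp_lfunE, comp_lfunE) !ractDl ractNl (sE (u x)) hu.
  rewrite linearD linearB /= hie.
  set a1 := i _; set a2 := i _; set a3 := ract (i _) a; set a4 := s _; set a5 := ract _ a; set a6 := s _.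
  rewrite [RHS](_ : _ = a4 + a2 + a1 + (- a5 - a3)); last first.
    by rewrite opprD opprB [a4 - a6 + a2]addrAC !addrA subrK.
  rewrite [a1 + _]addrA addrACA [- a3 - a5]addrC; congr (_ + _).
  by rewrite addrC [a1 + a2]addrC addrA.
- move=> j; split=> //; apply/surjP=> x; exists (inn j x); by rewrite pri eqxx.
move=> h hh; exists (r \o h)%VF => x a.
have rE e : r (ract e a) = ract (r e) a + D (p e) a.
  by rewrite {1}[e]e_id ractDl sE !linearD /= -hie !ri rs add0r.
have -> : (\sum_j (d j \o (pr j \o (p \o h))))%VF x a = D (p (h x)) a.
  by rewrite DP !sum_lfunE; apply: eq_bigr => j _; rewrite !comp_lfunE.
by rewrite !comp_lfunE hh rE addrC addKr.
Qed.

Lemma universal_extension B M : ext0 M M -> exists E P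
    (i : 'Hom(B, E)) (p : 'Hom(E, P)),
  [/\ ses i p, inadd M P & ext0 M E].
Proof.
move=> eM; have [k [d gd]] := ext_generators_exist B M.
by have [E [P [i [p [pr [sip PM eE _ _]]]]]] := generated_extension eM gd; exists E, P, i, p.
Qed.

End Extensions.

(** * Krull-Schmidt *)

Section KrullSchmidt.
Variables (K : fieldType) (A : falgType K).
Implicit Types L M N P X Y Z E Q U R B V W S T : rmodule A.

Definition bihom M N (f : 'Hom(M, N)) : Prop := [/\ is_hom f, lker f = 0%VS & limg f = fullv].

Lemma bihom_inv M N (f : 'Hom(M, N)) : bihom f ->
  exists g : 'Hom(N, M), [/\ bihom g, forall x, g (f x) = x & forall y, f (g y) = y].
Proof.
move=> [hf f0 f1]; have [g gf] := inj_retract f0.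
have fg y : f (g y) = y by move/surjP: f1 => /(_ y)[x ->]; rewrite gf.
exists g; split=> //; split.
- by move=> y a; rewrite -{1}(fg y) -hf gf.
- by apply/injP=> y gy; rewrite -(fg y) gy linear0.
- by apply/surjP=> x; exists (f x); rewrite gf.
Qed.

Lemma iso_refl M : iso M M.
Proof.
exists \1%VF; split; [exact: hom_id| |exact: lim1g].
by apply/injP=> u; rewrite id_lfunE.
Qed.

Lemma iso_sym M N : iso M N -> iso N M.
Proof. by move=> [f /bihom_inv[g [hg _ _]]]; exists g. Qed.

Lemma iso_trans N M P : iso M N -> iso N P -> iso M P.
Proof.
move=> [f [hf f0 f1]] [g [hg g0 g1]]; exists (g \o f)%VF; split.
- exact: hom_comp.
- by move/injP: f0 => f0; move/injP: g0 => g0; apply/injP=> u; rewrite comp_lfunE => /g0/f0.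
- by rewrite limg_comp f1.
Qed.

Lemma iso_of_inverse M N (f : 'Hom(M, N)) (g : 'Hom(N, M)) :
  is_hom f -> (forall x, g (f x) = x) -> (forall y, f (g y) = y) -> iso M N.
Proof.
move=> hf gf fg; exists f; split=> //.
  by apply/injP=> u fu; rewrite -(gf u) fu linear0.
by apply/surjP=> v; exists (g v); rewrite fg.
Qed.

Lemma endo_inj_surj M (f : 'Hom(M, M)) : lker f = 0%VS -> limg f = fullv.
Proof.
move=> f0; apply/eqP; rewrite eqEdim subvf /=.
by rewrite limg_dim_eq // f0 capv0.
Qed.

Lemma split_iso N E X (i : 'Hom(N, E)) (p : 'Hom(E, X)) (s : 'Hom(X, E)) :
  ses i p -> is_hom s -> (forall x, p (s x) = x) -> iso E (dsum X N).
Proof.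
move=> sip hs ps; have [r [ri pi rs e_id]] := ses_retraction sip ps.
have [hi hp /injP i0 _ _] := sip.
have hr : is_hom r.
  move=> e a; apply/eqP; rewrite -subr_eq0; apply/eqP/i0; rewrite linearB /=.
  apply/eqP; rewrite subr_eq0; apply/eqP/(addIr (s (p (ract e a)))).
  by rewrite -e_id {1}[e]e_id ractDl hi hp hs.
have [i1 [i2 [p1 [p2 [[h1 h2 k1 k2] [[a b] [c d] e]]]]]] := dsum_maps X N.
apply: (@iso_of_inverse _ _ ((i1 \o p) + (i2 \o r))%VF ((s \o p1) + (i \o p2))%VF).
- by apply: homD; apply: hom_comp.
- move=> x; rewrite !(add_lfunE, comp_lfunE) !linearD /= a b c d !linear0 !(add0r, addr0).
  by rewrite addrC -e_id.
move=> y; rewrite !(add_lfunE, comp_lfunE) !linearD /= ps pi rs ri !linear0 !(add0r, addr0).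
by rewrite -e.
Qed.

Lemma retract_iso M Y (f : 'Hom(Y, M)) (g : 'Hom(M, Y)) :
  is_hom f -> is_hom g -> (forall y, g (f y) = y) -> exists Z, iso M (dsum Y Z).
Proof.
move=> hf hg gf; have g1 : limg g = fullv by apply/surjP=> y; exists (f y); rewrite gf.
by have [Z [i sig]] := ses_ker hg g1; exists Z; apply: split_iso sig hf gf.
Qed.

(** For a power g of h with largest kernel, Y is the direct sum of ker g and im g, and one of the
    two vanishes. *)
Lemma fitting Y (h : 'Hom(Y, Y)) : indecomposable Y -> is_hom h ->
  lker h = 0%VS \/ exists k, forall x, iter k h x = 0.
Proof.
move=> [_ iY] hh.
pose Pr (x : nat * 'Hom(Y, Y)) := is_hom x.2 /\ forall y, x.2 y = iter x.1 h y.
have [||[k g] /= [hg gE] kmax] := @exists_maximal _ Pr (fun x => \dim (lker x.2)) (dim Y) (0%N, \1%VF).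
- by split; [apply: hom_id|move=> y; rewrite id_lfunE].
- by move=> x _; rewrite -dimvf dimvS ?subvf.
have gg x : g (g x) = 0 -> g x = 0.
  have /kmax : Pr ((k + k)%N, (g \o g)%VF).
    by split=> [|y] /=; [apply: hom_comp|rewrite comp_lfunE !gE -iterD].
  rewrite /= (geq_leqif (dimv_leqif_sup _)); last first.
    by apply/subvP=> y; rewrite !memv_ker comp_lfunE => /eqP ->; rewrite linear0.
  move=> /subvP sub gx; apply/eqP; rewrite -memv_ker; apply: sub.
  by rewrite memv_ker comp_lfunE gx.
have [N1 [i1 [h1 i10 i11]]] := submod_exists (ker_stable hg).
have [N2 [i2 [h2 i20 i21]]] := submod_exists (img_stable hg (@full_stable _ _ Y)).
have cap0 : (lker g :&: limg g = 0)%VS.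
  apply/eqP; rewrite -subv0; apply/subvP=> y; rewrite memv_cap memv_ker memv0.
  by move=> /andP[/eqP gy /memv_imgP[x _ yE]]; rewrite yE gg // -yE gy.
have sum1 : (lker g + limg g = fullv)%VS.
  apply/eqP; rewrite eqEdim subvf /= dimv_disjoint_sum //.
  by rewrite -[X in (\dim X + _)%N]capfv limg_ker_dim.
have [j1 [j2 [p1 [p2 [[k1 k2 q1 q2] [[a b] [c d] e]]]]]] := dsum_maps N1 N2.
have /iso_sym : iso (dsum N1 N2) Y.
  exists ((i1 \o p1) + (i2 \o p2))%VF; split.
  - by apply: homD; apply: hom_comp.
  - apply/injP=> v; rewrite add_lfunE !comp_lfunE => /eqP; rewrite addr_eq0 => /eqP v0.
    have h0 : i1 (p1 v) = 0.
      apply/eqP; rewrite -memv0 -cap0 memv_cap -i11 -i21 memv_img ?memvf //=.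
      by rewrite v0 memvN memv_img ?memvf.
    have h0' : i2 (p2 v) = 0 by apply/eqP; rewrite -oppr_eq0 -v0 h0.
    move/injP: i10 => i10; move/injP: i20 => i20.
    by rewrite [v]e (i10 _ h0) (i20 _ h0') !linear0 addr0.
  - apply/eqP; rewrite eqEsubv subvf -sum1; apply/subvP=> _ /memv_addP[u + [w + ->]].
    rewrite -i11 -i21 => /memv_imgP[n1 _ ->] /memv_imgP[n2 _ ->].
    apply/memv_imgP; exists (j1 n1 + j2 n2); rewrite ?memvf //.
    by rewrite add_lfunE !comp_lfunE !linearD /= a b c d !linear0 !(add0r, addr0).
move=> /iY[N10|N20]; [left|right].
  have g0 : lker g = 0%VS.
    apply/vspaceP=> x; rewrite memv0 -i11; apply/memv_imgP/eqP => [[n _ ->]|->].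
      by rewrite (N10 n) linear0.
    by exists 0; rewrite ?memvf ?linear0.
  have /kmax : Pr (1%N, h) by [].
  by rewrite /= g0 dimv0 leqn0 dimv_eq0 => /eqP.
exists k => x; rewrite -gE; have : g x \in limg i2 by rewrite i21 memv_img ?memvf.
by move=> /memv_imgP[n _ ->]; rewrite (N20 n) linear0.
Qed.

Lemma complement_inj Y (h : 'Hom(Y, Y)) : indecomposable Y -> is_hom h ->
  lker h <> 0%VS -> lker (\1 - h)%VF = 0%VS.
Proof.
move=> iY hh h0; have [//|[k hk]] := fitting iY hh.
apply/injP=> x; rewrite add_lfunE opp_lfunE id_lfunE => /eqP; rewrite subr_eq0 => /eqP xh.
by rewrite -(hk x); elim: k {hk} => //= k <-.
Qed.

Lemma endo_injl Y (f g : 'Hom(Y, Y)) : lker (g \o f)%VF = 0%VS -> lker f = 0%VS.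
Proof.
move/injP=> gf; apply/injP=> u fu; apply: gf.
by rewrite comp_lfunE fu linear0.
Qed.

Lemma endo_injr Y (f g : 'Hom(Y, Y)) : lker (g \o f)%VF = 0%VS -> lker g = 0%VS.
Proof.
move=> gf; have /surjP f1 := endo_inj_surj (endo_injl gf).
apply/injP=> u gu; have [v uv] := f1 u; move/injP: gf => /(_ v).
by rewrite comp_lfunE -uv gu uv => -> //; rewrite linear0.
Qed.

(** If v inverts f + g, then v g = 1 - v f is injective because v f is not, and so g is
    injective. *)
Lemma endo_local Y (f g : 'Hom(Y, Y)) : indecomposable Y -> is_hom f -> is_hom g ->
  lker f <> 0%VS -> lker g <> 0%VS -> lker (f + g)%VF <> 0%VS.
Proof.
move=> iY hf hg f0 g0 u0.
have [|v [[hv v0 v1] vu uv]] := @bihom_inv _ _ (f + g)%VF.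
  by split; [apply: homD|exact: u0|apply: endo_inj_surj].
have vf0 : lker (v \o f)%VF <> 0%VS by move=> /endo_injl.
apply: g0; apply: (@endo_injl _ _ v).
have := complement_inj iY (hom_comp hv hf) vf0.
suff -> : (\1 - (v \o f) = (v \o g))%VF by [].
apply/lfunP=> x; rewrite add_lfunE opp_lfunE !comp_lfunE id_lfunE.
by rewrite -{1}[x]vu add_lfunE linearD /= addrAC subrr add0r.
Qed.

Lemma endo_local_sum Y (I : finType) (f : I -> 'Hom(Y, Y)) : indecomposable Y ->
  (forall i, is_hom (f i)) -> lker (\sum_i f i)%VF = 0%VS -> exists i, lker (f i) = 0%VS.
Proof.
move=> iY hf f0; apply: contrapT => nf.
pose Pr (h : 'Hom(Y, Y)) := is_hom h /\ lker h <> 0%VS.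
have [_] : Pr (\sum_i f i)%VF; last by move/(_ f0).
apply: (big_ind Pr); last by move=> i _; split=> // fi; apply: nf; exists i.
- split; [exact: hom0|move=> /injP Y0; case: iY => iY _; apply: iY => y].
  by apply: Y0; rewrite zero_lfunE.
- by move=> u v [hu u0] [hv v0]; split; [apply: homD|apply: endo_local].
Qed.

(** The identity of Y is a sum of endomorphisms that factor through M; as End(Y) is local, one of
    them is invertible. *)
Lemma inadd_retract M Y : indecomposable Y -> inadd M Y ->
  exists (f : 'Hom(Y, M)) (g : 'Hom(M, Y)), [/\ is_hom f, is_hom g & forall y, g (f y) = y].
Proof.
move=> iY [I [f [g [hf hg fg]]]].
have [||i gf0] := @endo_local_sum Y I (fun i => g i \o f i)%VF iY.
- by move=> i; apply: hom_comp.
- apply/injP=> u; rewrite sum_lfunE => u0; rewrite [u]fg -[RHS]u0.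
  by apply: eq_bigr => i _; rewrite comp_lfunE.
have [|v [[hv _ _] vu uv]] := @bihom_inv _ _ (g i \o f i)%VF.
  by split; [apply: hom_comp|exact: gf0|apply: endo_inj_surj].
exists (f i), (v \o g i)%VF; split=> //; first exact: hom_comp.
by move=> y; rewrite -{2}[y]vu !comp_lfunE.
Qed.

Lemma inadd_split M Y : indecomposable Y -> inadd M Y -> exists Z, iso M (dsum Y Z).
Proof.
by move=> iY /(inadd_retract iY)[f [g [hf hg gf]]]; apply: retract_iso gf.
Qed.

Lemma iso_dsum0 X Y : is_zero X -> iso (dsum X Y) Y.
Proof.
move=> X0; have [i1 [i2 [p1 [p2 [[h1 h2 k1 k2] [[a b] [c d] e]]]]]] := dsum_maps X Y.
apply: (iso_of_inverse k2 _ d) => x.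
by rewrite {2}[x]e (X0 (p1 x)) linear0 add0r.
Qed.

Lemma iso_dsumC X Y : iso (dsum X Y) (dsum Y X).
Proof.
have [i1 [i2 [p1 [p2 [[h1 h2 k1 k2] [[a b] [c d] e]]]]]] := dsum_maps X Y.
have [j1 [j2 [q1 [q2 [[h1' h2' k1' k2'] [[a' b'] [c' d'] e']]]]]] := dsum_maps Y X.
apply: (@iso_of_inverse _ _ ((j1 \o p2) + (j2 \o p1))%VF ((i1 \o q2) + (i2 \o q1))%VF).
- by apply: homD; apply: hom_comp.
- move=> x; rewrite !(add_lfunE, comp_lfunE) !linearD /= a' b' c' d' !linear0 !(add0r, addr0).
  by rewrite -e.
move=> x; rewrite !(add_lfunE, comp_lfunE) !linearD /= a b c d !linear0 !(add0r, addr0).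
by rewrite -e'.
Qed.

Lemma inadd_indec M Y : indecomposable M -> indecomposable Y -> inadd M Y -> iso Y M.
Proof.
move=> [M0 iM] iY /(inadd_split iY)[Z MYZ].
have [Y0|Z0] := iM _ _ MYZ; first by case: iY => /(_ Y0).
by apply: iso_sym; apply: iso_trans MYZ _; apply: iso_trans (iso_dsumC _ _) (iso_dsum0 _ Z0).
Qed.

Lemma inadd_dsum_split X1 X2 Y : indecomposable Y -> inadd (dsum X1 X2) Y ->
  inadd X1 Y \/ inadd X2 Y.
Proof.
move=> iY /(inadd_retract iY)[f [g [hf hg gf]]].
have [i1 [i2 [p1 [p2 [[h1 h2 k1 k2] [_ _ e]]]]]] := dsum_maps X1 X2.
pose h (b : bool) := if b then (g \o (i1 \o (p1 \o f)))%VF else (g \o (i2 \o (p2 \o f)))%VF.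
have hh b : is_hom (h b) by case: b; repeat apply: hom_comp.
have [|b hb0] := @endo_local_sum Y bool h iY hh.
  apply/injP=> u; rewrite big_bool add_lfunE /= !comp_lfunE => u0.
  by rewrite -(gf u) [f u]e linearD.
have [|v [[hv _ _] vu uv]] := @bihom_inv _ _ (h b).
  by split=> //; apply: endo_inj_surj.
case: b hb0 vu uv => hb0 vu uv; [left|right].
  apply: (@retract_inadd _ _ _ _ (p1 \o f)%VF (v \o (g \o i1))%VF); try by repeat apply: hom_comp.
  by move=> x; rewrite -[RHS]vu /h !comp_lfunE.
apply: (@retract_inadd _ _ _ _ (p2 \o f)%VF (v \o (g \o i2))%VF); try by repeat apply: hom_comp.
by move=> x; rewrite -[RHS]vu /h !comp_lfunE.
Qed.

Lemma dim_iso M N : iso M N -> dim M = dim N.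
Proof.
move=> [f [_ f0 f1]]; rewrite -!dimvf -f1 limg_dim_eq // f0; exact: capv0.
Qed.

Lemma dim_dsum M N : dim (dsum M N) = (dim M + dim N)%N.
Proof.
have [i1 [i2 [p1 [p2 [[h1 h2 k1 k2] [[a b] [c d] e]]]]]] := dsum_maps M N.
have := limg_ker_dim p1 fullv; rewrite capfv.
have -> : limg p1 = fullv by apply/surjP=> v; exists (i1 v); rewrite a.
have -> : lker p1 = limg i2.
  apply/vspaceP=> v; rewrite memv_ker; apply/eqP/memv_imgP => [v0|[n _ ->]].
    by exists (p2 v); rewrite ?memvf // {1}[v]e v0 linear0 add0r.
  by rewrite c.
rewrite limg_dim_eq ?dimvf; last by apply/eqP; rewrite capfv; apply/eqP/injP=> n i0; rewrite -(d n) i0 linear0.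
by rewrite addnC => ->.
Qed.

Lemma zero_dim M : is_zero M <-> dim M = 0%N.
Proof.
rewrite -dimvf; split=> [M0|/eqP]; last first.
  by rewrite dimv_eq0 => /eqP M0 v; apply/eqP; rewrite -memv0 -M0 memvf.
by apply/eqP; rewrite dimv_eq0 -subv0; apply/subvP=> v _; rewrite (M0 v) mem0v.
Qed.

(** Replaces the choice of a decomposition into indecomposables, by induction on the dimension. *)
Lemma decomposition_ind (Pr : rmodule A -> Prop) :
  (forall M, is_zero M -> Pr M) -> (forall M, indecomposable M -> Pr M) ->
  (forall M X Y, iso M (dsum X Y) -> Pr X -> Pr Y -> Pr M) -> forall M, Pr M.
Proof.
move=> P0 P1 P2 M; have [n] := ubnP (dim M); elim: n M => // n IH M dM.
have [M0|M0] := pselect (is_zero M); first exact: P0.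
have [iM|iM] := pselect (indecomposable M); first exact: P1.
have [X [Y [MXY X0 Y0]]] : exists X Y, [/\ iso M (dsum X Y), ~ is_zero X & ~ is_zero Y].
  apply: contrapT => nXY; apply: iM; split=> // X Y MXY.
  have [X0|X0] := pselect (is_zero X); [by left|right].
  by apply: contrapT => Y0; apply: nXY; exists X, Y.
have dd : dim M = (dim X + dim Y)%N by rewrite (dim_iso MXY) dim_dsum.
have dX : (0 < dim X)%N by rewrite lt0n; apply/eqP=> /zero_dim.
have dY : (0 < dim Y)%N by rewrite lt0n; apply/eqP=> /zero_dim.
apply: (P2 _ _ _ MXY); apply: IH; apply: leq_trans (_ : dim M <= n)%N; rewrite // dd.
  by rewrite -addn1 leq_add2l.
by rewrite -add1n leq_add2r.
Qed.

Definition noniso_family (C : rmodule A -> Prop) k (X : 'I_k -> rmodule A) : Prop :=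
  (forall i, C (X i)) /\ forall i j, iso (X i) (X j) -> i = j.

Definition complete_family (C : rmodule A -> Prop) k (X : 'I_k -> rmodule A) : Prop :=
  noniso_family C X /\ forall Y, C Y -> exists i, iso Y (X i).

Lemma family_le C k (X : 'I_k -> rmodule A) n (Z : 'I_n -> rmodule A) :
  noniso_family C X -> (forall i, exists j, iso (X i) (Z j)) -> (k <= n)%N.
Proof.
move=> [_ Xinj] XZ; have [f fE] := choice XZ.
suff /leq_card : injective f by rewrite !card_ord.
move=> i j fij; apply: Xinj; apply: iso_trans (fE i) _; rewrite fij.
exact: iso_sym.
Qed.

Lemma family_onto C k (X : 'I_k -> rmodule A) n (Z : 'I_n -> rmodule A) :
  noniso_family C X -> (forall i, exists j, iso (X i) (Z j)) -> (n <= k)%N ->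
  forall j, exists i, iso (X i) (Z j).
Proof.
move=> [_ Xinj] XZ nk j; have [f fE] := choice XZ.
have finj : injective f.
  move=> i i' fij; apply: Xinj; apply: iso_trans (fE i) _; rewrite fij.
  exact: iso_sym.
have : j \in codom f by apply: inj_card_onto; rewrite // !card_ord.
by move=> /codomP[i ->]; exists i.
Qed.

Lemma indec_cover M : exists n (Z : 'I_n -> rmodule A),
  forall Y, indecomposable Y -> inadd M Y -> exists j, iso Y (Z j).
Proof.
elim/decomposition_ind: M => [M M0|M iM|M X1 X2 MX [n [Z ZE]] [m [Z' ZE']]].
- exists 0%N, (fun _ => M) => Y [Y0 _] [I [f [g [_ _ fg]]]]; case: Y0 => y.
  by rewrite [y]fg big1 // => i _; rewrite (M0 (f i y)) linear0.
- by exists 1%N, (fun _ => M) => Y iY MY; exists ord0; apply: inadd_indec.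
exists (n + m)%N, (fun i => match split i with inl j => Z j | inr j => Z' j end) => Y iY MY.
have := inadd_trans (iso_inadd MX).2 MY.
move=> /(inadd_dsum_split iY)[/(ZE _ iY)[j Yj]|/(ZE' _ iY)[j Yj]].
  by exists (lshift m j); rewrite (unsplitK (inl j)).
by exists (rshift n j); rewrite (unsplitK (inr j)).
Qed.

(** A finite list that meets every indecomposable summand of M bounds the number of non-isomorphic
    members of C, so a largest family is complete. *)
Lemma complete_exists M (C : rmodule A -> Prop) :
  (forall Y, C Y -> indecomposable Y /\ inadd M Y) ->
  exists k (X : 'I_k -> rmodule A), complete_family C X.
Proof.
move=> CM; have [n [Z ZE]] := indec_cover M.
have [||[k X] /= fX kmax] := @exists_maximal {k & 'I_k -> rmodule A}
   (fun x => noniso_family C (projT2 x)) (fun x => projT1 x) n (existT _ 0%N (fun _ => M)).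
- by split; case.
- move=> [k X] /= fX; apply: (family_le (Z := Z) fX) => i.
  by have [fX1 _] := fX; have [iX MX] := CM _ (fX1 i); apply: ZE.
exists k, X; split=> // Y CY; apply: contrapT => nY.
pose X' (i : 'I_k.+1) := if unlift ord0 i is Some j then X j else Y.
have /kmax : noniso_family C (projT2 (existT (fun k => 'I_k -> rmodule A) k.+1 X')).
  have [fX1 fX2] := fX; split=> [i|i j]; rewrite /= /X'.
    by case: (unliftP ord0 i).
  case: (unliftP ord0 i) => [i' ->|->]; case: (unliftP ord0 j) => [j' ->|->] //.
  - by move=> /fX2 ->.
  - by move=> /iso_sym Yi; case: nY; exists i'.
  - by move=> Yi; case: nY; exists j'.
by rewrite /= ltnn.
Qed.

Lemma indec_summandE Y M : indec_summand Y M <-> indecomposable Y /\ inadd M Y.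
Proof.
split=> -[iY]; last by move=> /(inadd_split iY); split.
move=> [Z MYZ]; split=> //; apply: inadd_trans (iso_inadd MYZ).1 _.
exact: inadd_dsuml.
Qed.

Definition indec_in M Y : Prop := indecomposable Y /\ inadd M Y.

Lemma nsummandsE M k (X : 'I_k -> rmodule A) :
  complete_family (indec_in M) X -> nsummands M = k.
Proof.
move=> cX; rewrite /nsummands; apply: classical_sets.xget_unique.
  have [[X1 X2] X3] := cX; exists X; split=> // [i|Y].
    by apply/indec_summandE; apply: X1.
  by move=> /indec_summandE; apply: X3.
move=> l [X' [X'1 X'2 X'3]]; have [[X1 X2] X3] := cX.
apply/eqP; rewrite eqn_leq; apply/andP; split.
  apply: (@family_le (indec_in M) _ X' _ X); first by split=> [i|]; [exact/indec_summandE/X'1|exact: X'2].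
  by move=> i; apply: X3; exact/indec_summandE/X'1.
apply: (@family_le (indec_in M) _ X _ X'); first exact: (conj X1 X2).
move=> i; apply: X'3; exact/indec_summandE/X1.
Qed.

Lemma nsummands_family M : exists X : 'I_(nsummands M) -> rmodule A,
  complete_family (indec_in M) X.
Proof.
have [k [X cX]] := @complete_exists M (indec_in M) (fun Y H => H).
by rewrite (nsummandsE cX); exists X.
Qed.

Lemma nsummands_le M X : inadd M X -> (nsummands X <= nsummands M)%N.
Proof.
move=> MX; have [F [F1 F2]] := nsummands_family X.
have [G [G1 G2]] := nsummands_family M.
apply: (family_le F1 (Z := G)) => i; apply: G2.
by have [iF XF] := F1.1 i; split=> //; apply: inadd_trans MX XF.
Qed.

Lemma inadd_of_indec X M :
  (forall Y, indecomposable Y -> inadd M Y -> inadd X Y) -> inadd X M.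
Proof.
elim/decomposition_ind: M => [M M0 _|M iM H|M Y1 Y2 MY IH1 IH2 H].
- exact: inadd_zero.
- by apply: H => //; apply: inadd_refl.
have [MY1 MY2] := iso_inadd MY.
apply: inadd_trans MY2; apply: inadd_dsum; [apply: IH1|apply: IH2] => Y iY YY; apply: H => //.
  exact: inadd_trans MY1 (inadd_trans (inadd_dsuml _ _) YY).
exact: inadd_trans MY1 (inadd_trans (inadd_dsumr _ _) YY).
Qed.

(** The form in which the counting bounds are applied: once a module attains the bound, enlarging it
    adds no new summand. *)
Lemma nsummands_eq M X :
  inadd M X -> (nsummands M <= nsummands X)%N -> inadd X M.
Proof.
move=> MX le; have [F [F1 F2]] := nsummands_family X.
have [G [G1 G2]] := nsummands_family M.
apply: inadd_of_indec => Y iY /(conj iY)/G2[j Yj].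
have [|i FG] := family_onto F1 (Z := G) _ le j.
  move=> i; apply: G2.
  by have [iF XF] := F1.1 i; split=> //; apply: inadd_trans MX XF.
have [iF XF] := F1.1 i; apply: inadd_trans XF _.
by apply: (iso_inadd (iso_trans FG (iso_sym Yj))).1.
Qed.

Lemma nsummands_succ M N X :
  (forall Y, indecomposable Y -> inadd M Y -> inadd N Y \/ iso Y X) ->
  (nsummands M <= (nsummands N).+1)%N.
Proof.
move=> H; have [F [F1 F2]] := nsummands_family M.
have [G [G1 G2]] := nsummands_family N.
apply: (family_le F1
  (Z := fun i : 'I_(nsummands N).+1 => if unlift ord0 i is Some j then G j else X)).
move=> i; have [iF MF] := F1.1 i; have [NF|FX] := H _ iF MF.
  by have [j Fj] := G2 _ (conj iF NF); exists (lift ord0 j); rewrite liftK.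
by exists ord0; rewrite unlift_none.
Qed.

End KrullSchmidt.

(** * Tau-rigidity and support tau-tilting modules *)

Section Presentations.
Variables (K : fieldType) (A : falgType K).
Implicit Types L M N P X Y Z E Q : rmodule A.
Local Notation RA := (regular_module A).

(** Suppose that no composite X -> E -> X is invertible. Then these composites have image in rad
    End(X) X, and all maps M -> X have image in the trace T of M. As M and X generate E,
    surjectivity of p gives X = T + rad End(X) X, so X = T by Nakayama's lemma over the local ring
    End(X), contrary to X not being in Fac M. *)
Lemma nakayama_component M X E (p : 'Hom(E, X)) :
  indecomposable X -> ~ gen M X -> gen (dsum M X) E -> is_hom p -> limg p = fullv ->
  exists2 h : 'Hom(X, E), is_hom h & lker (p \o h)%VF = 0%VS.
Proof.
move=> iX nMX gE hp p1; apply: contrapT => nh.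
have ph0 (h : 'Hom(X, E)) : is_hom h -> lker (p \o h)%VF <> 0%VS.
  by move=> hh h0; apply: nh; exists h.
pose endo_stable (S : {vspace X}) :=
  forall phi : 'Hom(X, X), is_hom phi -> (phi @: S <= S)%VS.
have [T T1 T2] := @span_exists K X (fun v => exists2 f : 'Hom(M, X), is_hom f & v \in limg f).
(* S will be a maximal proper End(X)-submodule containing T, so X / S is simple over End(X). *)
pose Pr (S : {vspace X}) := [/\ (T <= S)%VS, S <> fullv & endo_stable S].
have PT : Pr T.
  split=> //.
    move=> Tf; apply: nMX => U HU; apply/eqP; rewrite eqEsubv subvf -Tf.
    by apply: T2 => v [f hf]; apply/subvP/HU.
  move=> phi hphi; apply/subvP=> _ /memv_imgP[t tT ->]; rewrite memv_preim.
  move: tT; apply/subvP/T2 => v [f hf /memv_imgP[m _ ->]]; rewrite -memv_preim.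
  apply: T1; exists (phi \o f)%VF; first exact: hom_comp.
  by rewrite -comp_lfunE memv_img ?memvf.
have [|S [TS Sf Sst] Smax] := @exists_maximal {vspace X} Pr (fun S : {vspace X} => \dim S) (dim X) T PT.
  by move=> S _; rewrite -dimvf dimvS ?subvf.
have big S' : (S <= S')%VS -> endo_stable S' -> S' = fullv \/ (S' <= S)%VS.
  move=> SS' S'st; have [|S'f] := eqVneq S' fullv; [by left|right].
  rewrite -(geq_leqif (dimv_leqif_sup SS')); apply: Smax; split=> //.
    exact: subv_trans TS SS'.
  exact/eqP.
(* R is rad End(X) X, the radical being formed by the endomorphisms that are not injective. *)
have [R R1 R2] := @span_exists K X (fun v => exists phi : 'Hom(X, X),
  [/\ is_hom phi, lker phi <> 0%VS & v \in limg phi]).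
have Rst : endo_stable R.
  move=> psi hpsi; apply/subvP=> _ /memv_imgP[t tT ->]; rewrite memv_preim.
  move: tT; apply/subvP/R2 => v [f [hf f0 /memv_imgP[m _ ->]]]; rewrite -memv_preim.
  apply: R1; exists (psi \o f)%VF; split; first exact: hom_comp.
    by move=> /endo_injl.
  by rewrite -comp_lfunE memv_img ?memvf.
have addst S1 S2 : endo_stable S1 -> endo_stable S2 -> endo_stable (S1 + S2)%VS.
  by move=> st1 st2 phi hphi; rewrite limgD addvS ?st1 ?st2.
have [SRf|] := big _ (addvSl S R) (addst _ _ Sst Rst); last first.
  rewrite subv_add subvv /= => RS; apply: Sf.
  have pS : (p @^-1: S = fullv)%VS.
    apply: gE => f hf; apply/subvP=> _ /memv_imgP[x _ ->]; rewrite -memv_preim.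
    have [i1 [i2 [p1' [p2' [[h1 h2 k1 k2] [_ _ e]]]]]] := dsum_maps M X.
    rewrite [x]e !linearD /= memvD //.
      apply: (subvP TS); apply: T1; exists (p \o (f \o i1))%VF.
        by apply: hom_comp => //; apply: hom_comp.
      by apply/memv_imgP; exists (p1' x); rewrite ?memvf ?comp_lfunE.
    apply: (subvP RS); apply: R1; exists (p \o (f \o i2))%VF; split.
    - by apply: hom_comp => //; apply: hom_comp.
    - by apply: ph0; apply: hom_comp.
    - by apply/memv_imgP; exists (p2' x); rewrite ?memvf ?comp_lfunE.
  apply/eqP; rewrite eqEsubv subvf -p1; apply/subvP=> _ /memv_imgP[x _ ->].
  by rewrite memv_preim pS memvf.
have [v vS] : exists v, v \notin S.
  apply: contrapT => nv; apply: Sf; apply/eqP; rewrite eqEsubv subvf; apply/subvP=> v _.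
  by apply: contraT => vS; case: nv; exists v.
have [||Ev EvE] := @vspace_exists K X (fun w => exists2 phi : 'Hom(X, X), is_hom phi & w = phi v).
- by exists 0; [apply: hom0|rewrite zero_lfunE].
- move=> k _ _ [f hf ->] [g hg ->]; exists (k *: f + g); first by apply/homD/hg/homZ.
  by rewrite add_lfunE scale_lfunE.
have Evst : endo_stable Ev.
  move=> phi hphi; apply/subvP=> _ /memv_imgP[_ /EvE[f hf ->] ->]; apply/EvE.
  by exists (phi \o f)%VF; [apply: hom_comp|rewrite comp_lfunE].
have vEv : v \in Ev by apply/EvE; exists \1%VF; [apply: hom_id|rewrite id_lfunE].
have [Ef|] := big _ (addvSl S Ev) (addst _ _ Sst Evst); last first.
  rewrite subv_add subvv /= => /subvP/(_ _ vEv) vS'.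
  by rewrite vS' in vS.
have [||Jv JvE] := @vspace_exists K X
  (fun w => exists phi : 'Hom(X, X), [/\ is_hom phi, lker phi <> 0%VS & w = phi v]).
- exists 0; split; [exact: hom0| |by rewrite zero_lfunE].
  by move=> /injP Y0; case: iX => iX _; apply: iX => y; apply: Y0; rewrite zero_lfunE.
- move=> k _ _ [f [hf f0 ->]] [g [hg g0 ->]]; exists (k *: f + g); split.
  + by apply/homD/hg/homZ.
  + apply: endo_local => //; first exact: homZ.
    move=> kf0; apply: f0; apply/injP=> u fu; move/injP: kf0; apply.
    by rewrite scale_lfunE fu scaler0.
  + by rewrite add_lfunE scale_lfunE.
(* From X = S + End(X) v it follows that R lies in S + rad End(X) v. Thus v = s + phi v with s in S
   and phi in the radical, and inverting 1 - phi puts v into S. *)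
have : v \in (S + Jv)%VS.
  have : v \in (S + R)%VS by rewrite SRf memvf.
  apply/subvP; rewrite subv_add addvSl /=; apply: R2 => _ [phi [hphi phi0 /memv_imgP[x _ ->]]].
  have /memv_addP[s sS [_ /EvE[psi hpsi ->] ->]] : x \in (S + Ev)%VS by rewrite Ef memvf.
  rewrite linearD /= memv_add //.
    by apply: (subvP (Sst _ hphi)); rewrite memv_img.
  apply/JvE; exists (phi \o psi)%VF; split; first exact: hom_comp.
    by move=> /endo_injr.
  by rewrite comp_lfunE.
move=> /memv_addP[s sS [_ /JvE[phi [hphi phi0 ->]] vE]].
have [|u [[hu _ _] uK _]] := @bihom_inv _ _ _ _ (\1 - phi)%VF.
  have c0 := complement_inj iX hphi phi0.
  by split=> //; [apply: homB => //; apply: hom_id|apply: endo_inj_surj].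
have vu : v = u s.
  rewrite -[LHS]uK; congr (u _); rewrite add_lfunE opp_lfunE id_lfunE {1}vE.
  by rewrite addrK.
by move: vS; rewrite vu (subvP (Sst _ hu)) // memv_img.
Qed.

Lemma bigdsum_inadd M k : inadd M (\big[@dsum K A/zero_module A]_(i < k) M).
Proof.
elim: k => [|k IH]; first by rewrite big_ord0; apply: inadd_zero => z; apply: thinmx0.
by rewrite big_ord_recl; apply: inadd_dsum => //; apply: inadd_refl.
Qed.

Lemma FacP M N : Fac M N <-> gen M N.
Proof.
split=> [[k [f [hf f1]]]|/gen_finite[s [hs s1]]].
  by apply: gen_surj hf f1 _; apply/gen_inadd/bigdsum_inadd.
exists (size s).
suff [f [hf f1]] : exists f : 'Hom(\big[@dsum K A/zero_module A]_(i < size s) M, N),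
  is_hom f /\ limg f = (\sum_(g <- s) limg g)%VS by exists f; rewrite f1.
elim: s hs {s1} => [|g s IH] hs /=.
  by exists 0; rewrite big_nil lim0g; split=> //; apply: hom0.
have [|f [hf f1]] := IH; first by move=> h hsh; apply: hs; rewrite inE hsh orbT.
rewrite big_ord_recl big_cons -f1.
set Y := \big[_/_]_(_ < _) _ in f hf f1 *.
have [i1 [i2 [p1 [p2 [[h1 h2 k1 k2] [[a b] [c d] e]]]]]] := dsum_maps M Y.
have hg : is_hom g by apply: hs; rewrite inE eqxx.
exists ((g \o p1) + (f \o p2))%VF; split; first by apply: homD; apply: hom_comp.
apply/eqP; rewrite eqEsubv; apply/andP; split.
  apply/subvP=> _ /memv_imgP[x _ ->]; rewrite add_lfunE !comp_lfunE.
  by rewrite memv_add ?memv_img ?memvf.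
rewrite subv_add; apply/andP; split; apply/subvP=> _ /memv_imgP[x _ ->]; apply/memv_imgP.
  by exists (i1 x); rewrite ?memvf // add_lfunE !comp_lfunE a b linear0 addr0.
by exists (i2 x); rewrite ?memvf // add_lfunE !comp_lfunE c d linear0 add0r.
Qed.

Lemma regular_hom M (m : M) : exists2 f : 'Hom(RA, M), is_hom f & forall a : A, f a = ract m a.
Proof.
by have [f fE] := ract_lfun m; exists f => // x a; rewrite !fE /= ractM.
Qed.

Lemma regular_homE M (f : 'Hom(RA, M)) (a : A) : is_hom f -> f a = ract (f (1 : A)) a.
Proof. by move=> hf; rewrite -hf /= mul1r. Qed.

Lemma projective_regular : projective RA.
Proof.
move=> M N g f hg /surjP g1 hf; have [m mE] := g1 (f (1 : A)).
have [h hh hE] := regular_hom m; exists h => //.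
apply/lfunP=> a; rewrite comp_lfunE hE hg -mE -regular_homE //.
Qed.

Lemma projective_inadd P X : inadd P X -> projective P -> projective X.
Proof.
move=> [I [f [g [hf hg fg]]]] pP M N q u hq q1 hu.
have H i : exists h : 'Hom(P, M), is_hom h /\ (q \o h = u \o g i)%VF.
  by have [h hh hE] := pP _ _ _ _ hq q1 (hom_comp hu (hg i)); exists h.
have [h hE] := choice H.
exists (\sum_i (h i \o f i))%VF.
  by apply: hom_sum => i; apply: hom_comp => //; have [] := hE i.
apply/lfunP=> x; rewrite comp_lfunE sum_lfunE linear_sum {2}[x]fg linear_sum.
apply: eq_bigr => i _ /=; have [_ e] := hE i.
by rewrite comp_lfunE -comp_lfunE e comp_lfunE.
Qed.

Lemma gen_regular M : gen RA M.
Proof.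
move=> U HU; apply/eqP; rewrite eqEsubv subvf; apply/subvP=> v _.
have [f hf fE] := regular_hom v; apply: (subvP (HU f hf)); apply/memv_imgP.
by exists (1 : A); rewrite ?memvf // fE ract1.
Qed.

Lemma projectiveP P : projective P <-> inadd RA P.
Proof.
split=> [pP|RP]; last exact: projective_inadd RP projective_regular.
have [Y [p [RY hp p1]]] := gen_cover (@gen_regular P).
have [h hh ph] := pP _ _ _ _ hp p1 (@hom_id _ _ P).
apply: inadd_trans RY _; apply: (retract_inadd hh hp) => x.
by rewrite -comp_lfunE ph id_lfunE.
Qed.

Lemma dual_basis P : projective P -> exists (I : finType) (b : I -> P) (h : I -> 'Hom(P, RA)),
  (forall i, is_hom (h i)) /\ forall x, x = \sum_i ract (b i) (h i x : A).
Proof.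
move=> /projectiveP[I [f [g [hf hg fg]]]].
exists I, (fun i => g i (1 : A)), f; split=> // x.
by rewrite [LHS]fg; apply: eq_bigr => i _; rewrite -regular_homE.
Qed.

(** P is a projective of least dimension mapping onto M. Given g, let U be a minimal submodule of im
    g that still maps onto M, and lift f to a map P -> U. The composite U -> P -> U is onto by
    minimality of U, so U is a retract of P, hence projective, and equals P by minimality of P. *)
Lemma projective_cover M : exists P (f : 'Hom(P, M)), cover_of_image f /\ limg f = fullv.
Proof.
pose Pr (x : {P : rmodule A & 'Hom(P, M)}) :=
  [/\ projective (projT1 x), is_hom (projT2 x) & limg (projT2 x) = fullv].
have [Y [p [RY hp p1]]] := gen_cover (@gen_regular M).
have [|[P f] [/= pP hf f1] Pmin] :=
  @exists_minimal _ Pr (fun x => dim (projT1 x)) (existT _ Y p).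
  by split=> //; apply/projectiveP.
exists P, f; split=> //; split=> // X g hg fg.
pose Pr' (U : {vspace P}) := [/\ stable U, (U <= limg g)%VS & (f @: U = fullv)%VS].
have [|U [Ust Ug fU] Umin] := @exists_minimal _ Pr' (fun U : {vspace P} => \dim U) (limg g).
  split=> //; first exact: img_stable (@full_stable _ _ _).
  by rewrite -limg_comp fg.
have [X' [i [hi i0 iU]]] := submod_exists Ust.
have fi1 : limg (f \o i)%VF = fullv by rewrite limg_comp iU.
have [h hh fih] := pP _ _ _ _ (hom_comp hf hi) fi1 hf.
have fihE x : f (i (h x)) = f x by rewrite -[in RHS]fih !comp_lfunE.
have hi1 : limg (h \o i)%VF = fullv.
  have hihi : is_hom (i \o (h \o i))%VF by apply: hom_comp => //; apply: hom_comp.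
  have sub : (limg (i \o (h \o i))%VF <= U)%VS.
    by rewrite limg_comp -iU limgS ?subvf.
  have /Umin : Pr' (limg (i \o (h \o i))%VF).
    split.
    - exact: img_stable (@full_stable _ _ _).
    - exact: subv_trans sub Ug.
    rewrite -fU -iU -!limg_comp; congr (limg _); apply/lfunP=> x.
    by rewrite !comp_lfunE fihE.
  rewrite (geq_leqif (dimv_leqif_sup sub)) => /subvP Usub.
  apply/surjP=> x; have : i x \in U by rewrite -iU memv_img ?memvf.
  move=> /Usub/memv_imgP[y _ ixy]; exists y.
  have /eqP/lker0P : lker i = 0%VS by []; apply.
  by rewrite ixy comp_lfunE.
have hi0 : lker (h \o i)%VF = 0%VS.
  have := limg_ker_dim (h \o i)%VF fullv; rewrite hi1 capfv => /eqP.
  by rewrite -[X in _ == X]add0n eqn_add2r dimv_eq0 => /eqP.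
have [|u [[hu _ _] uK _]] := @bihom_inv _ _ _ _ (h \o i)%VF.
  by split=> //; apply: hom_comp.
have pX' : projective X'.
  apply: projective_inadd pP; apply: (@retract_inadd _ _ _ _ i (u \o h)%VF) => //.
    exact: hom_comp.
  by move=> x; rewrite comp_lfunE -(comp_lfunE h) uK.
have /Pmin /= le : Pr (existT _ X' (f \o i)%VF) by split=> //; apply: hom_comp.
have iF : limg i = fullv.
  apply/eqP; rewrite eqEdim subvf /= limg_dim_eq ?dimvf // i0; exact: capv0.
by apply/eqP; rewrite eqEsubv subvf -iF iU.
Qed.

Lemma minimal_presentation_exists M : exists P1 P0 (f1 : 'Hom(P1, P0)) (f0 : 'Hom(P0, M)),
  minimal_presentation f1 f0.
Proof.
have [P0 [f0 [c0 f01]]] := projective_cover M; have [_ hf0 _] := c0.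
have [L [i [hi i0 iL]]] := submod_exists (ker_stable hf0).
have [P1 [p [[pP1 hp cp] p1]]] := projective_cover L.
exists P1, P0, (i \o p)%VF, f0; split=> //; last by rewrite limg_comp p1.
split=> //; first exact: hom_comp.
move=> X g hg; rewrite -comp_lfunA limg_comp [in RHS]limg_comp => /eqP.
by rewrite eq_limg_ker0 ?i0 // => /eqP; apply: cp.
Qed.

(** Modulo g(ker f1) the map g extends along f1, because Ext^1(X, -) vanishes on quotients of N;
    projectivity of P0 lifts this extension to N. *)
Lemma presentation_factor P1 P0 X N (f1 : 'Hom(P1, P0)) (f0 : 'Hom(P0, X)) :
  minimal_presentation f1 f0 -> (forall N', gen N N' -> ext0 X N') ->
  forall g : 'Hom(P1, N), is_hom g -> exists2 v : 'Hom(P0, N), is_hom v & (v \o f1)%VF = g.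
Proof.
move=> [[pP0 hf0 _] f01 [pP1 hf1 c1] f1K] eX g hg.
have [N' [q [hq q1 qL]]] := quot_exists (img_stable hg (ker_stable hf1)).
have [|v' hv' v'E] := hom_extend hf1 hf0 f01 f1K (hom_comp hq hg) _ (eX N' (gen_surj hq q1 (@gen_refl _ _ N))).
  move=> x fx; apply/eqP; rewrite comp_lfunE -memv_ker qL memv_img //.
  by rewrite memv_ker fx.
have [v hv qv] := pP0 _ _ _ _ hq q1 hv'.
(* The error g' has its values in g(ker f1) = g'(ker f1), so ker f1 + ker g' = P1, and minimality of
   f1 gives g' = 0. *)
exists v => //; pose g' := g - (v \o f1)%VF.
have hg' : is_hom g' by apply: homB => //; apply: hom_comp.
have qg' x : q (g' x) = 0.
  rewrite add_lfunE opp_lfunE linearB /= -[q (g x)]comp_lfunE -v'E -qv.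
  by rewrite !comp_lfunE subrr.
have [X' [j [hj j0 jK]]] := submod_exists (ker_stable hg').
suff g'0 : lker g' = fullv.
  apply/lfunP=> x; apply/esym/eqP; rewrite -subr_eq0 -opp_lfunE -add_lfunE.
  by rewrite -memv_ker g'0 memvf.
rewrite -jK; apply: c1 => //; apply/eqP; rewrite eqEsubv limg_comp limgS ?subvf //=.
apply/subvP=> _ /memv_imgP[x _ ->].
have : g' x \in (g @: lker f1)%VS by rewrite -qL memv_ker qg'.
move=> /memv_imgP[k]; rewrite memv_ker => /eqP fk g'x.
have -> : f1 x = f1 (x - k) by rewrite linearB /= fk subr0.
rewrite memv_img // jK memv_ker linearB /= g'x /g' add_lfunE opp_lfunE comp_lfunE.
by rewrite fk linear0 subr0 subrr.
Qed.

(** Lift f0 to l : P0 -> E. On P1 the map l lands in N; writing this restriction as v f1 corrects l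
    to a map that factors through X and splits E. *)
Lemma factor_ext0 P1 P0 X N (f1 : 'Hom(P1, P0)) (f0 : 'Hom(P0, X)) :
  projective P0 -> is_hom f1 -> is_hom f0 -> limg f0 = fullv -> limg f1 = lker f0 ->
  (forall g : 'Hom(P1, N), is_hom g -> exists2 v : 'Hom(P0, N), is_hom v & (v \o f1)%VF = g) ->
  ext0 X N.
Proof.
move=> pP0 hf1 hf0 f01 f1K fac D cD.
have [E [i [p [s [sip ps pi sE]]]]] := extension_exists cD.
have [hi hp i0 p1 ker] := sip.
have [l hl plE] := pP0 _ _ _ _ hp p1 hf0.
have pl y : p (l y) = f0 y by rewrite -comp_lfunE plE.
have [r ri] := inj_retract i0.
have f01E y : f0 (f1 y) = 0.
  by apply/eqP; rewrite -memv_ker -f1K memv_img ?memvf.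
pose u := (r \o (l \o f1))%VF.
have iu y : i (u y) = l (f1 y).
  have [|n e] := (ker (l (f1 y))).1; first by rewrite pl f01E.
  by rewrite !comp_lfunE e ri.
have hu : is_hom u.
  move=> y a; apply/eqP; rewrite -subr_eq0; apply/eqP; move/injP: (i0) => i0'; apply: i0'.
  by rewrite linearB /= hi !iu hf1 hl subrr.
have [v hv vE] := fac u hu.
pose l' := (l - (i \o v))%VF.
have hl' : is_hom l' by apply: homB => //; apply: hom_comp.
have l'0 y : f0 y = 0 -> l' y = 0.
  move=> fy; have /memv_imgP[x _ ->] : y \in limg f1 by rewrite f1K memv_ker fy.
  by rewrite add_lfunE opp_lfunE comp_lfunE -(comp_lfunE v) vE iu subrr.
have [s0 s0E] := surj_section f01.
have l's y : l' (s0 (f0 y)) = l' y.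
  by apply/eqP; rewrite -subr_eq0 -linearB; apply/eqP/l'0; rewrite linearB /= s0E subrr.
apply: (@section_coboundary _ _ _ _ _ _ _ _ (l' \o s0)%VF _ sip ps sE).
  by move=> x a; rewrite !comp_lfunE -hl' -(l's (ract _ a)) hf0 s0E.
move=> x; rewrite comp_lfunE add_lfunE opp_lfunE linearB /= comp_lfunE pi subr0.
by rewrite pl s0E.
Qed.

End Presentations.

(** * The Auslander-Smalo criterion for tau-rigidity *)

Section TauRigid.
Variables (K : fieldType) (A : falgType K).
Implicit Types L M N P X Y Z E Q : rmodule A.
Local Notation RA := (regular_module A).

Lemma regular_dual_hom P (h : regular_dual P) : is_hom (vsval h : 'Hom(P, RA)).
Proof. exact/mem_hom_space/subvsP. Qed.

Lemma regular_dual_exists P (f : 'Hom(P, RA)) : is_hom f ->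
  exists h : regular_dual P, vsval h = f.
Proof. by move=> /mem_hom_space hf; exists (Subvs hf). Qed.

Lemma regular_dual_ract P (h : regular_dual P) (a : A) x :
  vsval (ract h (a : A^c)) x = a * (vsval h x : A) :> A.
Proof. by rewrite /= comp_lfunE lfunE. Qed.

Section Pairing.
Variables P M : rmodule A.

(* [T m h] is the homomorphism p |-> m h(p), the image of m (x) h under
   M (x) Hom(P, A) -> Hom(P, M). *)
Lemma pairing_exists : exists T : 'Hom(M, 'Hom(regular_dual P, 'Hom(P, M))),
  forall m h p, T m h p = ract m (vsval h p : A).
Proof.
have [||R RE] := @bilin_exists K M A M (fun m a => ract m a).
- by move=> a k u v; rewrite /= ractDl ractZl.
- by move=> m k a b; rewrite /= ractDr ractZr.
have [||T TE] := @bilin_exists K M (regular_dual P) 'Hom(P, M)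
   (fun m h => (R m \o (vsval h : 'Hom(P, A)))%VF).
- by move=> h k u v; rewrite linearP comp_lfunDl -comp_lfunZl.
- move=> m k u v; apply/lfunP=> x.
  by rewrite linearP !(comp_lfunE, add_lfunE, scale_lfunE) linearP.
by exists T => m h p; rewrite TE comp_lfunE RE.
Qed.

End Pairing.

Lemma pairing_hom P M (T : 'Hom(M, 'Hom(regular_dual P, 'Hom(P, M)))) m h :
  (forall m h p, T m h p = ract m (vsval h p : A)) -> is_hom (T m h).
Proof.
by move=> TE p a; rewrite !TE (regular_dual_hom h) /= ractM.
Qed.

(** For projective P, Hom(P, M) is the tensor product of M with Hom(P, A); a dual basis expresses
    this without forming tensor products. *)
Lemma pairing_expand P M (T : 'Hom(M, 'Hom(regular_dual P, 'Hom(P, M)))) :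
  (forall m h p, T m h p = ract m (vsval h p : A)) -> projective P ->
  exists (I : finType) (b : I -> P) (h : I -> regular_dual P),
    (forall g : 'Hom(P, M), is_hom g -> g = \sum_i T (g (b i)) (h i)) /\
    forall f : regular_dual P, f = \sum_i ract (h i) (vsval f (b i) : A).
Proof.
move=> TE /dual_basis[I [b [h [hh bh]]]].
have H i : exists h' : regular_dual P, vsval h' = h i by apply: regular_dual_exists.
have [h' h'E] := choice H; exists I, b, h'; split=> [g hg|f].
  apply/lfunP=> p; rewrite sum_lfunE {1}[p]bh linear_sum.
  by apply: eq_bigr => i _; rewrite /= TE h'E hg.
apply/subvs_inj; rewrite linear_sum; apply/lfunP=> p.
rewrite [in LHS](bh p) linear_sum sum_lfunE.
apply: eq_bigr => i _; rewrite /= (regular_dual_hom f) comp_lfunE lfunE /=.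
by rewrite -[h i]h'E.
Qed.

(** Hom(M, D Tr M) is dual to the cokernel of Hom(P0, M) -> Hom(P1, M), so its vanishing makes every
    map P1 -> M factor through f1. *)
Lemma tau_rigid_rig M : tau_rigid M -> rig M.
Proof.
move=> [N [X [P1 [P0 [f1 [f0 [mp [q [hq q1 kq]]]]]]] isoN] noMN].
have noX : no_hom M (dual_op X).
  move=> f hf; have [g /bihom_inv[g' [[hg' g'0 _] _ gg']]] := isoN.
  have := noMN _ (hom_comp hg' hf) => g'f0; apply/lfunP=> x; rewrite zero_lfunE.
  move/injP: g'0; apply; have /lfunP/(_ x) := g'f0.
  by rewrite comp_lfunE zero_lfunE.
have [[pP0 hf0 _] f01 [pP1 hf1 _] f1K] := mp.
have [T TE] := pairing_exists P1 M.
have fac (g : 'Hom(P1, M)) : is_hom g -> exists2 v : 'Hom(P0, M), is_hom v & (v \o f1)%VF = g.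
  move=> hg.
  have [||W WE] := @vspace_exists K 'Hom(P1, M)
      (fun g => exists2 v : 'Hom(P0, M), is_hom v & (v \o f1)%VF = g).
  - by exists 0; [apply: hom0|rewrite comp_lfun0l].
  - move=> k _ _ [u hu <-] [v hv <-]; exists (k *: u + v); first by apply/homD/hv/homZ.
    by rewrite comp_lfunDl -comp_lfunZl.
  (* A functional l that separates g from the maps through f1 defines a pairing of M with X = Tr M,
     that is, a homomorphism M -> D Tr M. *)
  apply/WE; apply: contraT => /separate[l lW lg].
  have [||B BE] := @bilin_exists K M (regular_dual P1) K^o (fun m h => l (T m h)).
  - by move=> h k u v; rewrite !linearP add_lfunE scale_lfunE linearP.
  - by move=> m k u v; rewrite !linearP.
  have Bker m h : q h = 0 -> B m h = 0.
    move=> /kq[g0 g0E]; rewrite BE; apply/eqP; rewrite -memv_ker; apply: (subvP lW).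
    have [v hv vE] := regular_hom m.
    apply/WE; exists (v \o vsval g0)%VF.
      apply: hom_comp => //; exact: regular_dual_hom.
    by apply/lfunP=> p; rewrite TE g0E !comp_lfunE vE.
  have [s sE] := surj_section q1.
  have Bs m h : B m (s (q h)) = B m h.
    by apply/eqP; rewrite -subr_eq0 -linearB; apply/eqP/Bker; rewrite linearB /= sE subrr.
  have [|phi phiE] := @lfun_exists K M 'Hom(X, K^o) (fun m => (B m \o s)%VF).
    by move=> k u v; rewrite linearP comp_lfunDl -comp_lfunZl.
  have hphi : is_hom (phi : 'Hom(M, dual_op X)).
    move=> m a; apply/lfunP=> x; rewrite phiE /= phiE !comp_lfunE act_lfunE.
    have [h ->] := (surjP q).1 q1 x.
    rewrite -hq !Bs !BE; congr (l _); apply/lfunP=> p.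
    by rewrite !TE regular_dual_ract ractM.
  have phi0 := noX _ hphi.
  have B0 m h : B m h = 0.
    rewrite -Bs; have /lfunP/(_ (q h)) : phi m = 0 by rewrite phi0 zero_lfunE.
    by rewrite phiE comp_lfunE zero_lfunE.
  have [I [b [h [gE _]]]] := pairing_expand TE pP1.
  case/negP: lg; rewrite (gE _ hg) linear_sum big1 // => i _.
  by rewrite /= -BE B0.
move=> Y /gen_cover[Z [p [MZ hp p1]]].
apply: (factor_ext0 pP0 hf1 hf0 f01 f1K) => g hg.
have [u hu <-] := pP1 _ _ _ _ hp p1 hg.
have [I [c [d [hc hd cd]]]] := MZ.
have H i : exists v : 'Hom(P0, M), is_hom v /\ (v \o f1)%VF = (c i \o u)%VF.
  by have [v hv vE] := fac _ (hom_comp (hc i) hu); exists v.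
have [v vE] := choice H.
exists (p \o \sum_i (d i \o v i))%VF.
  by apply: hom_comp => //; apply: hom_sum => i; apply: hom_comp => //; have [] := vE i.
apply/lfunP=> x; rewrite !comp_lfunE sum_lfunE [u x]cd; congr (p _).
apply: eq_bigr => i _; have [_ /lfunP/(_ x)] := vE i.
by rewrite !comp_lfunE => ->.
Qed.

Lemma rig_tau_rigid M : rig M -> tau_rigid M.
Proof.
move=> rM; have [P1 [P0 [f1 [f0 mp]]]] := minimal_presentation_exists M.
have fac := presentation_factor mp rM.
have [[pP0 hf0 _] f01 [pP1 hf1 _] f1K] := mp.
have [||W WE] := @vspace_exists K (regular_dual P1)
   (fun h => exists g : regular_dual P0, vsval h = (vsval g \o f1)%VF).
- by exists 0; rewrite /= comp_lfun0l.
- move=> k u v [g gE] [g' g'E]; exists (k *: g + g') => /=.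
  by rewrite gE g'E comp_lfunDl -comp_lfunZl.
have stW : stable W.
  move=> h a /WE[g gE]; apply/WE; exists (ract g a) => /=.
  by rewrite gE comp_lfunA.
have [X [q [hq q1 qW]]] := quot_exists stW.
exists (dual_op X); first exists X; last 1 first.
- move=> phi hphi.
  have [T TE] := pairing_exists P1 M; have [T' T'E] := pairing_exists P0 M.
  have [I [b [h [gE fE]]]] := pairing_expand TE pP1.
  have [I' [b' [h' [gE' _]]]] := pairing_expand T'E pP0.
  have phiact m a x : phi (ract m a) x = phi m (ract x (a : A^c)).
    by rewrite hphi /= comp_lfunE act_lfunE.
  (* The functional on Hom(P1, M) that corresponds to phi, written in a dual basis of P1. It
     vanishes on the maps through f1, and every map is one of them. *)
  pose l (g : 'Hom(P1, M)) : K^o := \sum_i phi (g (b i)) (q (h i)).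
  have lT m f : l (T m f) = phi m (q f).
    rewrite /l {2}[f]fE !linear_sum; apply: eq_bigr => i _.
    by rewrite /= TE phiact hq.
  apply/lfunP=> m; rewrite zero_lfunE; apply/lfunP=> x; rewrite zero_lfunE.
  have [f ->] := (surjP q).1 q1 x; rewrite -lT.
  have [v hv vE] := fac _ (pairing_hom m f TE).
  have Hj j : exists k : regular_dual P1, vsval k = (vsval (h' j) \o f1)%VF.
    by apply: regular_dual_exists; apply: hom_comp => //; apply: regular_dual_hom.
  have [k kE] := choice Hj.
  have -> : T m f = \sum_j T (v (b' j)) (k j).
    rewrite -vE; apply/lfunP=> p; rewrite comp_lfunE {1}(gE' _ hv) !sum_lfunE.
    by apply: eq_bigr => j _; rewrite TE T'E kE comp_lfunE.
  have lsum (F : I' -> 'Hom(P1, M)) : l (\sum_j F j) = \sum_j l (F j).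
    rewrite /l exchange_big /=; apply: eq_bigr => i _.
    by rewrite sum_lfunE linear_sum sum_lfunE.
  rewrite lsum big1 // => j _; rewrite lT.
  have -> : q (k j) = 0.
    by apply/eqP; rewrite -memv_ker qW; apply/WE; exists (h' j).
  by rewrite linear0.
- exists P1, P0, f1, f0; split=> //; exists q; split=> // h.
  rewrite -WE -qW memv_ker; by split=> /eqP.
- exact: iso_refl.
Qed.

Lemma tau_rigidP M : tau_rigid M <-> rig M.
Proof. by split; [apply: tau_rigid_rig|apply: rig_tau_rigid]. Qed.

End TauRigid.

(** * Counting summands by dimensions of Hom spaces *)

Section Counting.
Variables (K : fieldType) (A : falgType K).
Implicit Types L M N P X Y Z E Q T U V W : rmodule A.
Local Notation RA := (regular_module A).

Definition hdim X N : nat := \dim (hom_space X N).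

Lemma precompose_exists U V N (f : 'Hom(U, V)) :
  exists F : 'Hom('Hom(V, N), 'Hom(U, N)), forall v, F v = (v \o f)%VF.
Proof. by apply: lfun_exists => k u v; rewrite comp_lfunDl -comp_lfunZl. Qed.

Lemma postcompose_exists U V N (f : 'Hom(U, V)) :
  exists F : 'Hom('Hom(N, U), 'Hom(N, V)), forall v, F v = (f \o v)%VF.
Proof. by apply: lfun_exists => k u v; rewrite comp_lfunDr -comp_lfunZr. Qed.

Lemma hom_spaceP X N (f : 'Hom(X, N)) : reflect (is_hom f) (f \in hom_space X N).
Proof. by apply: (iffP idP) => /mem_hom_space. Qed.

Lemma hdim_rex U V W N (f : 'Hom(U, V)) (p : 'Hom(V, W)) :
  is_hom f -> is_hom p -> limg p = fullv -> limg f = lker p ->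
  (forall u : 'Hom(U, N), is_hom u -> exists2 v : 'Hom(V, N), is_hom v & (v \o f)%VF = u) ->
  (hdim W N + hdim U N = hdim V N)%N.
Proof.
move=> hf hp p1 fp fac.
have [F FE] := precompose_exists N f; have [G GE] := precompose_exists N p.
have [s ps] := surj_section p1.
have Finj : lker G = 0%VS.
  apply/injP=> w; rewrite GE => /lfunP w0; apply/lfunP=> x.
  by have := w0 (s x); rewrite comp_lfunE ps !zero_lfunE.
rewrite /hdim -(limg_ker_dim F (hom_space V N)).
have -> : (F @: hom_space V N)%VS = hom_space U N.
  apply/vspaceP=> u; apply/memv_imgP/hom_spaceP => [[v /hom_spaceP hv ->]|].
    by rewrite FE; apply: hom_comp.
  by move=> /fac[v hv vE]; exists v; [apply/hom_spaceP|rewrite FE].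
have <- : (G @: hom_space W N)%VS = (hom_space V N :&: lker F)%VS.
  apply/vspaceP=> v; rewrite memv_cap memv_ker FE.
  apply/memv_imgP/andP=> [[w /hom_spaceP hw ->]|[/hom_spaceP hv /eqP v0]].
    rewrite GE; split; first by apply/hom_spaceP/hom_comp.
    apply/eqP/lfunP=> x; rewrite !comp_lfunE zero_lfunE.
    have -> : p (f x) = 0 by apply/eqP; rewrite -memv_ker -fp memv_img ?memvf.
    by rewrite linear0.
  have vker x : p x = 0 -> v x = 0.
    move=> px; have /memv_imgP[y _ ->] : x \in limg f by rewrite fp memv_ker px.
    by rewrite -comp_lfunE v0 zero_lfunE.
  have vs x : v (s (p x)) = v x.
    by apply/eqP; rewrite -subr_eq0 -linearB; apply/eqP/vker; rewrite linearB /= ps subrr.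
  exists (v \o s)%VF; last by rewrite GE; apply/lfunP=> x; rewrite !comp_lfunE vs.
  by apply/hom_spaceP => x a; rewrite !comp_lfunE -hv -(vs (ract _ a)) hp ps.
by rewrite limg_dim_eq // Finj capv0.
Qed.

Lemma no_hom_hdim X N : no_hom X N -> hdim X N = 0%N.
Proof.
move=> XN; apply/eqP; rewrite dimv_eq0 -subv0; apply/subvP=> f /hom_spaceP/XN ->.
exact: mem0v.
Qed.

Lemma hdim_no_hom X N : hdim X N = 0%N -> no_hom X N.
Proof.
move=> /eqP; rewrite dimv_eq0 => /eqP h f /hom_spaceP.
by rewrite h memv0 => /eqP.
Qed.

Lemma hdim_zero X N : is_zero X -> hdim X N = 0%N.
Proof.
move=> X0; apply: no_hom_hdim => f _; apply/lfunP=> x.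
by rewrite (X0 x) !linear0.
Qed.

Lemma hdim_dsum X Y N : hdim (dsum X Y) N = (hdim X N + hdim Y N)%N.
Proof.
have [i1 [i2 [p1 [p2 [[h1 h2 k1 k2] [[a b] [c d] e]]]]]] := dsum_maps X Y.
rewrite addnC -(@hdim_rex X (dsum X Y) Y N i1 p2) //.
- by apply/surjP=> y; exists (i2 y); rewrite d.
- apply/vspaceP=> v; rewrite memv_ker; apply/memv_imgP/eqP => [[x _ ->]|v0]; first exact: b.
  by exists (p1 v); rewrite ?memvf // {1}[v]e v0 linear0 addr0.
- move=> u hu; exists (u \o p1)%VF; first exact: hom_comp.
  by apply/lfunP=> x; rewrite !comp_lfunE a.
Qed.

Lemma hdim_iso X Y N : iso X Y -> hdim X N = hdim Y N.
Proof.
move=> [f [hf f0 f1]]; have Z0 : is_zero (zero_module A) by move=> z; apply: thinmx0.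
rewrite -(@hdim_rex (zero_module A) X Y N 0 f) //; first by rewrite (hdim_zero N Z0) addn0.
- exact: hom0.
- by rewrite lim0g f0.
move=> u _; exists 0; first exact: hom0.
by apply/lfunP=> x; rewrite (Z0 x) !linear0.
Qed.

Lemma no_hom_gen P M N : projective P -> no_hom P M -> gen M N -> no_hom P N.
Proof.
move=> pP PM /gen_cover[Y [p [[I [f [g [hf hg fg]]]] hp p1]]] u hu.
have [v hv <-] := pP _ _ _ _ hp p1 hu.
apply/lfunP=> x; rewrite comp_lfunE zero_lfunE [v x]fg big1 ?linear0 // => i _.
by have := PM _ (hom_comp (hf i) hv) => /lfunP/(_ x); rewrite comp_lfunE zero_lfunE => ->; rewrite linear0.
Qed.

Lemma no_hom_inadd P X M : inadd P X -> no_hom P M -> no_hom X M.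
Proof.
move=> [I [f [g [hf hg fg]]]] PM u hu; apply/lfunP=> x.
rewrite zero_lfunE [x]fg linear_sum big1 // => i _ /=.
by have := PM _ (hom_comp hu (hg i)) => /lfunP/(_ (f i x)); rewrite comp_lfunE zero_lfunE.
Qed.

Lemma no_hom_indec P M :
  (forall Y, indecomposable Y -> inadd P Y -> no_hom Y M) -> no_hom P M.
Proof.
elim/decomposition_ind: P => [P P0 _|P iP H|P X1 X2 PX IH1 IH2 H].
- by move=> f _; apply/lfunP=> x; rewrite (P0 x) !linear0.
- by apply: H => //; apply: inadd_refl.
have [PX1 PX2] := iso_inadd PX.
apply: hdim_no_hom; rewrite (hdim_iso _ PX) hdim_dsum !no_hom_hdim //.
  by apply: IH2 => Y iY YY; apply: H => //; apply: inadd_trans PX1 (inadd_trans (inadd_dsumr _ _) YY).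
by apply: IH1 => Y iY YY; apply: H => //; apply: inadd_trans PX1 (inadd_trans (inadd_dsuml _ _) YY).
Qed.

Lemma hom_image_dim X T N N' (q : 'Hom(T, N)) (q' : 'Hom(T, N'))
    (F : 'Hom('Hom(X, T), 'Hom(X, N))) (F' : 'Hom('Hom(X, T), 'Hom(X, N'))) :
  (forall v, F v = (q \o v)%VF) -> (forall v, F' v = (q' \o v)%VF) ->
  (forall v : 'Hom(X, T), is_hom v -> (q \o v)%VF = 0 <-> (q' \o v)%VF = 0) ->
  \dim (F @: hom_space X T) = \dim (F' @: hom_space X T).
Proof.
move=> FE F'E qq; have := limg_ker_dim F (hom_space X T).
have <- := limg_ker_dim F' (hom_space X T).
suff -> : (hom_space X T :&: lker F = hom_space X T :&: lker F')%VS by move=> /addnI.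
apply/vspaceP=> v; rewrite !memv_cap !memv_ker FE F'E.
by apply/andP/andP=> -[hv /eqP/(qq _ (elimT (hom_spaceP v) hv))/eqP e].
Qed.

(** For X in add T, dim Hom(X, N) will be the dimension of the space of radical maps X -> Y: all
    maps when X is indecomposable and not isomorphic to Y, a proper subspace when X = Y. *)
Lemma radical_test T Y : rig T -> indecomposable Y -> inadd T Y ->
  exists N, [/\ gen T N,
    forall X, indecomposable X -> inadd T X -> ~ iso X Y -> hdim X N = hdim X Y
    & (hdim Y N < hdim Y Y)%N].
Proof.
move=> rT iY TY.
pose rad (f : 'Hom(T, Y)) :=
  is_hom f /\ forall h : 'Hom(Y, T), is_hom h -> lker (f \o h)%VF <> 0%VS.
have [||RT RTE] := @vspace_exists K _ rad.
- split; [exact: hom0|move=> h _ /injP Y0; case: (iY) => nY _; apply: nY => y].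
  by apply: Y0; rewrite comp_lfun0l zero_lfunE.
- move=> k f g [hf f0] [hg g0]; split; first by apply/homD/hg/homZ.
  move=> h hh; rewrite comp_lfunDl -comp_lfunZl; apply: endo_local => //.
  + by apply: homZ; apply: hom_comp.
  + exact: hom_comp.
  + move=> kf0; apply: (f0 h hh); apply/injP=> u fu; move/injP: kf0; apply.
    by rewrite scale_lfunE fu scaler0.
  + exact: g0.
pose k := \dim RT; pose r (i : 'I_k) := (vbasis RT)`_i.
have rR i : rad (r i) by apply/RTE; rewrite vbasis_mem // mem_nth ?size_tuple.
have [T' [inn [pr [hi hp pri v_id]]]] := power_exists T k.
(* A basis of the radical maps T -> Y, assembled into one map through which all of them factor. *)
pose rho := (\sum_i (r i \o pr i))%VF : 'Hom(T', Y).
have hrho : is_hom rho by apply: hom_sum => i; apply: hom_comp => //; have [] := rR i.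
(* Maps from T into the image of rho need not lift to T', so T' is divided only by the trace U0 of T
   in ker rho. As U0 is in Fac T, Ext^1(T, U0) = 0 and Hom(X, T') -> Hom(X, N) is onto for X in add
   T. *)
have [U0 U01 U02] := @span_exists K T' (fun v => exists f : 'Hom(T, T'),
  [/\ is_hom f, (rho \o f)%VF = 0 & v \in limg f]).
have st0 : stable U0.
  move=> v a vU; rewrite -act_lfunE memv_preim; move: v vU; apply/subvP/U02.
  move=> _ [f [hf f0 /memv_imgP[t _ ->]]]; rewrite -memv_preim act_lfunE -hf.
  by apply: U01; exists f; split=> //; rewrite memv_img ?memvf.
have [L [N [i [q [siq iU]]]]] := ses_sub st0.
have [hii hq i0 q1 ker] := siq.
have TT' : inadd T T' by apply: power_inadd v_id.
have gL : gen T L.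
  move=> U HU; apply/eqP; rewrite eqEsubv subvf.
  have /(limg_ker0 fullv U) <- : lker i == 0%VS by apply/eqP.
  rewrite iU; apply: U02 => _ [f [hf f0 /memv_imgP[t _ ->]]].
  have [j ji] := inj_retract i0.
  have ij x : i (j (f x)) = f x.
    have /memv_imgP[l _ ->] : f x \in limg i by rewrite iU; apply: U01; exists f; split=> //; rewrite memv_img ?memvf.
    by rewrite ji.
  have hj : is_hom (j \o f)%VF.
    move=> x a; apply/eqP; rewrite -subr_eq0; apply/eqP; move/injP: (i0); apply.
    by rewrite linearB /= hii !comp_lfunE !ij hf subrr.
  apply/memv_imgP; exists ((j \o f)%VF t); last by rewrite comp_lfunE ij.
  by apply: (subvP (HU _ hj)); rewrite memv_img ?memvf.
have gN : gen T N := gen_surj hq q1 (gen_inadd TT').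
have hdimN X : inadd T X -> exists F : 'Hom('Hom(X, T'), 'Hom(X, Y)),
    (forall v, F v = (rho \o v)%VF) /\ hdim X N = \dim (F @: hom_space X T').
  move=> TX; have [F FE] := postcompose_exists X rho.
  have [G GE] := postcompose_exists X q; exists F; split=> //.
  rewrite -(hom_image_dim GE FE).
    rewrite /hdim; congr (\dim _); apply/vspaceP=> w.
    apply/hom_spaceP/memv_imgP => [hw|[v /hom_spaceP hv ->]]; last by rewrite GE; apply: hom_comp.
    have [v hv <-] := hom_lift siq (ext0_inadd_l TX (rT _ gL)) hw.
    by exists v; [apply/hom_spaceP|rewrite GE].
  move=> v hv; split=> /lfunP v0; apply/lfunP=> x; rewrite comp_lfunE zero_lfunE.
    have qv : q (v x) = 0 by have := v0 x; rewrite comp_lfunE zero_lfunE.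
    have : v x \in U0 by rewrite -iU; have [n ->] := (ker (v x)).1 qv; rewrite memv_img ?memvf.
    move=> vxU; apply/eqP; rewrite -memv_ker; move: (v x) vxU; apply/subvP/U02.
    move=> _ [f [hf /lfunP f0 /memv_imgP[t _ ->]]].
    by rewrite memv_ker -comp_lfunE f0 zero_lfunE.
  have [I [f [g [hf hg fg]]]] := TX.
  have : v x \in U0.
    rewrite [x]fg linear_sum memv_suml // => j _; apply: U01.
    exists (v \o g j)%VF; split; first exact: hom_comp.
      by apply/lfunP=> y; have := v0 (g j y); rewrite !comp_lfunE !zero_lfunE.
    by apply/memv_imgP; exists (f j x); rewrite ?memvf ?comp_lfunE.
  by rewrite -iU => /memv_imgP[n _ ->]; apply/ker; exists n.
exists N; split=> // [X iX TX nXY|].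
  have [F [FE ->]] := hdimN X TX.
  rewrite /hdim; congr (\dim _); apply/vspaceP=> f.
  apply/memv_imgP/hom_spaceP => [[v /hom_spaceP hv ->]|hf].
    by rewrite FE; apply: hom_comp.
  have [a [b [ha hb ba]]] := inadd_retract iX TX.
  have /RTE/coord_vbasis fbE : rad (f \o b)%VF.
    split=> [|h hh]; first exact: hom_comp.
    rewrite -comp_lfunA => fbh0; apply: nXY; apply: iso_sym.
    have [|u [[hu _ _] uK _]] := @bihom_inv _ _ _ _ (f \o (b \o h))%VF.
      by split; [apply: hom_comp => //; apply: hom_comp|exact: fbh0|apply: endo_inj_surj; exact: fbh0].
    apply: inadd_indec => //; apply: (@retract_inadd _ _ _ _ (b \o h)%VF (u \o f)%VF).
    - exact: hom_comp.
    - exact: hom_comp.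
    - by move=> x; rewrite -[RHS]uK !comp_lfunE.
  pose c j := coord (vbasis RT) j (f \o b)%VF.
  exists ((\sum_j c j *: inn j) \o a)%VF.
    by apply/hom_spaceP/hom_comp => //; apply: hom_sum => j; apply: homZ.
  rewrite FE; apply/lfunP=> x; rewrite !comp_lfunE -{1}(ba x).
  have /lfunP/(_ (a x)) := fbE; rewrite comp_lfunE => ->.
  rewrite !sum_lfunE; apply: eq_bigr => j _.
  rewrite linear_sum (bigD1 j) //= big1 ?addr0 => [|l lj].
    by rewrite comp_lfunE !scale_lfunE linearZ /= pri eqxx linearZ.
  by rewrite comp_lfunE !scale_lfunE linearZ /= pri eq_sym (negPf lj) scaler0 linear0.
have [F [FE ->]] := hdimN Y TY.
have sub : (F @: hom_space Y T' <= hom_space Y Y)%VS.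
  apply/subvP=> _ /memv_imgP[v /hom_spaceP hv ->]; apply/hom_spaceP.
  by rewrite FE; apply: hom_comp.
rewrite ltn_neqAle dimvS // andbT; apply/negP => /eqP e.
have : \1%VF \in (F @: hom_space Y T')%VS.
  have /eqP -> : (F @: hom_space Y T')%VS == hom_space Y Y by rewrite eqEdim sub /= e.
  exact/hom_spaceP/hom_id.
move=> /memv_imgP[v /hom_spaceP hv]; rewrite FE => id_v.
have [||j] := @endo_local_sum _ _ Y _ (fun j => r j \o (pr j \o v))%VF iY.
- by move=> j; apply: hom_comp; [have [] := rR j|apply: hom_comp].
- apply/injP=> y; rewrite sum_lfunE => y0.
  have /lfunP/(_ y) := id_v; rewrite id_lfunE comp_lfunE sum_lfunE => ->.
  by rewrite -[RHS]y0; apply: eq_bigr => j _; rewrite !comp_lfunE.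
by have [_ r0] := rR j; apply: r0; apply: hom_comp.
Qed.

(** For phi : P -> M nonzero and U' a maximal submodule of im phi, the quotients of M by im phi and
    by U' differ by the simple top of P, to which no other indecomposable projective maps. *)
Lemma projective_test P M : indecomposable P -> projective P -> ~ no_hom P M ->
  exists N1 N2, [/\ gen M N1, gen M N2,
    forall P', indecomposable P' -> projective P' -> ~ iso P' P -> hdim P' N1 = hdim P' N2
    & (hdim P N1 < hdim P N2)%N].
Proof.
move=> iP pP nPM.
have [phi hphi phi0] : exists2 phi : 'Hom(P, M), is_hom phi & phi != 0.
  apply: contrapT => H; apply: nPM => f hf; apply/eqP; apply: contraT => f0.
  by case: H; exists f.
pose Pr (U : {vspace M}) := [/\ stable U, (U <= limg phi)%VS & U <> limg phi].
have [||U' [stU' U'phi U'n] U'max] :=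
  @exists_maximal {vspace M} Pr (fun U : {vspace M} => \dim U) (dim M) 0%VS.
- split; [by move=> v a; rewrite !memv0 => /eqP ->; rewrite ract0l|exact: sub0v|].
  move=> e; case/eqP: phi0; apply/lfunP=> x; apply/eqP.
  by rewrite zero_lfunE -memv0 e memv_img ?memvf.
- by move=> U _; rewrite -dimvf dimvS ?subvf.
have stU := img_stable hphi (@full_stable _ _ P).
have [N1 [q1 [hq1 q11 q1k]]] := quot_exists stU.
have [N2 [q2 [hq2 q21 q2k]]] := quot_exists stU'.
exists N1, N2.
have surj_space P' N q (F : 'Hom('Hom(P', M), 'Hom(P', N))) : projective P' -> is_hom q ->
    limg q = fullv -> (forall v, F v = (q \o v)%VF) ->
    (F @: hom_space P' M)%VS = hom_space P' N.
  move=> pP' hq qq FE; apply/vspaceP=> w.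
  apply/memv_imgP/hom_spaceP => [[v /hom_spaceP hv ->]|hw]; first by rewrite FE; apply: hom_comp.
  by have [v hv vE] := pP' _ _ _ _ hq qq hw; exists v; [apply/hom_spaceP|rewrite FE].
split.
- exact: gen_surj hq1 q11 (@gen_refl _ _ M).
- exact: gen_surj hq2 q21 (@gen_refl _ _ M).
- move=> P' iP' pP' nP'P.
  have [F1 F1E] := postcompose_exists P' q1; have [F2 F2E] := postcompose_exists P' q2.
  rewrite /hdim -(surj_space _ _ _ _ pP' hq1 q11 F1E) -(surj_space _ _ _ _ pP' hq2 q21 F2E).
  apply: (hom_image_dim F1E F2E) => v hv.
  have kerE N (q : 'Hom(M, N)) : (q \o v)%VF = 0 <-> (limg v <= lker q)%VS.
    split=> [/lfunP e|/subvP e].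
      by apply/subvP=> _ /memv_imgP[x _ ->]; rewrite memv_ker -comp_lfunE e zero_lfunE.
    apply/lfunP=> x; rewrite comp_lfunE zero_lfunE; apply/eqP; rewrite -memv_ker.
    by apply: e; rewrite memv_img ?memvf.
  rewrite !kerE q1k q2k; split=> [vU|vU']; last exact: subv_trans vU' U'phi.
  apply: contrapT => nvU'; apply: nP'P; apply: iso_sym; apply: inadd_indec => //.
  have sumU : (U' + limg v = limg phi)%VS.
    apply: contrapT => ne; apply: nvU'.
    have /U'max : Pr (U' + limg v)%VS.
      split=> //; last by rewrite subv_add U'phi vU.
      move=> _ a /memv_addP[x xU' [y yv ->]]; rewrite ractDl memv_add ?stU' //.
      exact: img_stable hv (@full_stable _ _ P') _ _ yv.
    by rewrite (geq_leqif (dimv_leqif_sup (addvSl _ _))); apply: subv_trans; apply: addvSr.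
  have im2 : limg (q2 \o v)%VF = limg (q2 \o phi)%VF.
    rewrite !limg_comp -sumU limgD.
    have /eqP -> : (q2 @: U' == 0)%VS by rewrite -lkerE q2k.
    by rewrite add0v.
  have [S [i [hi i0 iS]]] := submod_exists (img_stable (hom_comp hq2 hphi) (@full_stable _ _ P)).
  have [j ji] := inj_retract i0.
  have factor X (f : 'Hom(X, N2)) : is_hom f -> limg f = limg i ->
      exists f' : 'Hom(X, S), [/\ is_hom f', limg f' = fullv & forall x, i (f' x) = f x].
    move=> hf fi.
    have ij x : i (j (f x)) = f x.
      have /memv_imgP[l _ ->] : f x \in limg i by rewrite -fi memv_img ?memvf.
      by rewrite ji.
    exists (j \o f)%VF; split=> [x a||x]; last by rewrite comp_lfunE ij.
      apply/eqP; rewrite -subr_eq0; apply/eqP; move/injP: (i0); apply.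
      by rewrite linearB /= hi !comp_lfunE !ij hf subrr.
    apply/surjP=> s; have /memv_imgP[x _ e] : i s \in limg f by rewrite fi memv_img ?memvf.
    by exists x; rewrite comp_lfunE -e ji.
  have [f [hf f1 fE]] := factor P (q2 \o phi)%VF (hom_comp hq2 hphi) (esym iS).
  have [g [hg g1 gE]] := factor P' (q2 \o v)%VF (hom_comp hq2 hv) (etrans im2 (esym iS)).
  have [w hw fw] := pP' _ _ _ _ hf f1 hg.
  have [w' hw' gw'] := pP _ _ _ _ hg g1 hf.
  (* P and P' both cover the simple module im phi / U', so w and w' are maps over it and f (1 - w
     w') = 0. If w w' were not injective, 1 - w w' would be invertible and f would vanish. *)
  have ww'0 : lker (w \o w')%VF = 0%VS.
    apply: contrapT => n0; have /endo_inj_surj/surjP c1 := complement_inj iP (hom_comp hw hw') n0.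
    apply: nvU'; rewrite -q2k -kerE; apply/lfunP=> x; rewrite zero_lfunE -gE.
    suff f0 y : f y = 0 by rewrite -fw comp_lfunE f0 linear0.
    have [z ->] := c1 y; rewrite add_lfunE opp_lfunE id_lfunE linearB /=.
    by rewrite comp_lfunE -[f (w _)]comp_lfunE fw -[g _]comp_lfunE gw' subrr.
  have [|u [[hu _ _] uK _]] := @bihom_inv _ _ _ _ (w \o w')%VF.
    by split=> //; [apply: hom_comp|apply: endo_inj_surj].
  apply: (@retract_inadd _ _ _ _ w' (u \o w)%VF) => //; first exact: hom_comp.
  by move=> x; rewrite -[RHS]uK !comp_lfunE.
have [F1 F1E] := postcompose_exists P q1; have [F2 F2E] := postcompose_exists P q2.
rewrite /hdim -(surj_space _ _ _ _ pP hq1 q11 F1E) -(surj_space _ _ _ _ pP hq2 q21 F2E).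
have e1 := limg_ker_dim F1 (hom_space P M); have e2 := limg_ker_dim F2 (hom_space P M).
suff lt : (\dim (hom_space P M :&: lker F2) < \dim (hom_space P M :&: lker F1))%N.
  by rewrite -(ltn_add2l (\dim (hom_space P M :&: lker F2))) e2 -e1 ltn_add2r.
have sub : (hom_space P M :&: lker F2 <= hom_space P M :&: lker F1)%VS.
  apply: capvS => //; apply/subvP=> v; rewrite !memv_ker F1E F2E => /eqP/lfunP v0.
  apply/eqP/lfunP=> x; rewrite comp_lfunE zero_lfunE; apply/eqP; rewrite -memv_ker q1k.
  apply: (subvP U'phi); rewrite -q2k memv_ker; have := v0 x.
  by rewrite comp_lfunE zero_lfunE => ->.
rewrite ltn_neqAle dimvS // andbT; apply/negP => /eqP e.
have : phi \in (hom_space P M :&: lker F2)%VS.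
  have /eqP -> : (hom_space P M :&: lker F2 == hom_space P M :&: lker F1)%VS by rewrite eqEdim sub /= e.
  rewrite memv_cap memv_ker F1E; apply/andP; split; first exact/hom_spaceP.
  by apply/eqP/lfunP=> x; rewrite comp_lfunE zero_lfunE; apply/eqP; rewrite -memv_ker q1k memv_img ?memvf.
rewrite memv_cap memv_ker F2E => /andP[_ /eqP/lfunP p0]; apply: U'n; apply/eqP.
rewrite eqEsubv U'phi /=; apply/subvP=> _ /memv_imgP[x _ ->].
by rewrite -q2k memv_ker -comp_lfunE p0 zero_lfunE.
Qed.

End Counting.

Lemma rank_bound (t m : nat) (x : 'I_t -> 'I_t -> rat) (y : 'I_m -> 'I_t -> rat)
    (c : 'I_t -> 'I_m -> rat) :
  (forall i j, x i j = \sum_l c i l * y l j) -> (forall i j, i != j -> x i j = 0) ->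
  (forall i, x i i != 0) -> (t <= m)%N.
Proof.
move=> xE x0 x1.
pose X := \matrix_(i, j) x i j; pose Y := \matrix_(l, j) y l j; pose C := \matrix_(i, l) c i l.
have XE : X = C *m Y.
  by apply/matrixP=> i j; rewrite !mxE xE; apply: eq_bigr => l _; rewrite !mxE.
have X1 : X \in unitmx.
  rewrite unitmxE; have -> : X = diag_mx (\row_i x i i).
    apply/matrixP=> i j; rewrite !mxE; case: eqVneq => [->|ij]; rewrite ?mulr1n // mulr0n.
    exact: x0.
  by rewrite det_diag unitfE; apply/prodf_neq0 => i _; rewrite mxE.
have := mxrankM_maxl C Y; rewrite -XE mxrank_unit // => /leq_trans; apply.
exact: rank_leq_col.
Qed.

Section CountingTheorems.
Variables (K : fieldType) (A : falgType K).
Implicit Types L M N P X Y Z E Q T U V W : rmodule A.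
Local Notation RA := (regular_module A).

(** Additivity of dim Hom(-, N) over a decomposition, dropping the indecomposables that the test
    modules do not see. *)
Lemma hdim_expand T k (F : 'I_k -> rmodule A) (tst : rmodule A -> Prop) :
  (forall Y, indecomposable Y -> inadd T Y ->
     (exists i, iso Y (F i)) \/ forall N, tst N -> hdim Y N = 0%N) ->
  forall X, inadd T X -> exists c : 'I_k -> nat,
    forall N, tst N -> hdim X N = (\sum_i c i * hdim (F i) N)%N.
Proof.
move=> H; elim/decomposition_ind => [X X0 _|X iX TX|X X1 X2 XX IH1 IH2 TX].
- exists (fun _ => 0%N) => N _; rewrite hdim_zero // big1 // => i _.
- have [[i Xi]|X0] := H _ iX TX.
    exists (fun j => (j == i)%N) => N _; rewrite (hdim_iso _ Xi) (bigD1 i) //= eqxx mul1n.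
    by rewrite big1 ?addn0 // => j /negPf ->.
  by exists (fun _ => 0%N) => N tN; rewrite X0 // big1 // => i _.
have [XX1 XX2] := iso_inadd XX.
have [c1 c1E] := IH1 (inadd_trans TX (inadd_trans XX1 (inadd_dsuml _ _))).
have [c2 c2E] := IH2 (inadd_trans TX (inadd_trans XX1 (inadd_dsumr _ _))).
exists (fun i => c1 i + c2 i)%N => N tN.
rewrite (hdim_iso _ XX) hdim_dsum c1E // c2E // -big_split /=.
by apply: eq_bigr => i _; rewrite mulnDl.
Qed.

Definition supported_projective M Y : Prop :=
  [/\ indecomposable Y, projective Y & ~ no_hom Y M].

Definition unsupported_projective M Y : Prop :=
  [/\ indecomposable Y, projective Y & no_hom Y M].

Lemma supported_expand M m (G : 'I_m -> rmodule A) P :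
  complete_family (supported_projective M) G -> projective P ->
  exists c : 'I_m -> nat, forall N, gen M N -> hdim P N = (\sum_i c i * hdim (G i) N)%N.
Proof.
move=> [_ cG] /projectiveP pP; apply: hdim_expand pP => Y iY /projectiveP pY.
have [YM|YM] := pselect (no_hom Y M); [right|left].
  by move=> N MN; apply/no_hom_hdim/(no_hom_gen pY YM MN).
by apply: cG; split.
Qed.

(* This is support tau-tilting, see [support_tau_tiltingP]. *)
Definition maximal_rig M : Prop := rig M /\
  forall X, gen M X -> (forall N, gen M N -> ext0 X N) -> inadd M X.

(** This is the linear independence of g-vectors. On Fac T each dim Hom(F i, -) is a combination of
    the dim Hom(G l, -), and the test modules of [radical_test] make the matrix of differences
    diagonal with nonzero entries. *)
Lemma nsummands_le_supported T m (G : 'I_m -> rmodule A) :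
  rig T -> complete_family (supported_projective T) G -> (nsummands T <= m)%N.
Proof.
move=> rT cG; have [F [[F1 F2] F3]] := nsummands_family T.
have H j : exists N, [/\ gen T N,
    forall X, indecomposable X -> inadd T X -> ~ iso X (F j) -> hdim X N = hdim X (F j)
    & (hdim (F j) N < hdim (F j) (F j))%N].
  by have [iF TF] := F1 j; apply: radical_test.
have [N NE] := choice H.
have H' i : exists c : 'I_m -> rat, forall N', gen T N' ->
    (hdim (F i) N')%:R = \sum_l c l * (hdim (G l) N')%:R.
  have [iF TF] := F1 i.
  have [P1 [P0 [f1 [f0 mp]]]] := minimal_presentation_exists (F i).
  have [[pP0 hf0 _] f01 [pP1 hf1 _] f1K] := mp.
  have [c1 c1E] := supported_expand cG pP1; have [c0 c0E] := supported_expand cG pP0.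
  (* The g-vector of [F i]: multiplicities in P0 minus multiplicities in P1. *)
  exists (fun l => (c0 l)%:R - (c1 l)%:R) => N' TN'.
  have fac := presentation_factor mp (fun N'' N'N'' => ext0_inadd_l TF (rT _ (gen_trans TN' N'N''))).
  have e := hdim_rex hf1 hf0 f01 f1K fac.
  apply: (addIr (hdim P1 N')%:R); rewrite -natrD e (c0E _ TN') (c1E _ TN') !natr_sum.
  by rewrite -big_split /=; apply: eq_bigr => l _; rewrite !natrM mulrBl subrK.
have [c cE] := choice H'.
apply: (@rank_bound _ _
  (fun i j => (hdim (F i) (F j))%:R - (hdim (F i) (N j))%:R)
  (fun l j => (hdim (G l) (F j))%:R - (hdim (G l) (N j))%:R) c).
- move=> i j; have [gN _ _] := NE j; rewrite !cE //; last by apply: gen_inadd; have [] := F1 j.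
  by rewrite -sumrB; apply: eq_bigr => l _; rewrite mulrBr.
- move=> i j ij; have [_ h _] := NE j; have [iF TF] := F1 i.
  by rewrite h ?subrr // => /F2 e; rewrite e eqxx in ij.
- by move=> i; have [_ _ h] := NE i; rewrite subr_eq0 eqr_nat gtn_eqF.
Qed.

(** A basis of Hom(P, T) gives a left add T-approximation f : P -> M0 with cokernel M1. Every map
    from P to a module in Fac T factors through f, which makes M1 Ext-projective in Fac T and the
    dimensions additive. *)
Lemma projective_approximation P T : projective P ->
  (forall N, gen T N -> ext0 T N) ->
  exists M0 M1, [/\ inadd T M0, gen T M1, forall N, gen T N -> ext0 M1 N
    & forall N, gen T N -> (hdim M1 N + hdim P N = hdim M0 N)%N].
Proof.
move=> pP rT.
pose k := \dim (hom_space P T); pose b (i : 'I_k) := (vbasis (hom_space P T))`_i.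
have hb i : is_hom (b i) by apply/hom_spaceP; rewrite vbasis_mem // mem_nth ?size_tuple.
have [M0 [inn [pr [hi hp pri v_id]]]] := power_exists T k.
pose f := (\sum_i (inn i \o b i))%VF.
have hf : is_hom f by apply: hom_sum => i; apply: hom_comp.
have prf i x : pr i (f x) = b i x.
  rewrite /f sum_lfunE linear_sum (bigD1 i) //= comp_lfunE pri eqxx big1 ?addr0 // => j ji.
  by rewrite comp_lfunE pri eq_sym (negPf ji).
clearbody f.
have [M1 [p [hp1 p1 pK]]] := quot_exists (img_stable hf (@full_stable _ _ P)).
have TM0 : inadd T M0 by apply: power_inadd v_id.
have fac N : gen T N -> forall u : 'Hom(P, N), is_hom u ->
    exists2 v : 'Hom(M0, N), is_hom v & (v \o f)%VF = u.
  move=> /gen_cover[Y [q [[I [c [d [hc hd cd]]]] hq q1]]] u hu.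
  have [w hw <-] := pP _ _ _ _ hq q1 hu.
  pose e i j := coord (vbasis (hom_space P T)) j (c i \o w)%VF.
  pose v i := \sum_j e i j *: pr j.
  have hv i : is_hom (v i) by apply: hom_sum => j; apply: homZ.
  have vf i x : v i (f x) = c i (w x).
    have /hom_spaceP/coord_vbasis E : is_hom (c i \o w)%VF by apply: hom_comp.
    rewrite -comp_lfunE E !sum_lfunE; apply: eq_bigr => j _.
    by rewrite !scale_lfunE prf.
  exists (q \o \sum_i (d i \o v i))%VF.
    by apply: hom_comp => //; apply: hom_sum => i; apply: hom_comp.
  apply/lfunP=> x; rewrite !comp_lfunE sum_lfunE [w x]cd; congr (q _).
  by apply: eq_bigr => i _; rewrite comp_lfunE vf.
have pf x : p (f x) = 0 by apply/eqP; rewrite -memv_ker pK memv_img ?memvf.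
exists M0, M1; split=> //.
- exact: gen_surj hp1 p1 (gen_inadd TM0).
- move=> N TN D cD.
  have [D1 cD1 D1E] := cocycle_map hp1 (@hom_id _ _ N) cD.
  have [t tE] := ext0_inadd_l TM0 (rT _ TN) cD1.
  have htf : is_hom (t \o f)%VF.
    move=> x a; apply/eqP; rewrite !comp_lfunE hf -subr_eq0 -tE D1E id_lfunE pf.
    by rewrite linear0 zero_lfunE.
  have [v hv vE] := fac _ TN _ htf.
  have [s ps] := surj_section p1.
  pose t' := t - v.
  have t'0 y : p y = 0 -> t' y = 0.
    move=> py; have /memv_imgP[x _ ->] : y \in limg f by rewrite -pK memv_ker py.
    by rewrite add_lfunE opp_lfunE -[v _]comp_lfunE vE comp_lfunE subrr.
  have t's y : t' (s (p y)) = t' y.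
    by apply/eqP; rewrite -subr_eq0 -linearB; apply/eqP/t'0; rewrite linearB /= ps subrr.
  exists (t' \o s)%VF => x a; rewrite !comp_lfunE -{2}(ps x) -hp1 t's.
  rewrite -{1}(ps x) -[D _ a]id_lfunE -D1E tE /t' !add_lfunE !opp_lfunE hv ractBl.
  by rewrite opprB addrA subrK.
- by move=> N TN; apply: hdim_rex hf hp1 p1 (esym pK) (fac _ TN).
Qed.

(** The previous count with the roles exchanged: maximality puts the cokernel of the approximation
    of [G i] into add T, so on Fac T each dim Hom(G i, -) is a combination of the dim Hom(F l,
    -). *)
Lemma supported_le_nsummands T m (G : 'I_m -> rmodule A) :
  maximal_rig T -> noniso_family (supported_projective T) G -> (m <= nsummands T)%N.
Proof.
move=> [rT mT] [G1 G2]; have [F [[F1 F2] F3]] := nsummands_family T.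
have H l : exists NN : rmodule A * rmodule A, [/\ gen T NN.1, gen T NN.2,
    forall P', indecomposable P' -> projective P' -> ~ iso P' (G l) -> hdim P' NN.1 = hdim P' NN.2
    & (hdim (G l) NN.1 < hdim (G l) NN.2)%N].
  have [iG pG nG] := G1 l; have [N1 [N2 h]] := projective_test iG pG nG.
  by exists (N1, N2).
have [N NE] := choice H.
have H' i : exists c : 'I_(nsummands T) -> rat, forall N', gen T N' ->
    (hdim (G i) N')%:R = \sum_l c l * (hdim (F l) N')%:R.
  have [iG pG nG] := G1 i.
  have [M0 [M1 [TM0 TM1 eM1 e]]] := projective_approximation pG rT.
  have HF Y : indecomposable Y -> inadd T Y ->
     (exists i, iso Y (F i)) \/ forall N, gen T N -> hdim Y N = 0%N.
    by move=> iY TY; left; apply: F3.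
  have [c1 c1E] := hdim_expand HF (mT _ TM1 eM1); have [c0 c0E] := hdim_expand HF TM0.
  exists (fun l => (c0 l)%:R - (c1 l)%:R) => N' TN'.
  apply: (addIr (hdim M1 N')%:R); rewrite -natrD [X in X%:R]addnC (e _ TN') (c0E _ TN') (c1E _ TN') !natr_sum.
  by rewrite -big_split /=; apply: eq_bigr => l _; rewrite !natrM mulrBl subrK.
have [c cE] := choice H'.
apply: (@rank_bound _ _
  (fun i j => (hdim (G i) (N j).2)%:R - (hdim (G i) (N j).1)%:R)
  (fun l j => (hdim (F l) (N j).2)%:R - (hdim (F l) (N j).1)%:R) c).
- move=> i j; have [g1 g2 _ _] := NE j; rewrite !cE //.
  by rewrite -sumrB; apply: eq_bigr => l _; rewrite mulrBr.
- move=> i j ij; have [_ _ h _] := NE j; have [iF TF _] := G1 i.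
  by rewrite h ?subrr // => /G2 e; rewrite e eqxx in ij.
- by move=> i; have [_ _ _ h] := NE i; rewrite subr_eq0 eqr_nat gtn_eqF.
Qed.

Lemma supported_exists M : exists m (G : 'I_m -> rmodule A),
  complete_family (supported_projective M) G.
Proof.
by apply: (@complete_exists _ _ RA) => Y [iY pY _]; split=> //; apply/projectiveP.
Qed.

Lemma unsupported_exists M : exists m (G : 'I_m -> rmodule A),
  complete_family (unsupported_projective M) G.
Proof.
by apply: (@complete_exists _ _ RA) => Y [iY pY _]; split=> //; apply/projectiveP.
Qed.

Lemma supported_count M m (G : 'I_m -> rmodule A) p (G' : 'I_p -> rmodule A) :
  complete_family (supported_projective M) G ->
  complete_family (unsupported_projective M) G' -> (m + p)%N = nsummands RA.
Proof.
move=> [[G1 G2] G3] [[G'1 G'2] G'3]; apply/esym.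
apply: (@nsummandsE _ _ RA _ (fun i => match split i with inl j => G j | inr j => G' j end)).
split; first split=> [i|i j].
- case: (split i) => l; first by have [iG /projectiveP pG _] := G1 l.
  by have [iG /projectiveP pG _] := G'1 l.
- move=> e; rewrite -[i]splitK -[j]splitK; move: e.
  have nGG' l l' : ~ iso (G l) (G' l').
    move=> /iso_inadd[_ e]; have [_ _ nG] := G1 l; apply: nG.
    by have [_ _ nG'] := G'1 l'; apply: no_hom_inadd e nG'.
  case: (split i) => l; case: (split j) => l'; rewrite ?splitK.
  + by move=> /G2 ->.
  + by move=> /nGG'.
  + by move=> /iso_sym/nGG'.
  + by move=> /G'2 ->.
- move=> Y [iY /projectiveP pY]; have [nY|nY] := pselect (no_hom Y M).
    by have [|j Yj] := G'3 Y; [split|exists (rshift m j); rewrite (unsplitK (inr j))].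
  by have [|j Yj] := G3 Y; [split|exists (lshift p j); rewrite (unsplitK (inl j))].
Qed.

Lemma rig_bound M P : rig M -> projective P -> no_hom P M ->
  (nsummands M + nsummands P <= nsummands RA)%N.
Proof.
move=> rM pP PM; have [m [G cG]] := supported_exists M.
have [p [G' cG']] := unsupported_exists M.
rewrite -(supported_count cG cG'); apply: leq_add.
  exact: nsummands_le_supported cG.
have [F [F1 F2]] := nsummands_family P; have [_ G'3] := cG'.
apply: (family_le F1 (Z := G')) => i; have [iF PF] := F1.1 i.
apply: G'3; split=> //; first exact: projective_inadd PF pP.
exact: no_hom_inadd PF PM.
Qed.

Lemma sum_exists p (G : 'I_p -> rmodule A) : (forall i, indecomposable (G i)) ->
  exists P, [/\ forall i, inadd P (G i),
    forall Y, indecomposable Y -> inadd P Y -> exists i, iso Y (G i)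
    & forall L, (forall i, inadd L (G i)) -> inadd L P].
Proof.
elim: p G => [|p IH] G iG.
  have Z0 : is_zero (zero_module A) by move=> z; apply: thinmx0.
  exists (zero_module A); split=> [[]//|Y [Y0 _] [I [f [g [_ _ fg]]]]|L _]; last exact: inadd_zero.
  by case: Y0 => y; rewrite [y]fg big1 // => i _; rewrite (Z0 (f i y)) linear0.
have [P [P1 P2 P3]] := IH (fun i => G (lift ord0 i)) (fun i => iG _).
exists (dsum (G ord0) P); split=> [i|Y iY|L LG].
- case: (unliftP ord0 i) => [j ->|->]; last exact: inadd_dsuml.
  exact: inadd_trans (inadd_dsumr _ _) (P1 j).
- move=> /(inadd_dsum_split iY)[/(inadd_indec (iG _) iY) YG|/(P2 _ iY)[j Yj]].
    by exists ord0.
  by exists (lift ord0 j).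
- by apply: inadd_dsum => //; apply: P3 => i; apply: LG.
Qed.

Lemma maximal_rig_partner M : maximal_rig M -> exists P,
  [/\ projective P, no_hom P M & (nsummands M + nsummands P = nsummands RA)%N].
Proof.
move=> mM; have [m [G cG]] := supported_exists M.
have [p [G' cG']] := unsupported_exists M; have [[G'1 G'2] G'3] := cG'.
have [|P [P1 P2 P3]] := sum_exists (G := G'); first by move=> i; have [] := G'1 i.
have pP : projective P.
  by apply/projectiveP/P3 => i; have [_ /projectiveP] := G'1 i.
have PM : no_hom P M.
  apply: no_hom_indec => Y iY /(P2 _ iY)[i /iso_sym/iso_inadd[Yi _]].
  by have [_ _] := G'1 i; apply: no_hom_inadd.
exists P; split=> //; apply/eqP; rewrite eqn_leq rig_bound //=; last by have [] := mM.
rewrite -(supported_count cG cG'); apply: leq_add.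
  by case: cG => fG _; apply: supported_le_nsummands fG.
rewrite leq_eqVlt; apply/orP; left; apply/eqP/esym; apply: nsummandsE.
split; first by split; [move=> i; split=> //; have [] := G'1 i|exact: G'2].
by move=> Y [iY PY]; apply: P2.
Qed.

Lemma rig_dsum M X : gen M X -> rig M -> (forall N, gen M N -> ext0 X N) -> rig (dsum M X).
Proof.
move=> MX rM eX N VN.
have MN : gen M N by apply: gen_trans VN; apply: gen_dsum => //; apply: gen_refl.
have [i1 [i2 [p1 [p2 [[h1 h2 k1 k2] [[a b] [c d] e]]]]]] := dsum_maps M X.
apply: (@ext0_ses_l _ _ M (dsum M X) X i1 p2) (rM _ MN) (eX _ MN).
split=> //.
- by apply/injP=> m i0; rewrite -(a m) i0 linear0.
- by apply/surjP=> x; exists (i2 x); rewrite d.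
- move=> v; split=> [v0|[m ->]]; last exact: b.
  by exists (p1 v); rewrite {1}[v]e v0 linear0 addr0.
Qed.

(** T is rigid with as many summands as possible, subject to U in add T and T in Fac U. Enlargements
    by Ext-projectives stay under this constraint, so T has them all: it is the co-Bongartz
    completion of U. *)
Lemma rig_completion U : rig U ->
  exists T, [/\ maximal_rig T, gen U T & inadd T U].
Proof.
move=> rU; pose Pr T := [/\ rig T, gen U T & inadd T U].
have [||T [rT UT TU] Tmax] := @exists_maximal _ Pr (@nsummands K A) (nsummands RA) U.
- by split=> //; [apply: gen_refl|apply: inadd_refl].
- move=> T [rT _ _]; apply: leq_trans (_ : nsummands T + nsummands (zero_module A) <= _)%N.
    exact: leq_addr.
  have Z0 : is_zero (zero_module A) by move=> z; apply: thinmx0.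
  apply: rig_bound => //; first by apply/projectiveP/inadd_zero.
  by move=> f _; apply/lfunP=> z; rewrite (Z0 z) !linear0.
exists T; split=> //; split=> // X TX eX.
have TV : gen T (dsum T X) by apply: gen_dsum => //; apply: gen_refl.
apply: inadd_trans (_ : inadd T (dsum T X)) (inadd_dsumr _ _).
apply: nsummands_eq; first exact: inadd_dsuml.
apply: Tmax; split; first exact: rig_dsum.
- exact: gen_trans UT TV.
- exact: inadd_trans (inadd_dsuml _ _) TU.
Qed.

(** A partner P with |M| + |P| = |A| leaves no room for a further Ext-projective of Fac M.
    Conversely, the projectives outside the support of a maximal M fill up the count. *)
Lemma support_tau_tiltingP M : support_tau_tilting M <-> maximal_rig M.
Proof.
split=> [[P [pP /tau_rigidP rM PM e]]|mM].
  split=> // X MX eX; apply: inadd_trans (_ : inadd M (dsum M X)) (inadd_dsumr _ _).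
  apply: nsummands_eq; first exact: inadd_dsuml.
  rewrite -(leq_add2r (nsummands P)) e; apply: rig_bound => //; first exact: rig_dsum.
  by apply: no_hom_gen PM _ => //; apply: gen_dsum => //; apply: gen_refl.
have [P [pP PM e]] := maximal_rig_partner mM.
by exists P; split=> //; apply/tau_rigidP; have [] := mM.
Qed.

End CountingTheorems.

(** * Duality *)

Definition anti_morphism (K : fieldType) (A B : falgType K) (t : B -> A) : Prop :=
  [/\ linear t, t 1 = 1 & forall a b, t (a * b) = t b * t a].

Section DualModule.
Variables (K : fieldType) (A B : falgType K) (t : B -> A) (ht : anti_morphism t).
Implicit Types M N X Y E : rmodule A.

(* The standard duality, along an anti-morphism of algebras so that an algebra and its
   opposite play symmetric roles. *)
Definition adual M : rmodule B.
Proof.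
refine (@RModule K B ('Hom(M, K^o) : vectType K)
  (fun f (b : B) => (f \o @act_lfun K A M (t b))%VF) _ _ _ _).
- by move=> b; apply: (@dual_act_linear K A M).1.
- have [lt _ _] := ht; move=> f k b b' /=; rewrite lt.
  exact: (@dual_act_linear K A M).2.
- by move=> f; apply/lfunP=> v; have [_ -> _] := ht; rewrite comp_lfunE act_lfunE ract1.
- move=> f b b'; apply/lfunP=> v; have [_ _ ->] := ht.
  by rewrite !comp_lfunE !act_lfunE -ractM.
Defined.

Lemma adual_ract M (f : adual M) b (x : M) :
  (ract f b : 'Hom(M, K^o)) x = (f : 'Hom(M, K^o)) (ract x (t b)).
Proof. by rewrite /= comp_lfunE act_lfunE. Qed.

Lemma functional_eq (V : vectType K) (u v : V) :
  (forall f : 'Hom(V, K^o), f u = f v) -> u = v.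
Proof.
move=> uv; apply/eqP; rewrite -subr_eq0; apply: contraT => w0.
have [|l _] := @separate K V 0%VS (u - v); first by rewrite memv0.
by rewrite linearB /= uv subrr eqxx.
Qed.

Lemma dual_map M N (f : 'Hom(M, N)) : is_hom f ->
  exists2 F : 'Hom(adual N, adual M), is_hom F
    & forall g : adual N, F g = ((g : 'Hom(N, K^o)) \o f)%VF.
Proof.
move=> hf; have [|F FE] := @lfun_exists K (adual N) (adual M)
  (fun g : adual N => ((g : 'Hom(N, K^o)) \o f)%VF : adual M).
  by move=> k u v; rewrite comp_lfunDl -comp_lfunZl.
exists F => // g b; rewrite !FE; apply/lfunP=> x.
by rewrite adual_ract !comp_lfunE act_lfunE hf.
Qed.

Lemma dual_inadd M X : inadd M X -> inadd (adual M) (adual X).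
Proof.
move=> [I [f [g [hf hg fg]]]].
have Hf i : exists F : 'Hom(adual M, adual X), is_hom F /\
    forall u : adual M, F u = ((u : 'Hom(M, K^o)) \o f i)%VF.
  by have [F hF FE] := dual_map (hf i); exists F.
have Hg i : exists F : 'Hom(adual X, adual M), is_hom F /\
    forall u : adual X, F u = ((u : 'Hom(X, K^o)) \o g i)%VF.
  by have [F hF FE] := dual_map (hg i); exists F.
have [F FE] := choice Hf; have [G GE] := choice Hg.
exists I, G, F; split=> [i|i|u]; [by have [] := GE i|by have [] := FE i|].
apply/lfunP=> x; rewrite {1}[x]fg linear_sum sum_lfunE; apply: eq_bigr => i _ /=.
by have [_ ->] := FE i; have [_ ->] := GE i; rewrite !comp_lfunE.
Qed.

Lemma dual_iso M N : iso M N -> iso (adual M) (adual N).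
Proof.
move=> [f bf]; have [g [[hg _ _] gf fg]] := bihom_inv bf.
have [G hG GE] := dual_map hg; have [F hF FE] := dual_map (let: And3 h _ _ := bf in h).
apply: (@iso_of_inverse _ _ _ _ G F) => // u; apply/lfunP=> x.
  by rewrite FE GE !comp_lfunE gf.
by rewrite GE FE !comp_lfunE fg.
Qed.

Lemma dual_zero M : is_zero M -> is_zero (adual M).
Proof. by move=> M0 f; apply/lfunP=> x; rewrite (M0 x) !linear0. Qed.

Lemma dual_dsum M N : iso (adual (dsum M N)) (dsum (adual M) (adual N)).
Proof.
have [i1 [i2 [p1 [p2 [[h1 h2 k1 k2] [[a b] [c d] e]]]]]] := dsum_maps M N.
have [j1 [j2 [q1 [q2 [[h1' h2' k1' k2'] [[a' b'] [c' d'] e']]]]]] := dsum_maps (adual M) (adual N).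
have [I1 hI1 I1E] := dual_map h1; have [I2 hI2 I2E] := dual_map h2.
have [P1 hP1 P1E] := dual_map k1; have [P2 hP2 P2E] := dual_map k2.
apply: (@iso_of_inverse _ _ _ _ ((j1 \o I1) + (j2 \o I2))%VF ((P1 \o q1) + (P2 \o q2))%VF).
- by apply: homD; apply: hom_comp.
- move=> u; rewrite !(add_lfunE, comp_lfunE) !linearD /= a' b' c' d' !linear0 !(add0r, addr0).
  by apply/lfunP=> x; rewrite add_lfunE P1E P2E I1E I2E !comp_lfunE -linearD /= -e.
move=> u; rewrite !(add_lfunE, comp_lfunE) !linearD /=.
have IP1 w : I1 (P1 w) = w by apply/lfunP=> x; rewrite I1E P1E !comp_lfunE a.
have IP2 w : I2 (P2 w) = w by apply/lfunP=> x; rewrite I2E P2E !comp_lfunE d.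
have IP3 w : I1 (P2 w) = 0 by apply/lfunP=> x; rewrite I1E P2E !comp_lfunE b linear0 zero_lfunE.
have IP4 w : I2 (P1 w) = 0 by apply/lfunP=> x; rewrite I2E P1E !comp_lfunE c linear0 zero_lfunE.
by rewrite IP1 IP2 IP3 IP4 !linear0 !(add0r, addr0) -e'.
Qed.

Lemma dual_ses N E X (i : 'Hom(N, E)) (p : 'Hom(E, X)) : ses i p ->
  exists (i' : 'Hom(adual X, adual E)) (p' : 'Hom(adual E, adual N)), ses i' p'.
Proof.
move=> sip; have [hi hp i0 p1 ker] := sip.
have [I hI IE] := dual_map hi; have [P hP PE] := dual_map hp.
have [s [r [ps ri pi rs e_id]]] := ses_split sip.
exists P, I; split=> //.
- apply/injP=> u; rewrite PE => u0; apply/lfunP=> x; rewrite -(ps x).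
  by have /lfunP/(_ (s x)) := u0; rewrite comp_lfunE !zero_lfunE.
- apply/surjP=> u; exists ((u : 'Hom(N, K^o)) \o r)%VF; rewrite IE; apply/lfunP=> x.
  by rewrite !comp_lfunE ri.
move=> u; rewrite IE; split=> [u0|[v ->]]; last first.
  by rewrite PE; apply/lfunP=> x; rewrite !comp_lfunE pi linear0 zero_lfunE.
exists ((u : 'Hom(E, K^o)) \o s)%VF; rewrite PE; apply/lfunP=> x.
rewrite !comp_lfunE {1}[x]e_id linearD /=.
by have /lfunP/(_ (r x)) := u0; rewrite comp_lfunE zero_lfunE => ->; rewrite add0r.
Qed.

Definition kills M (a : A) : Prop := forall m : M, ract m a = 0.

End DualModule.

Section Duality.
Variables (K : fieldType) (A B : falgType K) (s : A -> B) (t : B -> A).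
Variables (hs : anti_morphism s) (ht : anti_morphism t).
Hypotheses (ts : forall a, t (s a) = a) (st : forall b, s (t b) = b).
Implicit Types M N X Y E : rmodule A.
Local Notation D := (adual ht).
Local Notation D' := (adual hs).

Lemma bidual M : iso M (D' (D M)).
Proof.
have [||ev evE] := @bilin_exists K M (D M) K^o (fun m f => (f : 'Hom(M, K^o)) m).
- by move=> f k u v; rewrite linearP.
- by move=> m k u v; rewrite add_lfunE scale_lfunE.
have evE' m (f : 'Hom(M, K^o)) : ev m f = f m by exact: evE.
exists (ev : 'Hom(M, D' (D M))); split.
- move=> m a; apply/lfunP=> f; rewrite adual_ract !evE' adual_ract.
  by rewrite ts.
- apply/injP=> m m0; apply: functional_eq => f; rewrite linear0 -evE'.
  by rewrite m0 zero_lfunE.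
apply/surjP=> l; have [m mE] := reflexive_ev (l : 'Hom('Hom(M, K^o), K^o)).
by exists m; apply/lfunP=> f; rewrite mE evE'.
Qed.

(** A cocycle from D N to D X transposes to one from X to N, since finite dimensional spaces are
    reflexive. *)
Lemma ext0_dual1 X N : ext0 X N -> ext0 (D N) (D X).
Proof.
move=> eX C cC.
have [ls s1 sM] := hs; have [lt t1 tM] := ht.
have H x (a : A) : exists n : N, forall g : D N, (C g (s a) : 'Hom(X, K^o)) x = (g : 'Hom(N, K^o)) n.
  have [|l lE] := @lfun_exists K 'Hom(N, K^o) K^o (fun g => (C g (s a) : 'Hom(X, K^o)) x).
    by move=> k u v; rewrite linearP add_lfunE scale_lfunE add_lfunE scale_lfunE.
  by have [n nE] := reflexive_ev l; exists n => g; rewrite -nE lE.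
have H' x : exists f : A -> N, forall a (g : D N), (C g (s a) : 'Hom(X, K^o)) x = (g : 'Hom(N, K^o)) (f a).
  by have [f fE] := choice (H x); exists f.
have [F FE] := choice H'.
have [||G GE] := @bilin_exists K X A N F.
- move=> a k u v; apply: functional_eq => g; rewrite -FE linearP /= !linearP /=.
  by rewrite !FE.
- move=> x k a b; apply: functional_eq => g; rewrite -FE ls linearP /=.
  by rewrite add_lfunE scale_lfunE linearP /= !FE.
have gG x a (g : D N) : (g : 'Hom(N, K^o)) (G x a) = (C g (s a) : 'Hom(X, K^o)) x.
  by rewrite GE FE.
have [|th thE] := eX G.
  move=> x a b; apply: functional_eq => g; rewrite gG sM cC [RHS]linearD.
  rewrite add_lfunE adual_ract ts addrC; congr (_ + _).
    by have := gG x a (@ract _ _ (D N) g (s b)); rewrite adual_ract ts => <-.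
  exact: esym (gG _ _ _).
(* Transposition exchanges the two terms of a coboundary, whence the sign. *)
have [|Th ThE] := @lfun_exists K 'Hom(N, K^o) 'Hom(X, K^o) (fun g => - (g \o th)%VF).
  by move=> k u v; rewrite comp_lfunDl -comp_lfunZl opprD scalerN.
exists (Th : 'Hom(D N, D X)) => g b; apply/lfunP=> x.
rewrite -{1}(st b) -gG thE add_lfunE opp_lfunE adual_ract !ThE !opp_lfunE !comp_lfunE.
by rewrite ?adual_ract ?act_lfunE [X in X = _]linearB /= opprK addrC.
Qed.

Lemma kills_dual1 M (a : A) : kills M a -> kills (D M) (s a).
Proof.
by move=> Ma f; apply/lfunP=> x; rewrite adual_ract ts Ma linear0 zero_lfunE.
Qed.

End Duality.

Lemma ext0_iso_l (K : fieldType) (A : falgType K) (X Y N : rmodule A) :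
  iso X Y -> ext0 X N -> ext0 Y N.
Proof. by move=> /iso_inadd[XY _]; apply: ext0_inadd_l. Qed.

Lemma ext0_iso_r (K : fieldType) (A : falgType K) (X M N : rmodule A) :
  iso M N -> ext0 X M -> ext0 X N.
Proof. by move=> /iso_inadd[XY _]; apply: ext0_inadd_r. Qed.

Section DualExtensions.
Variables (K : fieldType) (A B : falgType K) (s : A -> B) (t : B -> A).
Variables (hs : anti_morphism s) (ht : anti_morphism t).
Hypotheses (ts : forall a, t (s a) = a) (st : forall b, s (t b) = b).
Implicit Types M N X Y E : rmodule A.
Local Notation D := (adual ht).
Local Notation D' := (adual hs).
Local Notation bidual M := (bidual hs ht ts M).

Lemma ext0_dual X N : ext0 X N <-> ext0 (D N) (D X).
Proof.
split; first exact: (ext0_dual1 hs ts st).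
move=> /(ext0_dual1 (ht := hs) ht st ts) e.
apply: ext0_iso_l (iso_sym (bidual X)) _.
exact: ext0_iso_r (iso_sym (bidual N)) e.
Qed.

Lemma inadd_dual M X : inadd M X <-> inadd (D M) (D X).
Proof.
split=> [|/(dual_inadd hs) MX]; first exact: dual_inadd.
apply: inadd_trans (iso_inadd (bidual M)).1 _.
exact: inadd_trans MX (iso_inadd (bidual X)).2.
Qed.

Lemma kills_iso (C : falgType K) (U V : rmodule C) (a : C) : iso U V -> kills U a -> kills V a.
Proof.
by move=> [f [hf _ /surjP f1]] Ua v; have [u ->] := f1 v; rewrite -hf Ua linear0.
Qed.

Lemma kills_dual M (a : A) : kills M a <-> kills (D M) (s a).
Proof.
split=> [|Ma]; first exact: (kills_dual1 ts).
have := kills_dual1 (ht := hs) st Ma; rewrite ts => /kills_iso; apply.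
exact: iso_sym (bidual _).
Qed.

Lemma dual_iso_iff M N : iso M N <-> iso (D M) (D N).
Proof.
split=> [|/(dual_iso hs) MN]; first exact: dual_iso.
exact: iso_trans (bidual M) (iso_trans MN (iso_sym (bidual N))).
Qed.

Lemma dual_zero_iff M : is_zero M <-> is_zero (D M).
Proof.
split=> [|/(dual_zero (ht := hs)) M0]; first exact: dual_zero.
by move=> m; have [f [_ /injP f0 _]] := bidual M; apply: f0; apply: M0.
Qed.

End DualExtensions.

Section DualSummands.
Variables (K : fieldType) (A B : falgType K) (s : A -> B) (t : B -> A).
Variables (hs : anti_morphism s) (ht : anti_morphism t).
Hypotheses (ts : forall a, t (s a) = a) (st : forall b, s (t b) = b).
Implicit Types M N X Y E : rmodule A.
Local Notation D := (adual ht).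
Local Notation D' := (adual hs).

Lemma indec_dual M : indecomposable M -> indecomposable (D M).
Proof.
move=> [M0 iM]; split=> [/(dual_zero_iff hs ht ts) //|X Y DM].
have MXY : iso M (dsum (D' X) (D' Y)).
  apply: iso_trans (bidual hs ht ts M) _; apply: iso_trans (dual_iso hs DM) _.
  exact: dual_dsum.
by have [X0|Y0] := iM _ _ MXY; [left|right]; apply/(dual_zero_iff ht hs st).
Qed.

Lemma bigdsum_dual k (X : 'I_k -> rmodule A) :
  iso (D (\big[@dsum K A/zero_module A]_(i < k) X i))
      (\big[@dsum K B/zero_module B]_(i < k) D (X i)).
Proof.
elim: k X => [|k IH] X.
  rewrite !big_ord0; have Z0 : is_zero (zero_module B) by move=> z; apply: thinmx0.
  have Z0' : is_zero (D (zero_module A)) by apply: dual_zero => z; apply: thinmx0.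
  apply: (@iso_of_inverse _ _ _ _ 0 0); first exact: hom0.
    by move=> x; rewrite (Z0' x) linear0.
  by move=> x; rewrite (Z0 x) linear0.
rewrite !big_ord_recl; apply: iso_trans (dual_dsum ht _ _) _.
have [f [hf f0 f1]] := IH (fun i => X (lift ord0 i)).
set U := D (\big[_/_]_(_ < k) _) in f hf f0 f1 *.
set V := \big[_/_]_(i < k) D _ in f hf f0 f1 *.
have [g [[hg _ _] gf fg]] := bihom_inv (And3 hf f0 f1).
have [i1 [i2 [p1 [p2 [[h1 h2 k1 k2] [[a b] [c d] e]]]]]] := dsum_maps (D (X ord0)) U.
have [j1 [j2 [q1 [q2 [[h1' h2' k1' k2'] [[a' b'] [c' d'] e']]]]]] := dsum_maps (D (X ord0)) V.
apply: (@iso_of_inverse _ _ _ _ ((j1 \o p1) + (j2 \o (f \o p2)))%VF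
  ((i1 \o q1) + (i2 \o (g \o q2)))%VF).
- by apply: homD; apply: hom_comp => //; apply: hom_comp.
- move=> x; rewrite !(add_lfunE, comp_lfunE) !linearD /= a' b' c' d' gf !linear0 !(add0r, addr0).
  by rewrite -e.
move=> x; rewrite !(add_lfunE, comp_lfunE) !linearD /= a b c d fg !linear0 !(add0r, addr0).
by rewrite -e'.
Qed.

Lemma basic_dual M : basic M -> basic (D M).
Proof.
move=> [k [X [iX injX MX]]]; exists k, (fun i => D (X i)); split=> [i|i j|].
- exact: indec_dual.
- by move=> /(dual_iso_iff hs ht ts)/injX.
exact: iso_trans (dual_iso ht MX) (bigdsum_dual X).
Qed.

End DualSummands.

(** * Supports, tilting over the support, and covering relations *)

Section SupportTilting.
Variables (K : fieldType) (A : falgType K).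
Implicit Types B L M N P X Y Z E Q T V W : rmodule A.
Local Notation RA := (regular_module A).

(** Quantifying over all idempotents avoids fixing a complete set of primitive ones; e kills N
    exactly when Hom(eA, N) = 0. *)
Definition supp_le N M : Prop := forall e : A, e * e = e -> kills M e -> kills N e.

Lemma supp_le_trans L M N : supp_le L M -> supp_le M N -> supp_le L N.
Proof. by move=> LM MN e ee Ne; apply: LM => //; apply: MN. Qed.

Lemma kills_inadd M X (e : A) : inadd M X -> kills M e -> kills X e.
Proof.
move=> [I [f [g [hf hg fg]]]] Me x.
rewrite [x]fg ract_suml big1 // => i _.
by rewrite -hg Me linear0.
Qed.

Lemma kills_surj N N' (p : 'Hom(N, N')) (e : A) :
  is_hom p -> limg p = fullv -> kills N e -> kills N' e.
Proof. by move=> hp /surjP p1 Ne v; have [u ->] := p1 v; rewrite -hp Ne linear0. Qed.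

Lemma kills_gen M N (e : A) : gen M N -> kills M e -> kills N e.
Proof.
move=> /gen_cover[Y [p [MY hp p1]]] Me; apply: kills_surj hp p1 _.
exact: kills_inadd MY Me.
Qed.

Lemma gen_supp M N : gen M N -> supp_le N M.
Proof. by move=> MN e _; apply: kills_gen. Qed.

Lemma kills_ses N E X (i : 'Hom(N, E)) (p : 'Hom(E, X)) (e : A) : ses i p -> e * e = e ->
  kills N e -> kills X e -> kills E e.
Proof.
move=> [hi hp _ _ ker] ee Ne Xe v.
have [|n nE] := (ker (ract v e)).1; first by rewrite hp Xe.
by rewrite -ee ractM nE -hi Ne linear0.
Qed.

Lemma kills_sub N E (i : 'Hom(N, E)) (e : A) : is_hom i -> lker i = 0%VS ->
  kills E e -> kills N e.
Proof. by move=> hi /injP i0 Ee n; apply: i0; rewrite hi Ee. Qed.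

Lemma supp_ses N E X M (i : 'Hom(N, E)) (p : 'Hom(E, X)) : ses i p ->
  supp_le N M -> supp_le X M -> supp_le E M.
Proof.
move=> sip NM XM e ee Me; exact: (kills_ses sip ee (NM e ee Me) (XM e ee Me)).
Qed.
Lemma idempotent_projective (e : A) : e * e = e ->
  exists Q, [/\ projective Q & forall M, no_hom Q M <-> kills M e].
Proof.
move=> ee; have [f hf fE] := @regular_hom _ _ RA e.
have [Q [i [hi i0 iQ]]] := submod_exists (img_stable hf (@full_stable _ _ RA)).
have [j ji] := inj_retract i0.
have ij x : i (j (f x)) = f x.
  have /memv_imgP[l _ ->] : f x \in limg i by rewrite iQ memv_img ?memvf.
  by rewrite ji.
have hj : is_hom (j \o f)%VF.
  move=> x a; apply/eqP; rewrite -subr_eq0; apply/eqP; move/injP: (i0); apply.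
  by rewrite linearB /= hi !comp_lfunE !ij hf subrr.
have fi x : f (i x) = i x.
  have /memv_imgP[y _ ->] : i x \in limg f by rewrite -iQ memv_img ?memvf.
  by rewrite !fE /= mulrA ee.
have jfi x : (j \o f)%VF (i x) = x by rewrite comp_lfunE fi ji.
exists Q; split.
  by apply/projectiveP; apply: retract_inadd hi hj jfi.
move=> M; split=> [QM m|Me].
  have [g hg gE] := regular_hom m; have /lfunP/(_ ((j \o f)%VF (1 : A))) := QM _ (hom_comp hg hi).
  by rewrite zero_lfunE !comp_lfunE ij gE fE /= mulr1.
move=> u hu; apply/lfunP=> x; rewrite zero_lfunE.
have hv := hom_comp hu hj.
have -> : u x = (u \o (j \o f))%VF (i x) by rewrite comp_lfunE jfi.
rewrite -(fi x) (regular_homE _ hv).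
have -> : f (i x) = e * (i x) :> A by rewrite fE.
by rewrite ractM Me ract0l.
Qed.

(** An indecomposable summand of P is a retract of A, and the projection onto it is left
    multiplication by an idempotent. *)
Lemma no_hom_supp P M N : projective P -> no_hom P M -> supp_le N M -> no_hom P N.
Proof.
move=> pP PM NM; apply: no_hom_indec => Y iY PY.
have YM := no_hom_inadd PY PM; have /projectiveP RY := projective_inadd PY pP.
have [f [g [hf hg gf]]] := inadd_retract iY RY.
pose e : A := f (g (1 : A)).
have fge (a : A) : f (g a) = e * a :> A.
  by rewrite [g a]regular_homE // hf.
have ee : e * e = e by rewrite -fge /e gf.
have /(NM _ ee) Ne : kills M e.
  move=> m; have [h hh hE] := regular_hom m.
  have /lfunP/(_ (g (1 : A))) := YM _ (hom_comp hh hf).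
  by rewrite comp_lfunE hE zero_lfunE.
move=> u hu; apply/lfunP=> y; rewrite zero_lfunE.
have hv := hom_comp hu hg.
have -> : u y = (u \o g)%VF (f y) by rewrite comp_lfunE gf.
have -> : f y = e * f y :> A by rewrite -fge gf.
by rewrite (regular_homE _ hv) ractM Ne ract0l.
Qed.

Lemma partner_inadd M P Q : rig M -> projective P -> no_hom P M ->
  (nsummands M + nsummands P = nsummands RA)%N ->
  projective Q -> no_hom Q M -> inadd P Q.
Proof.
move=> rM pP PM cM pQ QM.
have VM : no_hom (dsum P Q) M by apply: hdim_no_hom; rewrite hdim_dsum !no_hom_hdim.
have pV : projective (dsum P Q).
  by apply/projectiveP/inadd_dsum; apply/projectiveP.
apply: inadd_trans (_ : inadd P (dsum P Q)) (inadd_dsumr _ _).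
apply: nsummands_eq; first exact: inadd_dsuml.
by rewrite -(leq_add2l (nsummands M)) cM; apply: rig_bound.
Qed.

Lemma partner_supp M N P : rig M -> projective P -> no_hom P M ->
  (nsummands M + nsummands P = nsummands RA)%N -> no_hom P N -> supp_le N M.
Proof.
move=> rM pP PM cM PN e ee Me; have [Q [pQ QE]] := idempotent_projective ee.
have QM := (QE M).2 Me; apply/QE.
by apply: no_hom_inadd PN; apply: partner_inadd cM pQ QM.
Qed.

(** A projective partner of M has no maps to V either, so |V| <= |M|. *)
Lemma maximal_rig_bound M V : maximal_rig M -> rig V -> supp_le V M -> inadd V M -> inadd M V.
Proof.
move=> mM rV VM; have [P [pP PM cM]] := maximal_rig_partner mM.
move=> VM'; apply: nsummands_eq => //.
rewrite -(leq_add2r (nsummands P)) cM; apply: rig_bound => //.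
exact: no_hom_supp PM VM.
Qed.

Lemma ext0_dsum_l X Y N : ext0 X N -> ext0 Y N -> ext0 (dsum X Y) N.
Proof.
have [i1 [i2 [p1 [p2 [[h1 h2 k1 k2] [[a b] [c d] e]]]]]] := dsum_maps X Y.
apply: (@ext0_ses_l _ _ X (dsum X Y) Y i1 p2); split=> //.
- by apply/injP=> m i0; rewrite -(a m) i0 linear0.
- by apply/surjP=> x; exists (i2 x); rewrite d.
- move=> v; split=> [v0|[m ->]]; last exact: b.
  by exists (p1 v); rewrite {1}[v]e v0 linear0 addr0.
Qed.

Lemma ext0_dsum_r X M N : ext0 X M -> ext0 X N -> ext0 X (dsum M N).
Proof.
have [i1 [i2 [p1 [p2 [[h1 h2 k1 k2] [[a b] [c d] e]]]]]] := dsum_maps M N.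
apply: (@ext0_ses_r _ _ M (dsum M N) N X i1 p2); split=> //.
- by apply/injP=> m i0; rewrite -(a m) i0 linear0.
- by apply/surjP=> x; exists (i2 x); rewrite d.
- move=> v; split=> [v0|[m ->]]; last exact: b.
  by exists (p1 v); rewrite {1}[v]e v0 linear0 addr0.
Qed.

(** Every map B -> N extends to E because Ext^1(Q, N) = 0. *)
Lemma gen_extension B E Q N (i : 'Hom(B, E)) (p : 'Hom(E, Q)) :
  ses i p -> ext0 Q N -> gen B N -> gen E N.
Proof.
move=> [hi hp /injP i0 p1 ker] eQ BN U HU; apply: BN => f hf.
have ip : limg i = lker p.
  apply/vspaceP=> v; rewrite memv_ker; apply/memv_imgP/eqP => [[n _ ->]|/ker[n ->]].
    by apply/ker; exists n.
  by exists n; rewrite ?memvf.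
have [|v hv <-] := hom_extend hi hp p1 ip hf _ eQ.
  by move=> x /i0 ->; rewrite linear0.
by rewrite limg_comp; apply: subv_trans (HU _ hv); apply: limgS; apply: subvf.
Qed.

Lemma hom_descend Y W N (p : 'Hom(Y, W)) (f : 'Hom(Y, N)) :
  is_hom p -> limg p = fullv -> is_hom f -> (lker p <= lker f)%VS ->
  exists2 g : 'Hom(W, N), is_hom g & forall y, g (p y) = f y.
Proof.
move=> hp p1 hf pf; have [s ps] := surj_section p1.
have fs y : f (s (p y)) = f y.
  apply/eqP; rewrite -subr_eq0 -linearB -memv_ker; apply: (subvP pf).
  by rewrite memv_ker linearB /= ps subrr.
exists (f \o s)%VF; last by move=> y; rewrite comp_lfunE fs.
by move=> w a; rewrite !comp_lfunE -hf -(fs (ract _ a)) hp ps.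
Qed.

(* The projective generator of the modules N with Hom(P, N) = 0 is the
   quotient of A by the trace of P. *)
Lemma relative_generator P : projective P -> exists J, [/\ no_hom P J,
  forall N, no_hom P N -> gen J N & forall N, no_hom P N -> ext0 J N].
Proof.
move=> pP.
have [U0 U01 U02] := @span_exists K RA (fun v => exists2 f : 'Hom(P, RA), is_hom f & v \in limg f).
have st0 : stable U0.
  move=> v a vU; rewrite -act_lfunE memv_preim; move: v vU; apply/subvP/U02.
  move=> _ [f hf /memv_imgP[t _ ->]]; rewrite -memv_preim act_lfunE -hf.
  by apply: U01; exists f; rewrite ?memv_img ?memvf.
have [J [q [hq q1 qU]]] := quot_exists st0.
have U0hom N (f : 'Hom(RA, N)) : no_hom P N -> 
    (forall g : 'Hom(P, RA), is_hom g -> is_hom (f \o g)%VF) -> (U0 <= lker f)%VS.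
  move=> PN hf; apply: U02 => _ [g hg /memv_imgP[t _ ->]].
  by rewrite memv_ker -comp_lfunE (PN _ (hf g hg)) zero_lfunE.
exists J; split.
- move=> u hu; have [w hw <-] := pP _ _ _ _ hq q1 hu.
  apply/lfunP=> x; rewrite comp_lfunE zero_lfunE; apply/eqP; rewrite -memv_ker qU.
  by apply: U01; exists w; rewrite ?memv_img ?memvf.
- move=> N PN U HU; apply/eqP; rewrite eqEsubv subvf; apply/subvP=> x _.
  have [f hf fE] := regular_hom x.
  have [|g hg gE] := hom_descend hq q1 hf _.
    by rewrite qU; apply: U0hom => // g hg; apply: hom_comp.
  apply: (subvP (HU g hg)); apply/memv_imgP; exists (q (1 : A)); rewrite ?memvf //.
  by rewrite gE fE ract1.
- move=> N PN D cD.
  have [D1 cD1 D1E] := cocycle_map hq (@hom_id _ _ N) cD.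
  have [t tE] := projective_ext0 (@projective_regular K A) cD1.
  have [s qs] := surj_section q1.
  have tU : (lker q <= lker t)%VS.
    rewrite qU; apply: U0hom => // g hg x a.
    apply/eqP; rewrite !comp_lfunE hg -subr_eq0 -tE D1E id_lfunE.
    have -> : q (g x) = 0.
      by apply/eqP; rewrite -memv_ker qU; apply: U01; exists g; rewrite ?memv_img ?memvf.
    by rewrite linear0 zero_lfunE.
  have ts y : t (s (q y)) = t y.
    apply/eqP; rewrite -subr_eq0 -linearB -memv_ker; apply: (subvP tU).
    by rewrite memv_ker linearB /= qs subrr.
  exists (t \o s)%VF => x a; rewrite !comp_lfunE -{2}(qs x) -hq ts.
  by rewrite -tE D1E id_lfunE qs.
Qed.

Lemma no_hom_ses P N E X (i : 'Hom(N, E)) (p : 'Hom(E, X)) : ses i p ->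
  no_hom P N -> no_hom P X -> no_hom P E.
Proof.
move=> [hi hp i0 _ ker] PN PX u hu; have [j ji] := inj_retract i0.
have iju x : i (j (u x)) = u x.
  have [|n ->] := (ker (u x)).1; last by rewrite ji.
  by have /lfunP/(_ x) := PX _ (hom_comp hp hu); rewrite comp_lfunE zero_lfunE.
have hju : is_hom (j \o u)%VF.
  move=> x a; apply/eqP; rewrite -subr_eq0; apply/eqP; move/injP: (i0); apply.
  by rewrite linearB /= hi !comp_lfunE !iju hu subrr.
apply/lfunP=> x; rewrite zero_lfunE -iju.
by have /lfunP/(_ x) := PN _ hju; rewrite comp_lfunE zero_lfunE => ->; rewrite linear0.
Qed.

(** Bongartz's argument over the quotient of A that supports M. The universal extension E of copies
    of M by the projective generator J is rigid together with M, hence lies in add M; maps J -> N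
    extend to E, and they cover N. *)
Lemma tilting_gen M N : maximal_rig M -> pd1 M -> supp_le N M -> ext0 M N -> gen M N.
Proof.
move=> mM pdM NM eMN; have [P [pP PM cM]] := maximal_rig_partner mM.
have [J [PJ genJ extJ]] := relative_generator pP.
have rM : rig M by have [] := mM.
have eM : ext0 M M := rM _ (@gen_refl _ _ M).
have [E [Q [i [p [sip MQ eE]]]]] := universal_extension J eM.
have PQ : no_hom P Q := no_hom_gen pP PM (gen_inadd MQ).
have PE : no_hom P E := no_hom_ses sip PJ PQ.
have PV : no_hom P (dsum E M).
  move=> u hu; have [i1 [i2 [p1 [p2 [[h1 h2 k1 k2] [_ _ e]]]]]] := dsum_maps E M.
  apply/lfunP=> x; rewrite zero_lfunE [u x]e.
  have /lfunP/(_ x) := PE _ (hom_comp k1 hu); have /lfunP/(_ x) := PM _ (hom_comp k2 hu).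
  by rewrite !comp_lfunE !zero_lfunE => -> ->; rewrite !linear0 addr0.
have rV : rig (dsum E M).
  move=> X VX; have PX := no_hom_gen pP PV VX.
  have eMX : ext0 M X := pd1_gen pdM (ext0_dsum_r eE eM) VX.
  apply: ext0_dsum_l => //.
  exact: ext0_ses_l sip (extJ _ PX) (ext0_inadd_l MQ eMX).
have MV : inadd M (dsum E M).
  apply: maximal_rig_bound => //; last exact: inadd_dsumr.
  exact: partner_supp cM PV.
have ME : inadd M E := inadd_trans MV (inadd_dsuml _ _).
apply: gen_trans (gen_inadd ME) _.
apply: gen_extension sip (ext0_inadd_l MQ eMN) _.
by apply: genJ; apply: no_hom_supp PM NM.
Qed.

(* For basic modules these are the arrows of the support tau-tilting quiver. *)
Definition rig_cover M N : Prop :=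
  [/\ maximal_rig M, maximal_rig N, gen M N, ~ gen N M
    & ~ exists L, [/\ maximal_rig L, gen M L /\ ~ gen L M & gen L N /\ ~ gen N L]].

Lemma cover_between M N L : rig_cover M N -> maximal_rig L -> gen M L -> gen L N ->
  ~ gen N L -> gen L M.
Proof.
move=> [_ _ _ _ nb] mL ML LN nNL; apply: contrapT => nLM.
by apply: nb; exists L.
Qed.

Lemma supp_not_le M N : ~ supp_le M N -> exists e, [/\ e * e = e, kills N e & ~ kills M e].
Proof.
move=> nMN; apply: contrapT => H; apply: nMN => e ee Ne.
by apply: contrapT => nMe; apply: H; exists e.
Qed.

Lemma maximal_rig_mem M X : maximal_rig M -> gen M X ->
  (forall N, gen M N -> ext0 X N) -> inadd M X.
Proof. by move=> [_ mM]; apply: mM. Qed.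

Lemma gen_between M N X : gen M N -> inadd M X -> gen N X -> maximal_rig M ->
  maximal_rig N -> inadd N X.
Proof.
move=> MN MX NX [rM _] mN; apply: maximal_rig_mem => // Y NY.
by apply: ext0_inadd_l MX _; apply: rM; apply: gen_trans MN NY.
Qed.

Section Cover.
Variables M N : rmodule A.
Hypotheses (cMN : rig_cover M N) (pdN : pd1 N) (nMN : ~ supp_le M N).

Let mM : maximal_rig M. Proof. by case: cMN. Qed.
Let mN : maximal_rig N. Proof. by case: cMN. Qed.
Let rM : rig M. Proof. by case: mM. Qed.
Let rN : rig N. Proof. by case: mN. Qed.
Let MN : gen M N. Proof. by case: cMN. Qed.
Let nNM : ~ gen N M. Proof. by case: cMN. Qed.

(** The universal extension E of copies of N by M lies in Fac M and is rigid together with N. Its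
    completion T is between M and N and, containing M inside E, is not supported by N; so Fac T =
    Fac M. As Ext^1(N, -) vanishes on Fac T, N is Ext-projective in Fac M. *)
Lemma cover_inadd : inadd M N.
Proof.
have eN : ext0 N N := rN (@gen_refl _ _ N).
have [E [Q [i [p [sip NQ eE]]]]] := universal_extension M eN.
have ME : gen M E.
  apply: gen_ses sip (@gen_refl _ _ M) (gen_trans MN (gen_inadd NQ)) _.
  exact: rM (@gen_refl _ _ M).
have MV : gen M (dsum E N) by apply: gen_dsum.
have eNV X : gen (dsum E N) X -> ext0 N X := pd1_gen pdN (ext0_dsum_r eE eN).
have rV : rig (dsum E N).
  move=> X VX; have eNX := eNV X VX; apply: ext0_dsum_l => //.
  exact: ext0_ses_l sip (rM (gen_trans MV VX)) (ext0_inadd_l NQ eNX).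
have [T [mT VT TV]] := rig_completion rV.
have TN : gen T N by apply: gen_inadd; apply: inadd_trans TV (inadd_dsumr _ _).
have nNT : ~ gen N T.
  have [e [ee Ne nMe]] := supp_not_le nMN.
  move=> NT; apply: nMe; have Te := kills_gen NT Ne.
  have Ee : kills E e := kills_inadd (inadd_trans TV (inadd_dsuml _ _)) Te.
  by have [hi _ i0 _ _] := sip; apply: kills_sub hi i0 Ee.
have TM := cover_between cMN mT (gen_trans MV VT) TN nNT.
apply: maximal_rig_mem => // X MX; apply: eNV.
exact: gen_trans VT (gen_trans TM MX).
Qed.

Lemma cover_gen X : inadd M X -> ~ inadd N X -> ~ gen N X /\ gen (dsum N X) M.
Proof.
move=> MX nNX; have nX : ~ gen N X by move=> NX; apply: nNX; apply: gen_between MN MX NX mM mN.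
split=> //.
have MV : inadd M (dsum N X) by apply: inadd_dsum => //; apply: cover_inadd.
have rV : rig (dsum N X).
  move=> Y VY; apply: (ext0_inadd_l MV); apply: rM.
  exact: gen_trans (gen_inadd MV) VY.
have [T [mT VT TV]] := rig_completion rV.
have TN : gen T N by apply: gen_inadd; apply: inadd_trans TV (inadd_dsuml _ _).
have nNT : ~ gen N T.
  by move=> NT; apply: nX; apply: gen_trans NT (gen_inadd (inadd_trans TV (inadd_dsumr _ _))).
apply: (gen_trans VT); apply: (cover_between cMN mT _ TN nNT).
exact: gen_trans (gen_inadd MV) VT.
Qed.

(** Given two candidates X and Y, M lies in Fac(N + Y), so X is a quotient of some Z in add(N + Y).
    The surjection splits by [nakayama_component]; thus X is a summand of N + Y, and not of N, so it
    is isomorphic to Y. *)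
Lemma cover_complement : exists X, [/\ indecomposable X, inadd M X, ~ gen N X
  & forall Y, indecomposable Y -> inadd M Y -> inadd N Y \/ iso Y X].
Proof.
have [X [iX MX nNX]] : exists X, [/\ indecomposable X, inadd M X & ~ inadd N X].
  apply: contrapT => H; apply: nNM; apply: gen_inadd; apply: inadd_of_indec => Y iY MY.
  by apply: contrapT => nNY; apply: H; exists Y.
have [nX VM] := cover_gen MX nNX.
exists X; split=> // Y iY MY; apply: contrapT => /not_orP[nNY nYX].
have [_ WM] := cover_gen MY nNY.
have [Z [p [WZ hp p1]]] := gen_cover (gen_trans WM (gen_inadd MX)).
have VW : gen (dsum N X) (dsum N Y).
  by apply: gen_dsum; [apply/gen_inadd/inadd_dsuml|apply: gen_trans VM (gen_inadd MY)].
have VZ := gen_trans VW (gen_inadd WZ).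
have [h hh ph0] := nakayama_component iX nX VZ hp p1.
have [|u [[hu _ _] uK _]] := @bihom_inv _ _ _ _ (p \o h)%VF.
  by split=> //; [apply: hom_comp|apply: endo_inj_surj].
have ZX : inadd Z X.
  apply: (@retract_inadd _ _ _ _ h (u \o p)%VF) => //; first exact: hom_comp.
  by move=> x; rewrite -[RHS]uK !comp_lfunE.
have [//|YX] := inadd_dsum_split iX (inadd_trans WZ ZX).
by apply: nYX; apply: iso_sym; apply: inadd_indec.
Qed.

(** Take the least number k of generators of Ext^1(X, Z) over End(X). The extension E they define
    lies in Fac M = Fac(N + X), so its surjection onto the first copy of X splits by
    [nakayama_component]. The resulting relation expresses one generator through the others, unless
    k = 0. *)
Lemma cover_ext0 Z : pd1 M -> supp_le Z M -> ext0 N Z -> ext0 M Z.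
Proof.
move=> pdM ZM eNZ; have [X [iX MX nNX MNX]] := cover_complement.
have VM : inadd (dsum N X) M.
  apply: inadd_of_indec => Y iY MY; have [NY|/iso_sym/iso_inadd[XY _]] := MNX _ iY MY.
    exact: inadd_trans (inadd_dsuml _ _) NY.
  exact: inadd_trans (inadd_dsumr _ _) XY.
apply: (ext0_inadd_l VM); apply: ext0_dsum_l => //.
have eXX : ext0 X X by apply: ext0_inadd_l MX (rM (gen_inadd MX)).
have eNX : ext0 N X by apply: ext0_inadd_l cover_inadd (rM (gen_inadd MX)).
pose Pr (x : {k & 'I_k -> 'Hom(X, 'Hom(A, Z))}) := ext_generators (projT2 x).
have [k0 [d0 gd0]] := ext_generators_exist Z X.
have [|[k d] /= gd kmin] := @exists_minimal _ Pr (fun x => projT1 x) (existT _ k0 d0) _ => //.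
have [E [Q [i [p [pr [sip XQ eXE prE hE]]]]]] := generated_extension eXX gd.
have [hi hp i0 p1 ker] := sip.
have eNE : ext0 N E := ext0_ses_r sip eNZ (ext0_inadd_r XQ eNX).
have EM : supp_le E M.
  apply: supp_ses sip ZM _; apply: supp_le_trans (gen_supp (gen_inadd XQ)) _.
  exact: gen_supp (gen_inadd MX).
have ME : gen M E.
  by apply: tilting_gen => //; apply: (ext0_inadd_l VM); apply: ext0_dsum_l.
have VE := gen_trans (gen_inadd VM) ME.
case: k d gd kmin pr prE hE => [|k] d gd kmin pr prE hE.
  move=> C cC; have [_ gen_d] := gd; have [phi _] := gen_d C cC.
  by rewrite big_ord0 subr0.
have [hpr0 pr01] := prE ord0.
have hq := hom_comp hpr0 hp.
have q1 : limg (pr ord0 \o p)%VF = fullv by rewrite limg_comp p1.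
have [h hh qh0] := nakayama_component iX nNX VE hq q1.
have [|u [[hu _ _] _ uK]] := @bihom_inv _ _ _ _ ((pr ord0 \o p) \o h)%VF.
  by split=> //; [apply: hom_comp|apply: endo_inj_surj].
have := hE h hh; rewrite big_ord_recl => cob.
have [cd gen_d] := gd.
suff /kmin : Pr (existT (fun k => 'I_k -> 'Hom(X, 'Hom(A, Z))) k (fun j => d (lift ord0 j))).
  by rewrite /= ltnn.
split=> [j|C cC] /=; first exact: cd.
have [chi hchi cobC] := gen_d C cC.
pose psi j := (pr (lift ord0 j) \o (p \o h))%VF.
have hpsi j : is_hom (psi j).
  by apply: hom_comp; [have [] := prE (lift ord0 j)|apply: hom_comp].
(* The relation is solved for [d ord0], with u inverse to its coefficient there, and substituted
   into the expression of C. *)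
exists (fun j => chi (lift ord0 j) - (psi j \o (u \o chi ord0)))%VF.
  by move=> j; apply: homB => //; apply: hom_comp => //; apply: hom_comp.
have := coboundaryD cobC (coboundary_comp (hom_comp hu (hchi ord0)) cob).
congr (coboundary _); rewrite big_ord_recl.
apply/lfunP=> x; apply/lfunP=> a.
pose y := u (chi ord0 x).
have yE : pr ord0 (p (h y)) = chi ord0 x by rewrite -[RHS]uK !comp_lfunE.
transitivity (C x a - (d ord0 (chi ord0 x) a + \sum_(j < k) d (lift ord0 j) (chi (lift ord0 j) x) a)
  + (d ord0 (pr ord0 (p (h y))) a + \sum_(j < k) d (lift ord0 j) (psi j y) a)).
  rewrite !(add_lfunE, opp_lfunE, comp_lfunE) !sum_lfunE; congr (_ - (_ + _) + (_ + _)).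
    by apply: eq_bigr => j _; rewrite comp_lfunE.
  by apply: eq_bigr => j _; rewrite !comp_lfunE.
have zmodE (V : zmodType) (c e u1 u2 : V) : c - (e + u1) + (e + u2) = c - (u1 - u2).
  by rewrite opprD [c + _]addrA addrACA subrK opprB [- u1 + u2]addrC.
rewrite yE zmodE !(add_lfunE, opp_lfunE) !sum_lfunE -sumrB; congr (_ - _).
apply: eq_bigr => j _; rewrite /y !(comp_lfunE, add_lfunE, opp_lfunE) linearB /=.
by rewrite add_lfunE opp_lfunE.
Qed.

End Cover.

(** The inclusion of supports puts the partner P of M into add P' for the partner P' of N; counting
    gives |P'| <= |P|, so the two have the same summands. *)
Lemma nsummands_supp M N : maximal_rig M -> maximal_rig N -> supp_le N M ->
  (nsummands M <= nsummands N)%N -> supp_le M N.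
Proof.
move=> [rM mM] [rN mN] NM le.
have [P [pP PM cM]] := maximal_rig_partner (conj rM mM).
have [P' [pP' PN' cN]] := maximal_rig_partner (conj rN mN).
have P'P : inadd P' P := partner_inadd rN pP' PN' cN pP (no_hom_supp pP PM NM).
have PP' : inadd P P'.
  apply: nsummands_eq P'P _; rewrite -(leq_add2l (nsummands N)) cN -cM.
  by rewrite leq_add2r.
exact: partner_supp cN (no_hom_inadd PP' PM).
Qed.

Lemma supp_nsummands M N : maximal_rig M -> maximal_rig N -> supp_le N M -> supp_le M N ->
  nsummands M = nsummands N.
Proof.
move=> [rM mM] [rN mN] NM MN.
have [P [pP PM cM]] := maximal_rig_partner (conj rM mM).
have [P' [pP' PN' cN]] := maximal_rig_partner (conj rN mN).
have P'P : inadd P' P := partner_inadd rN pP' PN' cN pP (no_hom_supp pP PM NM).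
have PP' : inadd P P' := partner_inadd rM pP PM cM pP' (no_hom_supp pP' PN' MN).
have ePP' : nsummands P = nsummands P' by apply/eqP; rewrite eqn_leq !nsummands_le.
by apply/eqP; rewrite -(eqn_add2r (nsummands P)) cM ePP' cN.
Qed.

Lemma maximal_rig_add M N : inadd M N -> inadd N M -> maximal_rig M -> maximal_rig N.
Proof.
move=> MN NM [rM mM]; split=> [X NX|X NX eX].
  by apply: (ext0_inadd_l MN); apply: rM; apply: gen_trans (gen_inadd MN) NX.
apply: (inadd_trans NM); apply: mM; first exact: gen_trans (gen_inadd MN) NX.
by move=> Y MY; apply: eX; apply: gen_trans (gen_inadd NM) MY.
Qed.

End SupportTilting.

(** * Support tau-tilting modules and their covers under duality *)

Section DualSupport.
Variables (K : fieldType) (A B : falgType K) (s : A -> B) (t : B -> A).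
Variables (hs : anti_morphism s) (ht : anti_morphism t).
Hypotheses (ts : forall a, t (s a) = a) (st : forall b, s (t b) = b).
Implicit Types L M N X Y : rmodule A.
Local Notation D := (adual ht).
Local Notation D' := (adual hs).

Lemma supp_dual M N : supp_le N M -> supp_le (D N) (D M).
Proof.
have [_ _ tM] := ht.
move=> NM e ee Me; rewrite -(st e); apply/(kills_dual hs ht ts st N (t e)).
apply: NM; first by rewrite -tM ee.
by apply/(kills_dual hs ht ts st M (t e)); rewrite st.
Qed.

Lemma dual_rig M : rig M -> pd1 (D M) -> rig (D M).
Proof.
move=> rM pDM X; apply: pd1_gen => //.
by apply/(ext0_dual hs ht ts st); apply: rM; apply: gen_refl.
Qed.

End DualSupport.

(* The only property of GLS algebras that the comparison of the two quivers needs. *)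
Definition rigid_tame (K : fieldType) (A B : falgType K) (t : B -> A)
    (ht : anti_morphism t) : Prop :=
  forall M : rmodule A, rig M -> pd1 M /\ pd1 (adual ht M).

Section DualMaximal.
Variables (K : fieldType) (A B : falgType K) (s : A -> B) (t : B -> A).
Variables (hs : anti_morphism s) (ht : anti_morphism t).
Hypotheses (ts : forall a, t (s a) = a) (st : forall b, s (t b) = b).
Hypotheses (tameA : rigid_tame ht) (tameB : rigid_tame hs).
Implicit Types L M N X Y : rmodule A.
Local Notation D := (adual ht).
Local Notation D' := (adual hs).

(** If D M is enlarged to a rigid V, then D' V is rigid, has M as a summand and no larger support
    than M. The bound for M shows that nothing was gained. *)
Lemma dual_maximal M : maximal_rig M -> maximal_rig (D M).
Proof.
move=> mM; have [rM _] := mM; have [pM pDM] := tameA rM.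
have rDM := dual_rig hs ts st rM pDM.
split=> // Y gY eY.
have rV : rig (dsum (D M) Y) by apply: rig_dsum.
have [pV pDV] := tameB rV.
have rDV := dual_rig ht st ts rV pDV.
have [DDM1 DDM2] := iso_inadd (bidual hs ht ts M).
have [DDV1 DDV2] := iso_inadd (bidual ht hs st (dsum (D M) Y)).
have MV : inadd M (D' (dsum (D M) Y)).
  apply: maximal_rig_bound => //.
    apply: supp_le_trans (gen_supp (gen_inadd DDM1)).
    apply: (supp_dual ht st ts); apply: gen_supp; apply: gen_dsum => //; exact: gen_refl.
  apply: inadd_trans DDM2; apply/(inadd_dual ht hs st).
  exact: inadd_dsuml.
apply: inadd_trans (_ : inadd (D M) (dsum (D M) Y)) (inadd_dsumr _ _).
apply: inadd_trans DDV2; exact/(inadd_dual hs ht ts).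
Qed.

Lemma gen_dual_same M N : maximal_rig M -> maximal_rig N -> supp_le N M -> supp_le M N ->
  gen M N <-> gen (D N) (D M).
Proof.
move=> mM mN NM MN; have [rM _] := mM; have [rN _] := mN.
have [pM _] := tameA rM; have [_ pDN] := tameA rN; split=> [gMN|gDN].
  apply: tilting_gen pDN _ _; first exact: dual_maximal.
    exact: (supp_dual hs ts st).
  by apply/(ext0_dual hs ht ts st); apply: rM.
apply: tilting_gen pM _ _ => //; apply/(ext0_dual hs ht ts st).
by have [rDN _] := dual_maximal mN; apply: rDN.
Qed.

End DualMaximal.

Section DualCover.
Variables (K : fieldType) (A B : falgType K) (s : A -> B) (t : B -> A).
Variables (hs : anti_morphism s) (ht : anti_morphism t).
Hypotheses (ts : forall a, t (s a) = a) (st : forall b, s (t b) = b).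
Hypotheses (tameA : rigid_tame ht) (tameB : rigid_tame hs).
Implicit Types M N X Y : rmodule A.
Implicit Types L : rmodule B.
Local Notation D := (adual ht).
Local Notation D' := (adual hs).
Local Notation maxD := (dual_maximal ts st tameA tameB).
Local Notation maxD' := (dual_maximal st ts tameB tameA).

Lemma dual_of_dual L : exists N, [/\ inadd L (D N), inadd (D N) L & maximal_rig L -> maximal_rig N].
Proof.
exists (D' L); have [DDL1 DDL2] := iso_inadd (bidual ht hs st L).
by split=> // mL; apply: maxD'.
Qed.

Lemma gen_congr M M' N N' : inadd M' M -> inadd N N' -> gen M N -> gen M' N'.
Proof.
by move=> MM NN MN; apply: gen_trans (gen_inadd MM) (gen_trans MN (gen_inadd NN)).
Qed.

Lemma supp_dual_iff M N : supp_le N M <-> supp_le (D N) (D M).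
Proof.
split=> [|NM0]; first exact: (supp_dual hs ts st).
have NM : supp_le (D' (D N)) (D' (D M)) by apply: (supp_dual ht st ts).
have [N1 N2] := iso_inadd (bidual hs ht ts N); have [M1 M2] := iso_inadd (bidual hs ht ts M).
exact: supp_le_trans (gen_supp (gen_inadd N2)) (supp_le_trans NM (gen_supp (gen_inadd M1))).
Qed.

Lemma cover_dual_same M N : rig_cover M N -> supp_le M N -> rig_cover (D N) (D M).
Proof.
move=> cMN MN; have [mM mN gMN nNM nb] := cMN; have NM := gen_supp gMN.
have rev X Y := @gen_dual_same _ _ _ _ _ hs ht ts st tameA tameB X Y.
have [rev1 _] := rev M N mM mN NM MN; have [_ rev2] := rev N M mN mM MN NM.
split; [exact: maxD|exact: maxD|exact: rev1 gMN|by move=> g; exact: nNM (rev2 g)|].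
move=> [L [mL [NL nLN] [LM nML]]]; apply: nb.
have [L' [L1 L2 /(_ mL) mL']] := dual_of_dual L.
have gNL' : gen (D N) (D L') := gen_trans NL (gen_inadd L1).
have gL'M : gen (D L') (D M) := gen_trans (gen_inadd L2) LM.
have sLN : supp_le L' N by apply/supp_dual_iff/gen_supp.
have sML : supp_le M L' by apply/supp_dual_iff/gen_supp.
have sNL : supp_le N L' := supp_le_trans NM sML.
have sLM : supp_le L' M := supp_le_trans sLN NM.
have [rML1 rML2] := rev M L' mM mL' sLM sML.
have [rLM1 rLM2] := rev L' M mL' mM sML sLM.
have [rLN1 rLN2] := rev L' N mL' mN sNL sLN.
have [rNL1 rNL2] := rev N L' mN mL' sLN sNL.
exists L'; split=> //; split.
- exact: rML2 gL'M.
- by move=> g; apply: nML; exact: gen_trans (rLM1 g) (gen_inadd L2).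
- exact: rLN2 gNL'.
- by move=> g; apply: nLN; exact: gen_trans (gen_inadd L1) (rNL1 g).
Qed.

(** D N is a summand of D M. A module L strictly between them has D N as a summand, so N is a
    summand of its dual L', and |M| <= |N| + 1 restricts the support of L'. *)
Lemma cover_dual_diff M N : rig_cover M N -> ~ supp_le M N -> rig_cover (D M) (D N).
Proof.
move=> cMN nMN; have [mM mN gMN nNM nb] := cMN; have NM := gen_supp gMN.
have [rM _] := mM; have [rN _] := mN; have [pM pDM] := tameA rM; have [pN _] := tameA rN.
have MN : inadd M N := cover_inadd cMN pN nMN.
have DMN : inadd (D M) (D N) by apply/(inadd_dual hs ht ts).
split; [exact: maxD|exact: maxD|exact: gen_inadd| |].
  by move=> /gen_supp/supp_dual_iff.
move=> [L [mL [ML nLM] [LN nNL]]]; have [rL _] := mL; have [pL _] := tameB rL.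
have [L' [L1 L2 /(_ mL) mL']] := dual_of_dual L; have [rL' _] := mL'.
have LDN : inadd L (D N) := gen_between ML DMN LN (maxD mM) mL.
have L'N : inadd L' N by apply/(inadd_dual hs ht ts); apply: inadd_trans L2 LDN.
have sLM : supp_le L' M.
  by apply/supp_dual_iff; apply: gen_supp; apply: gen_trans ML (gen_inadd L1).
have sML : supp_le M L'.
  (* If the support of L' is smaller than that of M, then L' has no more summands than N; as N is
     among them, L' lies in add N, and L would lie in Fac(D N). *)
  have [//|nML] := pselect (supp_le M L'); exfalso.
  have [X [_ _ _ MX]] := cover_complement cMN pN nMN.
  have leM := nsummands_succ MX.
  have leL : (nsummands L' <= nsummands N)%N.
    rewrite -ltnS; apply: leq_trans leM; rewrite ltnNge; apply/negP => le.
    exact: nML (nsummands_supp mM mL' sLM le).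
  apply: nNL; apply: gen_trans (_ : gen (D N) (D L')) (gen_inadd L2).
  by apply: gen_inadd; apply/(inadd_dual hs ht ts); apply: nsummands_eq.
(* If L' has the support of M, then Ext^1(N, L') = 0 extends to Ext^1(M, L') = 0, and dually D M
   lies in Fac L. *)
have eNL : ext0 N L' := ext0_inadd_l L'N (rL' _ (@gen_refl _ _ L')).
have /(ext0_dual hs ht ts st) eLM := cover_ext0 cMN pN nMN pM sLM eNL.
apply: nLM; apply: tilting_gen mL pL _ _; last exact: ext0_inadd_l L2 eLM.
exact: supp_le_trans ((supp_dual_iff _ _).1 sML) (gen_supp (gen_inadd L1)).
Qed.

End DualCover.

Section CoverInvariance.
Variables (K : fieldType) (A : falgType K).
Implicit Types M N : rmodule A.

Lemma rig_cover_iso M M' N N' : iso M M' -> iso N N' -> rig_cover M N -> rig_cover M' N'.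
Proof.
move=> /iso_inadd[MM M'M] /iso_inadd[NN N'N] [mM mN MN nNM nb].
split; [exact: maximal_rig_add mM|exact: maximal_rig_add mN| | |].
- exact: gen_congr MN.
- by move=> NM; apply: nNM; exact: gen_congr NM.
move=> [L [mL [ML nLM] [LN nNL]]]; apply: nb; exists L; split=> //; split.
- exact: gen_trans (gen_inadd MM) ML.
- by move=> LM; apply: nLM; exact: gen_trans LM (gen_inadd MM).
- exact: gen_trans LN (gen_inadd N'N).
- by move=> NL; apply: nNL; exact: gen_trans (gen_inadd N'N) NL.
Qed.

Lemma basic_iso M N : iso M N -> basic M -> basic N.
Proof.
move=> MN [k [X [iX injX MX]]]; exists k, X; split=> //.
exact: iso_trans (iso_sym MN) MX.
Qed.

Lemma basic_sttP M : basic_stt M <-> basic M /\ maximal_rig M.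
Proof. by split=> -[bM /support_tau_tiltingP]. Qed.

Lemma Fac_gtP M N : Fac_gt M N <-> gen M N /\ ~ gen N M.
Proof.
have E X Y : (forall Z, Fac X Z -> Fac Y Z) <-> gen Y X.
  split=> [H|YX Z /FacP XZ]; first by apply/FacP/H/FacP/gen_refl.
  exact/FacP/(gen_trans YX).
by rewrite /Fac_gt !E.
Qed.

Lemma stt_arrowP M N : stt_arrow M N <-> [/\ basic M, basic N & rig_cover M N].
Proof.
split=> [[/basic_sttP[bM mM] /basic_sttP[bN mN] /Fac_gtP[MN nNM] nb]|[bM bN [mM mN MN nNM nb]]].
  split=> //; split=> // -[L [/support_tau_tiltingP mL ML LN]]; apply: nb.
  by exists L; split=> //; apply/Fac_gtP.
split; [exact/basic_sttP|exact/basic_sttP|exact/Fac_gtP|].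
by move=> [L [/support_tau_tiltingP mL /Fac_gtP ML /Fac_gtP LN]]; apply: nb; exists L.
Qed.

End CoverInvariance.

Lemma cover_dual_either (K : fieldType) (A B : falgType K) (s : A -> B) (t : B -> A)
    (hs : anti_morphism s) (ht : anti_morphism t) (M N : rmodule A) :
  (forall a, t (s a) = a) -> (forall b, s (t b) = b) ->
  rigid_tame ht -> rigid_tame hs -> rig_cover M N ->
  rig_cover (adual ht M) (adual ht N) \/ rig_cover (adual ht N) (adual ht M).
Proof.
move=> ts st tA tB cMN; have [MN|nMN] := pselect (supp_le M N); [right|left].
  exact: cover_dual_same tA tB _ _ cMN MN.
exact: cover_dual_diff tA tB _ _ cMN nMN.
Qed.

Section Opposite.
Variables (K : fieldType) (H : falgType K).

Definition to_op (a : H) : H^c := a.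
Definition of_op (a : H^c) : H := a.

Lemma to_op_anti : @anti_morphism K H^c H to_op.
Proof. by split=> // k a b. Qed.

Lemma of_op_anti : @anti_morphism K H H^c of_op.
Proof. by split=> // k a b. Qed.

Local Notation D := (adual of_op_anti).
Local Notation D' := (adual to_op_anti).

(** Both sides have the same carrier and the same action, so the identity is an isomorphism. *)
Lemma dual_adual (M : rmodule H) : iso (dual M) (D M).
Proof.
exists (\1%VF : 'Hom('Hom(M, K^o), 'Hom(M, K^o))); split.
- by move=> f a; rewrite !id_lfunE.
- by apply/injP=> f; rewrite id_lfunE.
- exact: lim1g.
Qed.

Hypotheses (tame : rigid_tame of_op_anti) (tame_op : rigid_tame to_op_anti).

Lemma tame_duality :
  [/\ forall M : rmodule H, basic_stt M -> basic_stt (dual M),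
      forall M M' : rmodule H, basic_stt M -> basic_stt M' ->
        (iso M M' <-> iso (dual M) (dual M'))
    & forall N : rmodule H^c, basic_stt N ->
        exists2 M : rmodule H, basic_stt M & iso (dual M) N] /\
  (forall M M' : rmodule H, basic_stt M -> basic_stt M' ->
     (stt_arrow M M' \/ stt_arrow M' M <->
      stt_arrow (dual M) (dual M') \/ stt_arrow (dual M') (dual M))) /\
  (forall M M' : rmodule H, stt_arrow M M' ->
     (nsummands M <> nsummands M' <-> stt_arrow (dual M) (dual M')) /\
     (nsummands M = nsummands M' <-> stt_arrow (dual M') (dual M))).
Proof.
pose ts (a : H) : of_op (to_op a) = a := erefl; pose st (b : H^c) : to_op (of_op b) = b := erefl.
have bD (M : rmodule H) : basic M -> basic (dual M).
  move=> bM; apply: basic_iso (iso_sym (dual_adual M)) _.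
  exact: (basic_dual to_op_anti of_op_anti ts).
have arrowD (M N : rmodule H) : basic M -> basic N ->
    stt_arrow (dual M) (dual N) <-> rig_cover (D M) (D N).
  move=> bM bN; rewrite stt_arrowP; split=> [[_ _]|c].
    exact: rig_cover_iso (dual_adual M) (dual_adual N).
  split; [exact: bD|exact: bD|].
  exact: rig_cover_iso (iso_sym (dual_adual M)) (iso_sym (dual_adual N)) c.
split; [split|split].
- move=> M /basic_sttP[bM mM]; apply/basic_sttP; split; first exact: bD.
  have [D1 D2] := iso_inadd (dual_adual M); apply: maximal_rig_add D2 D1 _.
  exact: (dual_maximal ts st tame tame_op).
- move=> M M' _ _; rewrite (dual_iso_iff to_op_anti of_op_anti ts M M'); split=> e.
    exact: iso_trans (dual_adual M) (iso_trans e (iso_sym (dual_adual M'))).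
  exact: iso_trans (iso_sym (dual_adual M)) (iso_trans e (dual_adual M')).
- move=> N /basic_sttP[bN mN]; exists (D' N).
    apply/basic_sttP; split; first exact: (basic_dual of_op_anti to_op_anti st).
    exact: (dual_maximal st ts tame_op tame).
  apply: iso_trans (dual_adual _) (iso_sym _).
  exact: (bidual of_op_anti to_op_anti st).
- move=> M M' /basic_sttP[bM mM] /basic_sttP[bM' mM'].
  rewrite !arrowD // !stt_arrowP.
  have DD (N : rmodule H) := bidual to_op_anti of_op_anti ts N.
  split=> [[[_ _ c]|[_ _ c]]|[c|c]].
  + exact: cover_dual_either ts st tame tame_op c.
  + by have [] := cover_dual_either ts st tame tame_op c; [right|left].
  + have [c'|c'] := cover_dual_either st ts tame_op tame c; [left|right]; split=> //.
      exact: rig_cover_iso (iso_sym (DD _)) (iso_sym (DD _)) c'.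
    exact: rig_cover_iso (iso_sym (DD _)) (iso_sym (DD _)) c'.
  + have [c'|c'] := cover_dual_either st ts tame_op tame c; [right|left]; split=> //.
      exact: rig_cover_iso (iso_sym (DD _)) (iso_sym (DD _)) c'.
    exact: rig_cover_iso (iso_sym (DD _)) (iso_sym (DD _)) c'.
move=> M M' /stt_arrowP[bM bM' c]; rewrite !arrowD //.
have [mM mM' MM' nM'M _] := c; have sM'M := gen_supp MM'.
(* The two orientations exclude each other, so the implications [same] and [diff] already give both
   equivalences. *)
have asym (N N' : rmodule H^c) : rig_cover N N' -> ~ rig_cover N' N.
  by move=> [_ _ _ nN _] [_ _ g _ _]; apply: nN.
have same : nsummands M = nsummands M' -> rig_cover (D M') (D M).
  move=> e; apply: (cover_dual_same ts st tame tame_op c).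
  by apply: nsummands_supp => //; rewrite e.
have diff : nsummands M <> nsummands M' -> rig_cover (D M) (D M').
  move=> e; apply: (cover_dual_diff ts st tame tame_op c) => sMM'.
  by apply: e; apply: supp_nsummands.
split; split=> //.
- by move=> c1 e; apply: asym c1 (same e).
- by move=> c1; apply: contrapT => e; apply: asym c1 (diff e).
Qed.

End Opposite.

(** * Triangular algebras *)

Section Triangular.
Variables (K : fieldType) (A B : falgType K) (t : B -> A) (ht : anti_morphism t).
Variables (n : nat) (e : 'I_n -> A) (rk : 'I_n -> nat).
Implicit Types M N X Y L Q S : rmodule A.
Local Notation D := (adual ht).

Definition concentrated M (i : 'I_n) : Prop := forall v : M, ract v (e i) = v.

Hypothesis e_idem : forall i, e i * e i = e i.
Hypothesis e_sum : \sum_i e i = 1.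
Hypothesis rk_inj : injective rk.
Hypothesis e_tri : forall i j a, i != j -> ~~ (rk i < rk j)%N -> e i * a * e j = 0.
(** In the application E is the local algebra at the vertex i, and [corner_hom] holds because that
    algebra has a single simple module. *)
Hypothesis corner_tame : forall i, exists E, [/\ concentrated E i, pd1 E, pd1 (D E)
  & forall N, concentrated N i -> gen E N].
Hypothesis corner_hom : forall i X Y, concentrated X i -> concentrated Y i ->
  ~ is_zero X -> ~ is_zero Y -> exists2 f : 'Hom(X, Y), is_hom f & f <> 0.

Lemma pd1_zero (C : falgType K) (X : rmodule C) : is_zero X -> pd1 X.
Proof.
move=> X0 E N g C' _ _ _; exists 0; first exact: cocycle0.
by move=> x a; rewrite !zero_lfunE linear0 (X0 x) linear0 zero_lfunE.
Qed.

Lemma e_killed M : (forall i, kills M (e i)) -> is_zero M.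
Proof.
by move=> Me m; rewrite -(ract1 m) -e_sum ract_sumr big1 // => i _; apply: Me.
Qed.

Lemma concentrated_inadd M X i : inadd M X -> concentrated M i -> concentrated X i.
Proof.
move=> [I [f [g [hf hg fg]]]] cM x; rewrite [in LHS](fg x) ract_suml [RHS]fg.
by apply: eq_bigr => j _; rewrite -hg cM.
Qed.

Lemma concentrated_sub N M (i : 'Hom(N, M)) j : is_hom i -> lker i = 0%VS ->
  concentrated M j -> concentrated N j.
Proof.
move=> hi /injP i0 cM v; apply/eqP; rewrite -subr_eq0; apply/eqP/i0.
by rewrite linearB /= hi cM subrr.
Qed.

Lemma concentrated_surj N M (p : 'Hom(N, M)) j : is_hom p -> limg p = fullv ->
  concentrated N j -> concentrated M j.
Proof. by move=> hp /surjP p1 cN v; have [u ->] := p1 v; rewrite -hp cN. Qed.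

Section Step.
Variables (M : rmodule A) (i : 'I_n).
Hypotheses (rM : rig M) (Mk : forall j, (rk i < rk j)%N -> kills M (e j)).

Lemma sink_ses : exists L Q (l : 'Hom(L, M)) (q : 'Hom(M, Q)),
  [/\ ses l q, concentrated L i, limg l = limg (act_lfun M (e i))
    & forall j, (rk i <= rk j)%N -> kills Q (e j)].
Proof.
have Uact v : v \in limg (act_lfun M (e i)) -> ract v (e i) = v.
  by move=> /memv_imgP[m _ ->]; rewrite act_lfunE -ractM e_idem.
have stU : stable (limg (act_lfun M (e i))).
  move=> v a vU; rewrite -(Uact v vU) -ractM.
  have E : ract v (e i * a * 1) = ract v (e i * a * e i).
    rewrite -e_sum mulr_sumr ract_sumr (bigD1 i) //= big1 ?addr0 // => j ji.
    have [lt|nlt] := boolP (rk i < rk j)%N; first by rewrite ractM Mk.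
    by rewrite e_tri ?ract0r // eq_sym.
  rewrite -[e i * a]mulr1 E ractM -act_lfunE.
  by rewrite memv_img ?memvf.
have [L [Q [l [q [slq lU]]]]] := ses_sub stU; have [hl hq l0 q1 ker] := slq.
have [r ri] := inj_retract l0.
exists L, Q, l, q; split=> // [v|j].
  move/injP: l0 => l0; apply/eqP; rewrite -subr_eq0; apply/eqP/l0.
  by rewrite linearB /= hl Uact ?subrr // -lU memv_img ?memvf.
rewrite leq_eqVlt => /orP[/eqP/rk_inj <-|lt]; last by apply: kills_surj hq q1 _; apply: Mk.
move=> v; have [m ->] := (surjP q).1 q1 v; rewrite -hq; apply/ker.
have /memv_imgP[u _ E] : ract m (e i) \in limg l by rewrite lU -act_lfunE memv_img ?memvf.
by exists u.
Qed.

(** A module X in Fac Q is killed by [e i], so Hom(L, X) = 0 and Ext^1(Q, X) embeds into Ext^1(M, X)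
    = 0. *)
Lemma rig_sink_quotient L Q (l : 'Hom(L, M)) (q : 'Hom(M, Q)) :
  ses l q -> concentrated L i -> kills Q (e i) -> rig Q.
Proof.
move=> slq cL Qi X QX C cC; have [hl hq l0 q1 ker] := slq.
have [s [r [ps ri pi rs e_id]]] := ses_split slq.
have [C1 cC1 C1E] := cocycle_map hq (@hom_id _ _ X) cC.
have [th thE] := rM (gen_trans (gen_surj hq q1 (@gen_refl _ _ M)) QX) cC1.
have Xi : kills X (e i) := kills_gen QX Qi.
have thl u : th (l u) = 0.
  have := thE (l u) (e i); rewrite C1E id_lfunE pi linear0 zero_lfunE -hl cL Xi subr0.
  by move=> <-.
have ths y : th (s (q y)) = th y by rewrite [in RHS](e_id y) linearD /= thl add0r.
exists (th \o s)%VF => x a; rewrite !comp_lfunE -{2}(ps x) -hq ths.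
by rewrite -thE C1E id_lfunE ps.
Qed.

Lemma ext0_sink L Q (l : 'Hom(L, M)) (q : 'Hom(M, Q)) N :
  ses l q -> pd1 Q -> gen M N -> ext0 L N.
Proof.
move=> slq pQ MN C cC; have [hl _ _ _ _] := slq.
have [C' cC' C'E] := cocycle_coextend slq pQ cC.
have [th thE] := rM MN cC'; exists (th \o l)%VF => u a.
by rewrite -C'E thE !comp_lfunE hl.
Qed.

(** S is N e_i for the quotient N of M by the kernel of L -> S, and Ext^1(L, N) = 0. Evaluating the
    cocycle at [e i] shows that a primitive L -> N takes its values in N e_i. *)
Lemma ext0_sink_quotient L Q (l : 'Hom(L, M)) (q : 'Hom(M, Q)) S (p : 'Hom(L, S)) :
  ses l q -> pd1 Q -> concentrated L i -> limg l = limg (act_lfun M (e i)) ->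
  is_hom p -> limg p = fullv -> ext0 L S.
Proof.
move=> slq pQ cL lU hp p1; have [hl hq l0 q1 ker] := slq.
have [N [pi [hpi pi1 piK]]] := quot_exists (img_stable hl (ker_stable hp)).
have MN : gen M N := gen_surj hpi pi1 (@gen_refl _ _ M).
have [|io hio ioE] := hom_descend hp p1 (hom_comp hpi hl) _.
  apply/subvP=> u up; rewrite memv_ker comp_lfunE -memv_ker piK.
  by rewrite memv_img.
have io0 : lker io = 0%VS.
  apply/injP=> x; have [u ->] := (surjP p).1 p1 x; rewrite ioE comp_lfunE => /eqP.
  rewrite -memv_ker piK => /memv_imgP[w wp luw].
  have -> : u = w by apply/eqP; rewrite -subr_eq0; apply/eqP; move/injP: (l0); apply; rewrite linearB /= luw subrr.
  by move: wp; rewrite memv_ker => /eqP.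
have [r rio] := inj_retract io0.
have cS : concentrated S i := concentrated_surj hp p1 cL.
move=> C cC; have [C1 cC1 C1E] := cocycle_map (@hom_id _ _ L) hio cC.
have [th thE] := ext0_sink slq pQ MN cC1.
have the u : th u = ract (th u) (e i).
  have E : io (C u (e i)) = th u - ract (th u) (e i).
    by have := C1E u (e i); rewrite id_lfunE thE cL => <-.
  have : ract (io (C u (e i))) (e i) = 0 by rewrite E ractBl -ractM e_idem subrr.
  by rewrite -hio cS E => /eqP; rewrite subr_eq0 => /eqP.
have ior u : io (r (th u)) = th u.
  rewrite the; have [m ->] := (surjP pi).1 pi1 (th u); rewrite -hpi.
  have /memv_imgP[w _ ->] : ract m (e i) \in limg l by rewrite lU -act_lfunE memv_img ?memvf.
  by have := ioE w; rewrite comp_lfunE => <-; rewrite rio.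
exists (r \o th)%VF => u a; apply/eqP; rewrite -subr_eq0; apply/eqP; move/injP: (io0); apply.
rewrite linearB linearB /= hio !comp_lfunE !ior -thE.
by have := C1E u a; rewrite id_lfunE => ->; rewrite subrr.
Qed.

(** A nonzero quotient S of L of least dimension is the simple module at i, and the concentrated
    modules are iterated extensions of it. So Ext^1(L, -) vanishes on all of them, and a surjection
    onto L from a module in add E splits. *)
Lemma sink_inadd L Q (l : 'Hom(L, M)) (q : 'Hom(M, Q)) E :
  ses l q -> pd1 Q -> concentrated L i -> limg l = limg (act_lfun M (e i)) ->
  concentrated E i -> (forall N, concentrated N i -> gen E N) -> inadd E L.
Proof.
move=> slq pQ cL lU cE gE; have [L0|L0] := pselect (is_zero L); first exact: inadd_zero.
pose Pr (x : {S : rmodule A & 'Hom(L, S)}) :=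
  [/\ is_hom (projT2 x), limg (projT2 x) = fullv & ~ is_zero (projT1 x)].
have [|[S p] [/= hp p1 S0] Smin] := @exists_minimal _ Pr (fun x => dim (projT1 x))
    (existT _ L (\1%VF : 'Hom(L, L))).
  by split=> //=; [apply: hom_id|apply: lim1g].
have eS := ext0_sink_quotient slq pQ cL lU hp p1.
have cS := concentrated_surj hp p1 cL.
have ext0c Y : concentrated Y i -> ext0 L Y.
  have [k] := ubnP (dim Y); elim: k Y => // k IH Y dY cY.
  have [Y0|Y0] := pselect (is_zero Y); first exact: ext0_inadd_r (inadd_zero _ Y0) eS.
  have [f hf f0] := corner_hom cY cS Y0 S0.
  have f1 : limg f = fullv.
    apply: contrapT => nf; have [S' [p' [hp' p'1 p'K]]] := quot_exists (img_stable hf (@full_stable _ _ Y)).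
    have /Smin /= : Pr (existT _ S' (p' \o p)%VF).
      split=> /=; [exact: hom_comp|by rewrite limg_comp p1|move=> S'0; apply: nf].
      apply/eqP; rewrite eqEsubv subvf -p'K; apply/subvP=> v _.
      by rewrite memv_ker (S'0 (p' v)).
    have := limg_ker_dim p' fullv; rewrite capfv p'1 p'K !dimvf => <-.
    rewrite -[X in (_ <= X)%N]add0n leq_add2r leqn0 dimv_eq0 => /eqP fz; apply: f0.
    by apply/lfunP=> x; apply/eqP; rewrite zero_lfunE -memv0 -fz memv_img ?memvf.
  have [N [j sjf]] := ses_ker hf f1; have [hj _ j0 _ _] := sjf.
  apply: (ext0_ses_r sjf _ eS); apply: IH; last exact: concentrated_sub hj j0 cY.
  rewrite -ltnS; apply: leq_trans dY; rewrite ltnS.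
  have [_ _ _ _ ker] := sjf.
  have kf : lker f = limg j.
    apply/vspaceP=> v; rewrite memv_ker; apply/eqP/memv_imgP => [/ker[u ->]|[u _ ->]].
      by exists u; rewrite ?memvf.
    by apply/ker; exists u.
  have := limg_ker_dim f fullv; rewrite capfv f1 kf limg_dim_eq ?j0 ?capv0 // !dimvf => <-.
  by rewrite -addn1 leq_add2l lt0n; apply/eqP => /zero_dim.
have [Y [f [EY hf f1]]] := gen_cover (gE _ cL).
have cY := concentrated_inadd EY cE.
have [N [j sjf]] := ses_ker hf f1; have [hj _ j0 _ _] := sjf.
have [h hh fh] := hom_lift sjf (ext0c _ (concentrated_sub hj j0 cY)) (@hom_id _ _ L).
apply: inadd_trans EY _; apply: retract_inadd hh hf _ => x.
by rewrite -comp_lfunE fh id_lfunE.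
Qed.

End Step.

Theorem triangular_tame : rigid_tame ht.
Proof.
(* Induction on k, a strict bound for the ranks of the vertices supporting M. In the step, the
   vertex of rank k, if there is one, is a sink of the support. *)
suff H k M : (forall i, (k <= rk i)%N -> kills M (e i)) -> rig M -> pd1 M /\ pd1 (D M).
  move=> M rM; apply: (H (\max_i (rk i)).+1) => // i.
  by rewrite ltnNge leq_bigmax.
elim: k M => [|k IH] M Mk rM.
  have M0 : is_zero M by apply: e_killed => i; apply: Mk.
  by split; apply: pd1_zero => //; apply: dual_zero.
have [[i ki]|nk] := pselect (exists i, rk i = k); last first.
  apply: IH => // i; rewrite leq_eqVlt => /orP[/eqP ki|/Mk //].
  by case: nk; exists i.
have Mi j : (rk i < rk j)%N -> kills M (e j) by rewrite ki; apply: Mk.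
have [L [Q [l [q [slq cL lU Qk]]]]] := sink_ses Mi.
have rQ : rig Q := rig_sink_quotient rM slq cL (Qk i (leqnn _)).
have [|pQ pDQ] := IH Q _ rQ; first by rewrite -ki.
have [E [cE pE pDE gE]] := corner_tame i.
have EL := sink_inadd rM slq pQ cL lU cE gE.
split; first exact: pd1_ses slq (pd1_inadd EL pE) pQ.
have [q' [l' sD]] := dual_ses ht slq.
exact: pd1_ses sD pDQ (pd1_inadd (dual_inadd ht EL) pDE).
Qed.

End Triangular.

(* [e i * A] is the direct sum of the local algebra with basis the [x i ^+ s * e i] and
   of the right modules [g u * A], each of them isomorphic to [e (tgt u) * A]. *)
Record triangular_basis (K : fieldType) (A : falgType K) (n : nat)
    (e x : 'I_n -> A) (d rk : 'I_n -> nat) (U : 'I_n -> finType)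
    (tgt : forall i, U i -> 'I_n) (g : forall i, U i -> A) : Prop := {
  tb_idem : forall i, e i * e i = e i;
  tb_orth : forall i j, i != j -> e i * e j = 0;
  tb_sum : \sum_i e i = 1;
  tb_loopl : forall i, e i * x i = x i;
  tb_loopr : forall i, x i * e i = x i;
  tb_nilp : forall i, x i ^+ d i = 0;
  tb_rk : injective rk;
  tb_lt : forall i (u : U i), (rk i < rk (tgt i u))%N;
  tb_srcE : forall i (u : U i), e i * g i u = g i u;
  tb_tgtE : forall i (u : U i), g i u * e (tgt i u) = g i u;
  tb_span : forall i a, exists (c : 'I_(d i) -> K) (y : U i -> A),
    e i * a = \sum_s c s *: (x i ^+ s * e i) + \sum_u g i u * y u;
  tb_free : forall i (c : 'I_(d i) -> K) (y : U i -> A),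
    (forall u, e (tgt i u) * y u = y u) ->
    \sum_s c s *: (x i ^+ s * e i) + \sum_u g i u * y u = 0 ->
    (forall s, c s = 0) /\ (forall u, y u = 0) }.

(** * The local algebra at a vertex *)

Section Corner.
Variables (K : fieldType) (A : falgType K) (n : nat).
Variables (e x : 'I_n -> A) (d rk : 'I_n -> nat) (U : 'I_n -> finType).
Variables (tgt : forall i, U i -> 'I_n) (g : forall i, U i -> A).
Hypothesis tb : triangular_basis e x d rk tgt g.
Implicit Types M N X Y E : rmodule A.
Local Notation RA := (regular_module A).

Lemma loop_exp i s : e i * x i ^+ s = x i ^+ s * e i.
Proof.
elim: s => [|s IH]; first by rewrite expr0 mulr1 mul1r.
by rewrite exprS mulrA (tb_loopl tb) -mulrA -IH mulrA (tb_loopr tb).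
Qed.

Lemma loop_expK i s : e i * (x i ^+ s * e i) = x i ^+ s * e i.
Proof. by rewrite mulrA loop_exp -mulrA (tb_idem tb). Qed.

(** Expanding [e i * a] replaces i by targets of larger rank, whence the induction on the distance
    of [rk i] from the largest rank. *)
Lemma corner_tri i j a : i != j -> ~~ (rk i < rk j)%N -> e i * a * e j = 0.
Proof.
have [k] := ubnP (\max_h rk h - rk i)%N; elim: k i a => // k IH i a ik ij rij.
have [c [y ->]] := tb_span tb i a.
rewrite mulrDl !mulr_suml !big1 ?addr0 // => [u|s] _; last first.
  by rewrite -scalerAl -mulrA (tb_orth tb) // mulr0 scaler0.
have lu := tb_lt tb u; rewrite -(tb_tgtE tb) -!mulrA [e (tgt _) * _]mulrA.
have [tj|tj] := eqVneq (tgt u) j; first by rewrite -tj lu in rij.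
rewrite IH ?mulr0 //; last by apply: contra rij; apply: ltn_trans.
rewrite -ltnS; apply: leq_trans ik; rewrite ltnS ltn_sub2l //.
by apply: leq_trans lu _; apply: leq_bigmax.
Qed.

(** A path that leaves i never returns, so the corner algebra at i is also a quotient algebra of
    A. *)
Lemma cornerM i a b : e i * (a * b) * e i = (e i * a * e i) * (e i * b * e i).
Proof.
have H : e i * a * b * e i = e i * a * e i * b * e i.
  rewrite -[e i * a in LHS]mulr1 -(tb_sum tb) mulr_sumr !mulr_suml (bigD1 i) //=.
  rewrite big1 ?addr0 // => j ji.
  have [lt|nlt] := boolP (rk i < rk j)%N; last by rewrite corner_tri ?mul0r // eq_sym.
  rewrite -[X in X = _]mulrA -[X in X = _]mulrA [e j * _]mulrA.
  by rewrite (corner_tri (j := i)) ?mulr0 // -leqNgt ltnW.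
by rewrite mulrA H !mulrA -[e i * a * e i * e i]mulrA (tb_idem tb).
Qed.

Lemma corner_span i a : exists c : 'I_(d i) -> K,
  e i * a * e i = \sum_s c s *: (x i ^+ s * e i).
Proof.
have [c [y ->]] := tb_span tb i a; exists c.
rewrite mulrDl !mulr_suml [X in _ + X]big1 ?addr0 => [|u _].
  by apply: eq_bigr => s _; rewrite -scalerAl -mulrA (tb_idem tb).
rewrite -(tb_tgtE tb) -!mulrA [e (tgt _) * _]mulrA corner_tri ?mulr0 //.
  by apply: contraTneq (tb_lt tb u) => ->; rewrite ltnn.
by rewrite -leqNgt ltnW ?(tb_lt tb u).
Qed.

Lemma corner_free i (c c' : 'I_(d i) -> K) :
  \sum_s c s *: (x i ^+ s * e i) = \sum_s c' s *: (x i ^+ s * e i) -> c =1 c'.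
Proof.
move=> cc s; have [||H _] := tb_free tb (c := fun s => c s - c' s) (y := fun=> 0).
- by move=> u; rewrite mulr0.
- rewrite [X in _ + X]big1 ?addr0 => [|u _]; last by rewrite mulr0.
  under eq_bigr do rewrite scalerBl.
  by rewrite sumrB cc subrr.
by apply/eqP; rewrite -subr_eq0 H.
Qed.

Lemma corner_coef i : exists c : 'I_(d i) -> 'Hom(A, K^o),
  forall a, e i * a * e i = \sum_s c s a *: (x i ^+ s * e i).
Proof.
have [c cE] := choice (corner_span i).
have H s : exists f : 'Hom(A, K^o), forall a, f a = c a s.
  apply: lfun_exists => k a b.
  have := @corner_free i (c (k *: a + b)) (fun s => k * c a s + c b s); apply.
  rewrite -cE mulrDr mulrDl -scalerAr -scalerAl !cE scaler_sumr -big_split /=.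
  by apply: eq_bigr => r _; rewrite scalerDl scalerA.
have [f fE] := choice H; exists f => a; rewrite cE.
by apply: eq_bigr => s _; rewrite fE.
Qed.

Lemma corner_module i : exists E (q : 'Hom(RA, E)),
  [/\ is_hom q, limg q = fullv & forall a : A, q a = 0 <-> e i * a * e i = 0].
Proof.
have [f fE] : exists f : 'Hom(RA, RA), forall a : A, f a = e i * a * e i.
  by apply: lfun_exists => k a b; rewrite mulrDr mulrDl -scalerAr -scalerAl.
have [|E [q [hq q1 qK]]] := @quot_exists _ _ RA (lker f).
  by move=> v a; rewrite !memv_ker !fE /= cornerM => /eqP ->; rewrite mul0r.
exists E, q; split=> // a; rewrite -fE.
by split=> [/eqP|/eqP]; rewrite -memv_ker; [rewrite qK|rewrite -qK]; rewrite memv_ker => /eqP.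
Qed.

Lemma corner_ract M i (v : M) a : concentrated e M i ->
  ract v a = ract v (e i * a * e i).
Proof. by move=> cM; rewrite !ractM !cM. Qed.

Section CornerModule.
Variables (i : 'I_n) (E : rmodule A) (q : 'Hom(RA, E)).
Hypotheses (hq : is_hom q) (q1 : limg q = fullv).
Hypothesis qK : forall a : A, q a = 0 <-> e i * a * e i = 0.

Lemma corner_concentrated : concentrated e E i.
Proof.
move=> v; have [a ->] := (surjP q).1 q1 v; rewrite -hq; apply/eqP.
rewrite -subr_eq0 -linearB; apply/eqP/qK => /=.
by rewrite mulrBr mulrBl -!mulrA (tb_idem tb) subrr.
Qed.

Lemma corner_hom_from N (v : N) : concentrated e N i ->
  exists2 f : 'Hom(E, N), is_hom f & forall a : A, f (q a) = ract v a.
Proof.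
move=> cN; have [h hh hE] := regular_hom v.
have [|f hf fE] := hom_descend hq q1 hh _.
  apply/subvP=> a; rewrite !memv_ker hE (corner_ract _ _ cN) => /eqP/qK ->.
  by rewrite ract0r.
by exists f => // a; rewrite fE hE.
Qed.

Lemma corner_gen N : concentrated e N i -> gen E N.
Proof.
move=> cN V HV; apply/eqP; rewrite eqEsubv subvf; apply/subvP=> v _.
have [f hf fE] := corner_hom_from v cN.
apply: (subvP (HV f hf)); apply/memv_imgP; exists (q (1 : A)); rewrite ?memvf //.
by rewrite fE ract1.
Qed.

(** The kernel R of A -> E is the direct sum of (1 - e_i) A and the g_u A, and uniqueness of the
    coefficients identifies g_u A with e_j A for the target j of u. So R is projective. *)
Lemma corner_pd1 : pd1 E.
Proof.
have [R [j sj]] := ses_ker hq q1; have [hj _ /injP j0 _ ker] := sj.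
apply: (pd1_projective_kernel sj); last exact: projective_regular.
apply: projective_inadd (@projective_regular _ A).
have eJ v : e i * (j v : A) * e i = 0 by apply/qK/ker; exists v.
have H (v : R) : exists y : U i -> A, (forall u, e (tgt u) * y u = y u) /\
    e i * (j v : A) = \sum_u g u * y u.
  have [c [y E1]] := tb_span tb i (j v); exists (fun u => e (tgt u) * y u); split.
    by move=> u; rewrite mulrA (tb_idem tb).
  have E2 : \sum_s c s *: (x i ^+ s * e i) = \sum_(s < d i) 0 *: (x i ^+ s * e i).
    rewrite [RHS]big1 => [|s _]; last by rewrite scale0r.
    have := eJ v; rewrite E1 mulrDl !mulr_suml [X in _ + X]big1 ?addr0 => [E3|u _].
      by rewrite -[RHS]E3; apply: eq_bigr => s _; rewrite -scalerAl -mulrA (tb_idem tb).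
    rewrite -(tb_tgtE tb) -!mulrA [e (tgt _) * _]mulrA corner_tri ?mulr0 //.
      by apply: contraTneq (tb_lt tb u) => ->; rewrite ltnn.
    by rewrite -leqNgt ltnW ?(tb_lt tb u).
  rewrite E1 E2 big1 ?add0r => [|s _]; last by rewrite scale0r.
  by apply: eq_bigr => u _; rewrite mulrA (tb_tgtE tb).
have [y yE] := choice H.
have yU v (z : U i -> A) : (forall u, e (tgt u) * z u = z u) ->
    e i * (j v : A) = \sum_u g u * z u -> y v =1 z.
  move=> zE jE u; have [y1 y2] := yE v.
  have [||_ F] := tb_free tb (c := fun s : 'I_(d i) => 0) (y := fun u => y v u - z u).
  - by move=> w; rewrite mulrBr y1 zE.
  - rewrite big1 ?add0r => [|s _]; last by rewrite scale0r.
    by under eq_bigr do rewrite mulrBr; rewrite sumrB -y2 -jE subrr.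
  by apply/eqP; rewrite -subr_eq0 F.
have F u : exists f : 'Hom(R, RA), is_hom f /\ forall v, f v = y v u.
  have [|f fE] := @lfun_exists K R RA (y^~ u).
    move=> k v w /=; have [[v1 v2] [w1 w2]] := (yE v, yE w).
    apply: (yU _ (fun u => k *: y v u + y w u)) => [z|].
      by rewrite mulrDr -scalerAr v1 w1.
    rewrite linearP mulrDr -scalerAr v2 w2 scaler_sumr -big_split /=.
    by apply: eq_bigr => z _; rewrite mulrDr scalerAr.
  exists f; split=> // v a; rewrite !fE; have [v1 v2] := yE v.
  apply: (yU _ (fun u => y v u * a)) => [z|]; first by rewrite mulrA v1.
  rewrite hj /= mulrA v2 mulr_suml; by apply: eq_bigr => z _; rewrite mulrA.
have [f fP] := choice F.
have G (b : A) : e i * b * e i = 0 ->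
    exists h : 'Hom(RA, R), is_hom h /\ forall a : A, j (h a) = b * a.
  move=> /qK/ker[r br]; have [h hh hE] := regular_hom r.
  by exists h; split=> // a; rewrite hE hj -br.
have gk (u : U i) : e i * g u * e i = 0.
  rewrite (tb_srcE tb) -(tb_tgtE tb) -mulrA (tb_orth tb) ?mulr0 //.
  by apply: contraTneq (tb_lt tb u) => ->; rewrite ltnn.
have [h hP] := choice (fun u => G _ (gk u)).
have [h0 [hh0 h0E]] : exists h : 'Hom(RA, R), is_hom h /\ forall a : A, j (h a) = (1 - e i) * a.
  by apply: G; rewrite mulrBr mulr1 (tb_idem tb) subrr mul0r.
exists (unit + U i)%type, (fun o => if o is inr u then f u else j).
exists (fun o => if o is inr u then h u else h0); split=> [[_|u]|[_|u]|v] //.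
- by have [] := fP u.
- by have [] := hP u.
apply/eqP; rewrite -subr_eq0; apply/eqP/j0; rewrite linearB linear_sum /=.
rewrite big_sumType big_const card_unit /= addr0 h0E; under eq_bigr => u _ do rewrite (hP u).2 (fP u).2.
by rewrite -(yE v).2 mulrBl mul1r subrK subrr.
Qed.

End CornerModule.

(** A rank one map from the top of X to the socle of Y: as [x i] is nilpotent, some nonzero
    functional vanishes on X x_i and some nonzero y is killed by [x i]. *)
Lemma corner_hom_exists i X Y : concentrated e X i -> concentrated e Y i ->
  ~ is_zero X -> ~ is_zero Y -> exists2 f : 'Hom(X, Y), is_hom f & f <> 0.
Proof.
move=> cX cY X0 Y0.
have xs0 M (v : M) s : (d i <= s)%N -> ract v (x i ^+ s) = 0.
  by move=> ds; rewrite -(subnK ds) exprD (tb_nilp tb) mulr0 ract0r.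
have [l [lK l0]] : exists l : 'Hom(X, K^o), (forall v, l (ract v (x i)) = 0) /\ l <> 0.
  have [v vx] : exists v : X, v \notin limg (act_lfun X (x i)).
    apply: contrapT => nX; apply: X0 => v.
    have H s : exists w, v = ract w (x i ^+ s).
      elim: s => [|s [w ->]]; first by exists v; rewrite expr0 ract1.
      have /memv_imgP[w' _ ->] : w \in limg (act_lfun X (x i)).
        by apply: contrapT => /negP wn; apply: nX; exists w.
      by exists w'; rewrite act_lfunE -ractM exprS.
    by have [w ->] := H (d i); apply: xs0.
  have [l /subvP lU lv] := separate vx; exists l; split=> [w|l0].
    by apply/eqP; rewrite -memv_ker lU // -act_lfunE memv_img ?memvf.
  by move: lv; rewrite l0 zero_lfunE eqxx.
have [y [yx y0]] : exists y : Y, ract y (x i) = 0 /\ y <> 0.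
  apply: contrapT => nY; apply: Y0 => v.
  have H s : ract v (x i ^+ s) = 0 -> v = 0.
    elim: s => [|s IH]; first by rewrite expr0 ract1.
    rewrite exprSr ractM => vs; apply: IH; apply: contrapT => v0; apply: nY.
    by exists (ract v (x i ^+ s)).
  exact: H (xs0 _ _ _ (leqnn _)).
have [|f fE] := @lfun_exists K X Y (fun v => l v *: y).
  by move=> k u v; rewrite linearP scalerDl scalerA.
exists f => [v a|f0]; last first.
  apply: l0; apply/lfunP=> v; have := fE v; rewrite f0 !zero_lfunE => /esym/eqP.
  by rewrite scaler_eq0 => /orP[/eqP //|/eqP].
have [c cE] := corner_span i a.
rewrite !fE (corner_ract _ _ cX) [RHS](corner_ract _ _ cY) cE !ract_sumr linear_sum scaler_suml.
apply: eq_bigr => s _; rewrite !ractZr linearZ /= !ractM cX cY ractZl.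
case: s => [[|s] sd] /=; first by rewrite expr0 !ract1 scalerA.
by rewrite [in RHS]exprS exprSr !ractM lK yx ract0l !scaler0 scale0r.
Qed.

End Corner.

Section CornerDual.
Variables (K : fieldType) (A B : falgType K) (t : B -> A) (ht : anti_morphism t).
Hypothesis t_inj : injective t.
Variables (n : nat) (d : 'I_n -> nat).
Variables (e x : 'I_n -> A) (rk : 'I_n -> nat) (U : 'I_n -> finType).
Variables (tgt : forall i, U i -> 'I_n) (g : forall i, U i -> A).
Variables (e' x' : 'I_n -> B) (rk' : 'I_n -> nat) (U' : 'I_n -> finType).
Variables (tgt' : forall i, U' i -> 'I_n) (g' : forall i, U' i -> B).
Hypothesis tb : triangular_basis e x d rk tgt g.
Hypothesis tb' : triangular_basis e' x' d rk' tgt' g'.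
Hypotheses (te : forall i, t (e' i) = e i) (tx : forall i, t (x' i) = x i).
Local Notation D := (adual ht).

(* The corner algebra is a truncated polynomial ring, hence a Frobenius algebra: the
   coefficient of the top power of the loop is a Frobenius form. *)
Lemma corner_dual i (E : rmodule A) (q : 'Hom(regular_module A, E))
    (E' : rmodule B) (q' : 'Hom(regular_module B, E')) :
  is_hom q -> limg q = fullv -> (forall a : A, q a = 0 <-> e i * a * e i = 0) ->
  is_hom q' -> limg q' = fullv -> (forall b : B, q' b = 0 <-> e' i * b * e' i = 0) ->
  iso E' (D E).
Proof.
move=> hq q1 qK hq' q'1 q'K; have [lt t1 tM] := ht.
have texp s : t (x' i ^+ s) = x i ^+ s.
  by elim: s => [|s IH]; rewrite ?expr0 // exprS tM IH tx -exprSr.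
have [tl tlE] := lfun_exists lt.
have cE := corner_concentrated tb hq q1 qK.
have qe (a : A) : q a = q (e i * a * e i).
  apply/eqP; rewrite -subr_eq0 -linearB; apply/eqP/qK.
  by rewrite mulrBr mulrBl !mulrA (tb_idem tb) -[_ * e i * e i]mulrA (tb_idem tb) subrr.
have [c cdef] := corner_coef tb i.
have c_basis (b : 'I_(d i) -> K) (a : A) :
    e i * a * e i = \sum_s b s *: (x i ^+ s * e i) -> forall s, c s a = b s.
  by move=> aE s; apply: (corner_free tb (c := fun s => c s a)); rewrite -cdef.
(* The coefficient of the top power of the loop. The filtered sum has one term when [d i] is
   positive and needs no index when it is 0. *)
pose la : 'Hom(A, K^o) := \sum_(s | val s == (d i).-1) c s.
have laE a : la a = \sum_(s | val s == (d i).-1) c s a by rewrite sum_lfunE.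
clearbody la.
have la_eq a b : e i * a * e i = e i * b * e i -> la a = la b.
  by move=> ab; rewrite !laE; apply: eq_bigr => s _; apply: (c_basis (fun s => c s b)); rewrite ab.
have la_mon k (s : 'I_(d i)) : la (x i ^+ (k + s)%N * e i) = (k + s == (d i).-1)%N%:R.
  have d0 : (0 < d i)%N by apply: leq_trans (ltn_ord s).
  rewrite laE (eq_bigr (fun r : 'I_(d i) => (k + s == r)%N%:R)); last first.
    move=> r _; apply: (c_basis (fun r : 'I_(d i) => (k + s == r)%N%:R)).
    rewrite (loop_expK tb) -mulrA (tb_idem tb).
    have [lt1|ge1] := ltnP (k + s) (d i).
      rewrite (bigD1 (Ordinal lt1)) //= eqxx scale1r big1 ?addr0 // => j rn.
      rewrite (_ : (k + s == j)%N = false) ?scale0r //.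
      by apply: contra_neqF rn => /eqP H; apply: val_inj.
    rewrite -(subnK ge1) exprD (tb_nilp tb) mulr0 mul0r big1 // => j _.
    rewrite subnK // gtn_eqF ?scale0r //.
    exact: leq_trans (ltn_ord j) ge1.
  have lt0 : ((d i).-1 < d i)%N by rewrite prednK.
  rewrite (bigD1 (Ordinal lt0)) //= big1 ?addr0 // => r /andP[/eqP r1 /eqP[]].
  exact: val_inj.
have la_coef k (b : A) (w : 'I_(d i) -> K) : e i * b * e i = \sum_s w s *: (x i ^+ s * e i) ->
    la (x i ^+ k * e i * b) = \sum_s w s * (k + s == (d i).-1)%N%:R.
  move=> bE; rewrite (la_eq _ (\sum_s w s *: (x i ^+ (k + s)%N * e i))).
    by rewrite linear_sum; apply: eq_bigr => s _; rewrite linearZ /= la_mon.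
  have -> : e i * (x i ^+ k * e i * b) * e i = x i ^+ k * (e i * b * e i).
    by rewrite !mulrA (loop_exp tb) -[_ * e i * e i]mulrA (tb_idem tb).
  rewrite bE !mulr_sumr mulr_suml; apply: eq_bigr => s _.
  by rewrite -!scalerAr -scalerAl (loop_expK tb) -mulrA (tb_idem tb) exprD mulrA.
have [la' la'E] : exists la' : 'Hom(E, K^o), forall a : A, la' (q a) = la a.
  have [h hE] := surj_section q1.
  exists (la \o h)%VF => a; rewrite comp_lfunE; apply: la_eq; apply/eqP.
  rewrite -subr_eq0 -mulrBl -mulrBr; apply/eqP/qK.
  by rewrite linearB /= hE subrr.
have [|f hf fE] := corner_hom_from hq' q'1 q'K (la' : D E) (i := i).
  by move=> l; apply/lfunP=> v; rewrite adual_ract te cE.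
have fqE (b : B) (a : A) : (f (q' b) : 'Hom(E, K^o)) (q a) = la (a * t b).
  by rewrite fE adual_ract -hq la'E.
exists f; split=> //.
  apply/injP=> v; have [b ->] := (surjP q').1 q'1 v => fb; apply/q'K.
  (* Pairing with the power of exponent (d i).-1 - s isolates the coefficient of index s. *)
  apply: t_inj; rewrite -!tlE linear0 tlE !tM te mulrA cdef big1 // => s _.
  have := fqE b (x i ^+ ((d i).-1 - s) * e i); rewrite fb zero_lfunE (la_coef _ _ _ (cdef _)).
  rewrite (bigD1 s) //= big1 ?addr0 => [|r rs].
    rewrite subnK ?eqxx ?mulr1 => [<-|]; first by rewrite scale0r.
    by rewrite -ltnS (leq_trans (ltn_ord s)) ?leqSpred.
  rewrite (_ : (_ == (d i).-1)%N = false) ?mulr0 //; apply: contra_neqF rs => /eqP H.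
  apply: val_inj; apply/eqP; rewrite -(eqn_add2l ((d i).-1 - s)%N) H subnK //.
  by rewrite -ltnS (leq_trans (ltn_ord s)) ?leqSpred.
(* By the same pairing, the element representing mu has at s the value of mu on the complementary
   power. *)
apply/surjP=> mu; pose b := \sum_(s < d i) (mu : 'Hom(E, K^o)) (q (x i ^+ ((d i).-1 - s) * e i)) *: (x' i ^+ s * e' i).
have tb_b : e i * t b * e i = \sum_(s < d i) (mu : 'Hom(E, K^o)) (q (x i ^+ ((d i).-1 - s) * e i)) *: (x i ^+ s * e i).
  rewrite -tlE linear_sum mulr_sumr mulr_suml; apply: eq_bigr => s _.
  rewrite linearZ /= tlE tM te texp (loop_exp tb) -scalerAr -scalerAl.
  by rewrite (loop_expK tb) -mulrA (tb_idem tb).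
exists (q' b); apply/lfunP=> v; have [a ->] := (surjP q).1 q1 v.
rewrite [in LHS]qe [in RHS]qe cdef; set z := \sum_s _.
clearbody b.
rewrite /z !linear_sum /=; apply: eq_bigr => k _; rewrite !linearZ /= fqE (la_coef _ _ _ tb_b).
have kd : (k <= (d i).-1)%N by rewrite -ltnS (leq_trans (ltn_ord k)) ?leqSpred.
have lt0 : ((d i).-1 - k < d i)%N.
  by apply: leq_ltn_trans (leq_subr _ _) _; rewrite prednK // (leq_trans _ (ltn_ord k)).
rewrite (bigD1 (Ordinal lt0)) //= subnKC // eqxx mulr1 subKn // big1 ?addr0 // => s sn.
rewrite (_ : (k + s == (d i).-1)%N = false) ?mulr0 //; apply: contra_neqF sn => /eqP H.
by apply: val_inj; rewrite /= -H addKn.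
Qed.

Theorem triangular_basis_tame : rigid_tame ht.
Proof.
apply: (@triangular_tame _ _ _ _ ht n e rk (tb_idem tb) (tb_sum tb) (tb_rk tb)).
- by move=> i j a; apply: (corner_tri tb).
- move=> i; have [E [q [hq q1 qK]]] := corner_module tb i.
  have [E' [q' [hq' q'1 q'K]]] := corner_module tb' i.
  exists E; split.
  + exact: (corner_concentrated tb hq q1 qK).
  + exact: (corner_pd1 tb hq q1 qK).
  + apply: pd1_inadd (corner_pd1 tb' hq' q'1 q'K).
    by have [] := iso_inadd (corner_dual hq q1 qK hq' q'1 q'K).
  + exact: (corner_gen hq q1 qK).
- exact: (corner_hom_exists tb).
Qed.

End CornerDual.

(** * Algebras with the GLS presentation *)

Section Presentation.
Variables (K : fieldType) (n : nat) (ar : rel 'I_n) (f : 'I_n -> 'I_n -> nat) (d : 'I_n -> nat).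

(* The relations of the presentation, for a family of operators written as a right
   action: a product acts by its left factor first. *)
Record gls_action (W : vectType K) (E X : 'I_n -> W -> W) (L : 'I_n -> 'I_n -> W -> W) : Prop := {
  ga_linE : forall i, linear (E i);
  ga_linX : forall i, linear (X i);
  ga_linL : forall i j, linear (L i j);
  ga_idem : forall i v, E i (E i v) = E i v;
  ga_orth : forall i j v, i != j -> E j (E i v) = 0;
  ga_sum : forall v, \sum_i E i v = v;
  ga_loopl : forall i v, X i (E i v) = X i v;
  ga_loopr : forall i v, E i (X i v) = X i v;
  ga_nilp : forall i v, iter (d i) (X i) v = 0;
  ga_src : forall i j v, ar i j -> L i j (E i v) = L i j v;
  ga_tgt : forall i j v, ar i j -> E j (L i j v) = L i j v;
  ga_comm : forall i j v, ar i j ->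
    L i j (iter (f j i) (X i) v) = iter (f i j) (X j) (L i j v) }.

(** An algebra given by generators and relations, known only through its generation and its
    universal property for operators on vector spaces. In this form the opposite algebra qualifies
    as well, with reversed arrows. *)
Record gls_presentation (A : falgType K) (e x : 'I_n -> A) (al : 'I_n -> 'I_n -> A) : Prop := {
  gp_regular : @gls_action A (fun i v => v * e i) (fun i v => v * x i) (fun i j v => v * al i j);
  gp_gen : forall V : {vspace A}, 1 \in V ->
    (forall v i, v \in V -> v * e i \in V) -> (forall v i, v \in V -> v * x i \in V) ->
    (forall v i j, ar i j -> v \in V -> v * al i j \in V) -> V = fullv;
  gp_univ : forall (W : vectType K) (E X : 'I_n -> W -> W) (L : 'I_n -> 'I_n -> W -> W),
    gls_action E X L -> exists act : W -> A -> W,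
    [/\ forall a, linear (act^~ a), forall v, linear (act v), forall v, act v 1 = v
      & forall v a b, act v (a * b) = act (act v a) b] /\
    [/\ forall i v, act v (e i) = E i v, forall i v, act v (x i) = X i v
      & forall i j v, ar i j -> act v (al i j) = L i j v] }.

Variables (A : falgType K) (e x : 'I_n -> A) (al : 'I_n -> 'I_n -> A).
Hypothesis gp : gls_presentation e x al.
Variable rk : 'I_n -> nat.
Hypotheses (rk_inj : injective rk) (ar_lt : forall i j, ar i j -> (rk i < rk j)%N).
Hypothesis d_gt0 : forall i, (0 < d i)%N.
Hypothesis f_gt0 : forall i j, ar i j -> (0 < f j i)%N.
Hypothesis df : forall i j, ar i j -> exists k, (d i = k * f j i)%N /\ (d j = k * f i j)%N.

Let reg := gp_regular gp.

Lemma iter_rmul (a v : A) s : iter s (fun v => v * a) v = v * a ^+ s.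
Proof.
elim: s v => [|s IH] v; first by rewrite expr0 mulr1.
by rewrite iterSr IH exprS mulrA.
Qed.

Lemma gp_idem i : e i * e i = e i.
Proof. by have := ga_idem reg i 1; rewrite /= mul1r. Qed.
Lemma gp_orth i j : i != j -> e i * e j = 0.
Proof. by move=> ij; have := ga_orth reg 1 ij; rewrite /= mul1r. Qed.
Lemma gp_sum : \sum_i e i = 1.
Proof. by have := ga_sum reg 1; under eq_bigr do rewrite mul1r. Qed.
Lemma gp_loopl i : e i * x i = x i.
Proof. by have := ga_loopl reg i 1; rewrite /= !mul1r. Qed.
Lemma gp_loopr i : x i * e i = x i.
Proof. by have := ga_loopr reg i 1; rewrite /= !mul1r. Qed.
Lemma gp_nilp i : x i ^+ d i = 0.
Proof. by have := ga_nilp reg i 1; rewrite iter_rmul mul1r. Qed.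
Lemma gp_src i j : ar i j -> e i * al i j = al i j.
Proof. by move=> /(ga_src reg 1); rewrite /= !mul1r. Qed.
Lemma gp_tgt i j : ar i j -> al i j * e j = al i j.
Proof. by move=> /(ga_tgt reg 1); rewrite /= !mul1r. Qed.
Lemma gp_comm i j : ar i j -> x i ^+ f j i * al i j = al i j * x j ^+ f i j.
Proof. by move=> /(ga_comm reg 1); rewrite !iter_rmul !mul1r. Qed.

Lemma gp_exp i s : e i * x i ^+ s = x i ^+ s * e i.
Proof.
elim: s => [|s IH]; first by rewrite expr0 mulr1 mul1r.
by rewrite exprS mulrA gp_loopl -mulrA -IH mulrA gp_loopr.
Qed.

Lemma gp_comm_exp i j q : ar i j -> x i ^+ (q * f j i) * al i j = al i j * x j ^+ (q * f i j).
Proof.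
move=> ij; elim: q => [|q IH]; first by rewrite !mul0n !expr0 mul1r mulr1.
by rewrite !mulSn exprD -mulrA IH mulrA gp_comm // -mulrA -exprD.
Qed.

Definition arrow_bound : nat := \max_i \max_j f j i.

(** A pair (j, r) stands for x_i^r al_ij; from the exponent [f j i] on, powers of the loop move
    across the arrow. The bound on r only makes the type finite. *)
Definition arrow_power (i : 'I_n) : finType :=
  {u : 'I_n * 'I_arrow_bound | ar i u.1 && (u.2 < f u.1 i)%N}.

Definition power_target i (u : arrow_power i) : 'I_n := (val u).1.
Definition power_elt i (u : arrow_power i) : A := x i ^+ (val u).2 * al i (val u).1.

Lemma arrow_powerP i j r : ar i j -> (r < f j i)%N ->
  exists u : arrow_power i, (val u).1 = j /\ val (val u).2 = r.
Proof.
move=> ij rf; have rb : (r < arrow_bound)%N.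
  apply: leq_trans rf _; apply: leq_trans (leq_bigmax (F := fun i => \max_j f j i) i).
  exact: (leq_bigmax (F := fun j => f j i) j).
have H : ar i (j, Ordinal rb).1 && ((j, Ordinal rb).2 < f (j, Ordinal rb).1 i)%N by rewrite /= ij.
by exists (exist _ (j, Ordinal rb) H).
Qed.

(** The elements of the required form make up a subspace, and right multiplication by the generators
    preserves it. *)
Lemma gp_span i a : exists (c : 'I_(d i) -> K) (y : arrow_power i -> A),
  e i * a = \sum_s c s *: (x i ^+ s * e i) + \sum_u power_elt u * y u.
Proof.
pose P b := exists (c : 'I_(d i) -> K) (y : arrow_power i -> A),
  b = \sum_s c s *: (x i ^+ s * e i) + \sum_u power_elt u * y u.
have P0 : P 0.
  exists (fun=> 0), (fun=> 0); rewrite !big1 ?addr0 // => [u _|s _].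
    by rewrite mulr0.
  by rewrite scale0r.
have PL k u v : P u -> P v -> P (k *: u + v).
  move=> [c [y ->]] [c' [y' ->]]; exists (fun s => k * c s + c' s), (fun u => k *: y u + y' u).
  rewrite scalerDr !scaler_sumr addrACA -!big_split /=; congr (_ + _); apply: eq_bigr => s _.
    by rewrite scalerDl scalerA.
  by rewrite mulrDr scalerAr.
have Psum (I : finType) (F : I -> A) : (forall j, P (F j)) -> P (\sum_j F j).
  by move=> PF; apply: (big_ind P) => // u v Pu Pv; rewrite -[u]scale1r; apply: PL.
have PX (s : arrow_power i) b : P (power_elt s * b).
  exists (fun=> 0), (fun u => if u == s then b else 0).
  rewrite big1 ?add0r => [|u _]; last by rewrite scale0r.
  rewrite (bigD1 s) //= eqxx big1 ?addr0 // => u /negPf ->; by rewrite mulr0.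
have Pe s : P (x i ^+ s * e i).
  have [sd|ds] := ltnP s (d i); last by rewrite -(subnK ds) exprD gp_nilp mulr0 mul0r.
  exists (fun r : 'I_(d i) => (r == Ordinal sd)%:R), (fun=> 0).
  rewrite [X in _ + X]big1 ?addr0 => [|u _]; last by rewrite mulr0.
  by rewrite (bigD1 (Ordinal sd)) //= eqxx scale1r big1 ?addr0 // => r /negPf ->; rewrite scale0r.
have Pal j s : ar i j -> P (x i ^+ s * al i j).
  (* Euclidean division of s by the exponent of the relation: the multiple passes to the loop at j,
     the remainder indexes an [arrow_power]. *)
  move=> ij; rewrite (divn_eq s (f j i)) addnC exprD -mulrA gp_comm_exp // mulrA.
  have [u [u1 u2]] := arrow_powerP ij (ltn_pmod s (f_gt0 ij)).
  by have := PX u (x j ^+ (s %/ f j i * f i j)); rewrite /power_elt u1 u2.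
have Pgen b h : P b -> (forall s, P (x i ^+ s * e i * h)) -> P (b * h).
  move=> [c [y ->]] Ph; rewrite mulrDl !mulr_suml -[X in X + _]scale1r.
  apply: (PL); last by apply: (Psum) => u; rewrite -mulrA; apply: PX.
  by apply: (Psum) => s; rewrite -scalerAl -[_ *: _]addr0; apply: PL.
have [//|//|V0 V0P] := @vspace_exists K A P.
have [g gE] : exists g : 'Hom(A, A), forall b, g b = e i * b.
  by apply: lfun_exists => k u v; rewrite mulrDr scalerAr.
suff H : (g @^-1: V0)%VS = fullv.
  by apply/V0P; rewrite -gE memv_preim H memvf.
apply: (gp_gen gp).
- rewrite -memv_preim gE mulr1; apply/V0P; have := Pe 0%N; by rewrite expr0 mul1r.
- move=> v j; rewrite -!memv_preim !gE mulrA => /V0P Pv; apply/V0P/Pgen => // s.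
  rewrite -mulrA; have [<-|ij] := eqVneq i j; first by rewrite gp_idem.
  by rewrite gp_orth // mulr0.
- move=> v j; rewrite -!memv_preim !gE mulrA => /V0P Pv; apply/V0P/Pgen => // s.
  rewrite -mulrA; have [<-|ij] := eqVneq i j; last by rewrite -(gp_loopl j) [e i * _]mulrA gp_orth // mul0r mulr0.
  by rewrite gp_loopl -[X in _ * X]gp_loopr mulrA -exprSr.
- move=> v j k jk; rewrite -!memv_preim !gE mulrA => /V0P Pv; apply/V0P/Pgen => // s.
  rewrite -mulrA; have [ij|ij] := eqVneq i j; last by rewrite -(gp_src jk) [e i * _]mulrA gp_orth // mul0r mulr0.
  by rewrite -ij in jk *; rewrite gp_src //; apply: Pal.
Qed.

Section FreeAction.
Variable i : 'I_n.
Local Notation m := (d i).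
Local Notation U := (arrow_power i).
Local Notation W := ('rV[K]_m * {ffun U -> A})%type.

(** The first factor of W has a basis standing for the powers of the loop at i, on which that loop
    acts by this shift; the second is the free A-module on [arrow_power i]. The arrows out of i also
    map the first factor to the second. *)
Definition shift_mx : 'M[K]_m := \matrix_(s, t) (t == s.+1 :> nat)%:R.

(** Coordinates pushed past the last one are lost; the right hand side agrees because F vanishes
    from m on. *)
Lemma shift_sum (V : lmodType K) (F : nat -> V) (w : 'rV[K]_m) k :
  (forall s, (m <= s)%N -> F s = 0) ->
  \sum_s iter k (mulmx^~ shift_mx) w 0 s *: F s = \sum_s w 0 s *: F (s + k)%N.
Proof.
move=> F0; elim: k w => [|k IH] w; first by under [RHS]eq_bigr do rewrite addn0.
rewrite iterSr IH; under eq_bigr => s _ do rewrite mxE scaler_suml.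
rewrite exchange_big; apply: eq_bigr => s _ /=.
under eq_bigr => t _ do rewrite mxE -scalerA.
rewrite -scaler_sumr; congr (_ *: _).
have [sm|ms] := ltnP s.+1 m.
  rewrite (bigD1 (Ordinal sm)) //= eqxx scale1r addSnnS big1 ?addr0 // => t tn.
  by rewrite (_ : (_ == _)%N = false) ?scale0r //; apply: contra_neqF tn => /eqP H; apply: val_inj.
rewrite F0 ?big1 // => [t _|]; last by rewrite addnS (leq_trans ms) // leq_addr.
by rewrite ltn_eqF ?scale0r // (leq_trans (ltn_ord t)).
Qed.

Lemma shift_coord (w : 'rV[K]_m) k t : iter k (mulmx^~ shift_mx) w 0 t =
  \sum_s w 0 s * (s + k == t)%N%:R.
Proof.
have F0 s : (m <= s)%N -> (s == t)%N%:R = 0 :> K^o.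
  by move=> ms; rewrite gtn_eqF // (leq_trans (ltn_ord t)).
apply: etrans (shift_sum w k F0); rewrite (bigD1 t) //= eqxx big1 => [|s st].
  by rewrite addr0; apply/esym/mulr1.
by rewrite (_ : (_ == _)%N = false) ?scaler0 //; apply: contra_neqF st => /eqP H; apply: val_inj.
Qed.

(* The image under the arrow i -> j of the s-th power of the loop at i. *)
Definition arrow_image (j : 'I_n) s : {ffun U -> A} :=
  [ffun u : U => if ((val u).1 == j) && (nat_of_ord (val u).2 == s %% f j i)%N
             then x j ^+ (s %/ f j i * f i j) * e j else 0].

Definition freeE j (w : W) : W :=
  ((if i == j then w.1 else 0), [ffun u : U => w.2 u * e j]).
Definition freeX j (w : W) : W :=
  ((if i == j then w.1 *m shift_mx else 0), [ffun u : U => w.2 u * x j]).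
Definition freeL j k (w : W) : W :=
  (0, [ffun u : U => w.2 u * al j k] +
      if i == j then \sum_s w.1 0 s *: arrow_image k s else 0).

(** The arrows must respect the nilpotency of the loop at i. The common factor k in [df] achieves
    it: x_i^(d i) moves across the arrow as x_j^(d j). *)
Lemma arrow_image0 j s : ar i j -> (m <= s)%N -> arrow_image j s = 0.
Proof.
move=> ij ms; apply/ffunP=> u; rewrite !ffunE; case: ifP => // _.
have [k [dk dk']] := df ij.
have ks : (k <= s %/ f j i)%N by rewrite leq_divRL ?f_gt0 // -dk.
by rewrite -(subnK (leq_mul ks (leqnn (f i j)))) -dk' exprD gp_nilp mulr0 mul0r.
Qed.

Lemma arrow_imageD j s u : ar i j ->
  arrow_image j (s + f j i)%N u = arrow_image j s u * x j ^+ f i j.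
Proof.
move=> ij; rewrite !ffunE modnDr; case: ifP => _; last by rewrite mul0r.
by rewrite divnDr // divnn f_gt0 // mulnDl mul1n exprD -!mulrA gp_exp.
Qed.

Lemma arrow_image_end j s u : arrow_image j s u * e j = arrow_image j s u.
Proof. by rewrite !ffunE; case: ifP => _; rewrite ?mul0r // -mulrA gp_idem. Qed.

Lemma iter_freeX j s w : iter s (freeX j) w =
  ((if i == j then iter s (mulmx^~ shift_mx) w.1 else if s == 0%N then w.1 else 0),
   [ffun u : U => w.2 u * x j ^+ s]).
Proof.
elim: s w => [|s IH] w.
  rewrite /= if_same [LHS]surjective_pairing; congr pair.
  by apply/ffunP=> u; rewrite ffunE mulr1.
rewrite iterSr IH /freeX /= ; congr pair.
  case: eqP => _; first by rewrite -iterSr.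
  by case: ifP.
by apply/ffunP=> u; rewrite !ffunE -mulrA -exprS.
Qed.

Lemma free_gls_action : gls_action freeE freeX freeL.
Proof.
have scaleE (k : K) (h : {ffun U -> A}) u : (k *: h) u = k *: h u by rewrite ffunE.
split.
- move=> j k u v; apply: pair_ext => /=; first by case: ifP => // _; rewrite scaler0 addr0.
  by apply/ffunP=> w; rewrite !ffunE mulrDl -scalerAl.
- move=> j k u v; apply: pair_ext => /=.
    by case: ifP => // _; rewrite ?scaler0 ?addr0 // mulmxDl -scalemxAl.
  by apply/ffunP=> w; rewrite !ffunE mulrDl -scalerAl.
- move=> j h k u v; apply: pair_ext => /=; first by rewrite scaler0 addr0.
  rewrite scalerDr addrACA; congr (_ + _).
    by apply/ffunP=> w; rewrite !ffunE mulrDl -scalerAl.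
  case: ifP => _; last by rewrite scaler0 addr0.
  rewrite scaler_sumr -big_split /=; apply: eq_bigr => s _.
  by rewrite !mxE scalerDl scalerA.
- move=> j v; apply: pair_ext => /=; first by case: (i == j).
  by apply/ffunP=> u; rewrite !ffunE -mulrA gp_idem.
- move=> j k v jk; apply: pair_ext => /=.
    by case: eqP => // ik; case: eqP => // ij; case/eqP: jk; rewrite -ij -ik.
  by apply/ffunP=> u; rewrite !ffunE -mulrA gp_orth // mulr0.
- move=> v; apply: pair_ext.
    rewrite (raddf_sum (fst : W -> _)) /= (bigD1 i) //= eqxx big1 ?addr0 // => j.
    by rewrite eq_sym => /negPf ->.
  rewrite (raddf_sum (snd : W -> _)) /=; apply/ffunP=> u; rewrite sum_ffunE.
  by under eq_bigr do rewrite ffunE; rewrite -mulr_sumr gp_sum mulr1.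
- move=> j v; apply: pair_ext => /=; first by case: (i == j).
  by apply/ffunP=> u; rewrite !ffunE -mulrA gp_loopl.
- move=> j v; apply: pair_ext => /=; first by case: (i == j).
  by apply/ffunP=> u; rewrite !ffunE -mulrA gp_loopr.
- move=> j v; rewrite iter_freeX; apply: pair_ext => /=; last first.
    by apply/ffunP=> u; rewrite !ffunE gp_nilp mulr0.
  rewrite eqn0Ngt d_gt0 /=; case: eqP => // <-.
  apply/rowP=> t; rewrite shift_coord mxE big1 // => s _.
  by rewrite gtn_eqF ?mulr0 // (leq_trans (ltn_ord t)) ?leq_addl.
- move=> j k v jk; apply: pair_ext => //=; congr (_ + _); last by case: (i == j).
  by apply/ffunP=> u; rewrite !ffunE -mulrA gp_src.
- move=> j k v jk; apply: pair_ext => /=; first by rewrite if_same.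
  apply/ffunP=> u; rewrite !ffunE mulrDl -mulrA gp_tgt //; congr (_ + _).
  case: ifP => _; last by rewrite ffunE mul0r.
  rewrite !sum_ffunE mulr_suml; apply: eq_bigr => s _.
  by rewrite !scaleE -scalerAl arrow_image_end.
- move=> j k v jk; rewrite !iter_freeX; apply: pair_ext => /=.
    by case: eqP => _; [elim: (f j k) => //= r <-; rewrite mul0mx|rewrite if_same].
  apply/ffunP=> u; rewrite !ffunE mulrDl -!mulrA gp_comm //; congr (_ + _).
  case: eqP => [ij|_]; last by rewrite ffunE mul0r.
  rewrite -ij in jk *; rewrite shift_sum; last by move=> s; apply: arrow_image0.
  rewrite !sum_ffunE mulr_suml; apply: eq_bigr => s _.
  by rewrite !scaleE -scalerAl arrow_imageD.
Qed.

End FreeAction.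

(** Apply the relation to the vector v0 that stands for the trivial path at i: its terms land on
    distinct basis vectors of the first factor and in distinct copies of A in the second. *)
Lemma gp_free i (c : 'I_(d i) -> K) (y : arrow_power i -> A) :
  (forall u, e (power_target u) * y u = y u) ->
  \sum_s c s *: (x i ^+ s * e i) + \sum_u power_elt u * y u = 0 ->
  (forall s, c s = 0) /\ (forall u, y u = 0).
Proof.
move=> yE cy0; pose U := arrow_power i; pose W := ('rV[K]_(d i) * {ffun U -> A})%type.
have [act [[al1 al2 act1 actM] [actE actX actL]]] := gp_univ gp (free_gls_action i).
pose M : rmodule A := RModule al1 al2 act1 actM.
pose copy (h : {ffun U -> A}) : M := (0, h).
(* The second factor is a submodule on which A acts by right multiplication; it is enough to check
   the generators. *)
have copyE h a : ract (copy h) a = copy [ffun u => h u * a].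
  have [||V VP] := @vspace_exists K A (fun a => forall h, ract (copy h) a = copy [ffun u => h u * a]).
  - move=> h'; rewrite ract0r; apply: pair_ext => //=.
    by apply/ffunP=> u; rewrite !ffunE mulr0.
  - move=> k a1 a2 H1 H2 h'; rewrite ractDr ractZr H1 H2; apply: pair_ext => /=.
      by rewrite scaler0 addr0.
    by apply/ffunP=> u; rewrite !ffunE mulrDr scalerAr.
  suff V1 : V = fullv by move: h; apply/VP; rewrite V1 memvf.
  have step b (g : W -> W) : (forall v, act v b = g v) ->
      (forall h', g (copy h') = copy [ffun u => h' u * b]) ->
      forall v, v \in V -> v * b \in V.
    move=> bE gE v /VP vV; apply/VP=> h'; rewrite ractM vV [LHS]bE gE.
    by congr copy; apply/ffunP=> u; rewrite !ffunE mulrA.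
  apply: (gp_gen gp).
  - apply/VP=> h'; rewrite ract1; congr copy.
    by apply/ffunP=> u; rewrite ffunE mulr1.
  - move=> v j; apply: (step _ _ (actE j)) => h'; apply: pair_ext => //=.
    by rewrite if_same.
  - move=> v j; apply: (step _ _ (actX j)) => h'; apply: pair_ext => //=.
    by rewrite mul0mx if_same.
  - move=> v j k jk; apply: (step _ _ (fun v => actL j k v jk)) => h'; apply: pair_ext => //=.
    rewrite big1 ?if_same ?addr0 // => s _; by rewrite mxE scale0r.
pose v0 : M := (delta_mx 0 (Ordinal (d_gt0 i)), 0).
have v0x s : ract v0 (x i ^+ s) = (iter s (mulmx^~ (shift_mx i)) v0.1, 0).
  have -> : ract v0 (x i ^+ s) = iter s (freeX (i := i) i) v0.
    elim: s => [|s IH]; first by rewrite expr0 ract1.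
    by rewrite exprSr ractM IH [LHS]actX.
  rewrite iter_freeX eqxx; congr pair.
  by apply/ffunP=> u; rewrite !ffunE mul0r.
have v0xE s t : (iter s (mulmx^~ (shift_mx i)) v0.1) 0 t = (s == t)%N%:R.
  rewrite shift_coord (bigD1 (Ordinal (d_gt0 i))) //= mxE !eqxx mul1r add0n.
  by rewrite big1 ?addr0 // => r /negPf r0; rewrite mxE r0 andbF mul0r.
have v0e s : ract v0 (x i ^+ s * e i) = ract v0 (x i ^+ s).
  rewrite ractM v0x [LHS]actE /freeE eqxx /=; congr pair.
  by apply/ffunP=> u; rewrite !ffunE mul0r.
have v0g u : ract v0 (power_elt u) = copy [ffun u' => (u' == u)%:R * e (power_target u)].
  have /andP[iu rf] := valP u.
  rewrite ractM v0x [LHS]actL // /freeL eqxx /=; congr pair.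
  have rd : ((val u).2 < d i)%N.
    have [[|k] [dk _]] := df iu; first by have := d_gt0 i; rewrite dk.
    by apply: leq_trans rf _; rewrite dk mulSn leq_addr.
  rewrite (bigD1 (Ordinal rd)) //= v0xE eqxx scale1r big1 ?addr0; last first.
    move=> s sn; rewrite v0xE (_ : (_ == _)%N = false) ?scale0r //.
    by apply: contra_neqF sn => /eqP H; apply: val_inj.
  apply/ffunP=> w; rewrite !ffunE mul0r add0r divn_small ?modn_small // mul0n expr0 mul1r.
  have -> : (w == u) = ((val w).1 == (val u).1) && (nat_of_ord (val w).2 == (val u).2)%N.
    by rewrite -val_eqE; case: (val w) (val u) => [w1 w2] [u1 u2]; rewrite xpair_eqE.
  by case: (_ && _); rewrite ?mul1r ?mul0r.
have := congr1 (ract v0) cy0; rewrite ract0r ractDr !ract_sumr.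
under eq_bigr do rewrite ractZr v0e v0x.
under [X in _ + X]eq_bigr do rewrite ractM v0g copyE.
move=> H; split=> [t|u].
  have /rowP/(_ t) := congr1 (fst : W -> _) (H : _ = 0 :> W).
  rewrite raddfD /= !(raddf_sum (fst : W -> _)) /= !mxE !summxE (bigD1 t) //= mxE v0xE eqxx mulr1.
  rewrite big1 ?addr0 => [|s st]; last by rewrite mxE v0xE (negPf (_ : s != t :> nat)) ?mulr0.
  by rewrite big1 ?addr0 // => s _; rewrite mxE.
have /ffunP/(_ u) := congr1 (snd : W -> _) (H : _ = 0 :> W).
rewrite raddfD /= !(raddf_sum (snd : W -> _)) /= !ffunE !sum_ffunE.
rewrite big1 ?add0r => [|s _]; last by rewrite !ffunE scaler0.
rewrite (bigD1 u) //= !ffunE eqxx mul1r yE big1 ?addr0 // => w wu.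
by rewrite !ffunE eq_sym (negPf wu) !mul0r.
Qed.

Lemma gls_triangular_basis :
  triangular_basis e x d rk power_target power_elt.
Proof.
split.
- exact: gp_idem.
- exact: gp_orth.
- exact: gp_sum.
- exact: gp_loopl.
- exact: gp_loopr.
- exact: gp_nilp.
- exact: rk_inj.
- by move=> i u; apply: ar_lt; have /andP[] := valP u.
- move=> i u; have /andP[iu _] := valP u.
  by rewrite /power_elt mulrA gp_exp -mulrA gp_src.
- by move=> i u; have /andP[iu _] := valP u; rewrite /power_elt -mulrA gp_tgt.
- exact: gp_span.
- exact: gp_free.
Qed.

End Presentation.

(** * Representations of path algebras and the presentation of H *)

Section PathRepresentation.
Variables (K : fieldType) (Q : quiver) (F : lmodType K) (mul : F -> F -> F) (one : F).
Hypotheses (mull : forall b, linear (mul^~ b)) (mulr : forall a, linear (mul a)).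
Hypotheses (mulA : associative mul) (mul1l : left_id one mul) (mul1r : right_id one mul).
Variables (E : vertex Q -> F) (op : arrow Q -> F).
Hypotheses (EE : forall v, mul (E v) (E v) = E v).
Hypotheses (E0 : forall v w, v != w -> mul (E v) (E w) = 0).
Hypotheses (E1 : \sum_v E v = one).
Hypotheses (opl : forall a, mul (E (source a)) (op a) = op a).
Hypotheses (opr : forall a, mul (op a) (E (target a)) = op a).
Local Notation KQ := (path_algebra K Q).

Let mulL b : {linear F -> F} := HB.pack (mul^~ b) (GRing.isLinear.Build K F F _ (mul^~ b) (mull b)).
Let mulR a : {linear F -> F} := HB.pack (mul a) (GRing.isLinear.Build K F F _ (mul a) (mulr a)).

Let mul0l b : mul 0 b = 0. Proof. exact: (linear0 (mulL b)). Qed.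
Let mul0r a : mul a 0 = 0. Proof. exact: (linear0 (mulR a)). Qed.
Let mulZl k a b : mul (k *: a) b = k *: mul a b. Proof. exact: (linearZZ (mulL b)). Qed.
Let mulZr k a b : mul a (k *: b) = k *: mul a b. Proof. exact: (linearZZ (mulR a)). Qed.
Let mul_suml I (r : seq I) G b : mul (\sum_(i <- r) G i) b = \sum_(i <- r) mul (G i) b.
Proof. exact: (linear_sum (mulL b)). Qed.
Let mul_sumr I (r : seq I) G a : mul a (\sum_(i <- r) G i) = \sum_(i <- r) mul a (G i).
Proof. exact: (linear_sum (mulR a)). Qed.

(** The target F carries a bare bilinear product and no ring structure: it will be End(W) with
    composition in either order, where W may be zero. *)
Fixpoint walk_rep (v : vertex Q) (s : seq (arrow Q)) : F :=
  if s is a :: s' then mul (op a) (walk_rep (target a) s') else E v.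

Lemma walk_repl v s : composable v s -> mul (E v) (walk_rep v s) = walk_rep v s.
Proof. by case: s => [|a s] //= /andP[/eqP <- _]; rewrite mulA opl. Qed.

Lemma walk_rep_cat v s t : composable (walk_end v s) t ->
  walk_rep v (s ++ t) = mul (walk_rep v s) (walk_rep (walk_end v s) t).
Proof.
elim: s v => [|a s IH] v /= ct; first by rewrite walk_repl.
by rewrite IH // mulA.
Qed.

Lemma walk_repr v s : mul (walk_rep v s) (E (walk_end v s)) = walk_rep v s.
Proof. by have := @walk_rep_cat v s [::] isT; rewrite cats0. Qed.

Definition path_rep (p : qpath Q) : F := walk_rep (val p).1 (val p).2.

Lemma path_rep_mul p q :
  mul (path_rep p) (path_rep q) = oapp path_rep 0 (qcomp p q).
Proof.
have [epq|npq] := eqVneq (qend p) (qstart q).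
  have [r -> rE] := qcompE epq; rewrite /= /path_rep rE walk_rep_cat -/(qend p) epq //.
  exact: qpath_ok.
rewrite /qcomp (negPf npq) /= /path_rep -walk_repr -(walk_repl (qpath_ok q)).
rewrite mulA -[mul (mul _ _) (E _)]mulA E0 //.
by rewrite mul0r mul0l.
Qed.

Definition kq_rep (x : KQ) : F := \sum_(p <- msupp x) x@_p *: path_rep p.

Lemma kq_repw (S : {fset qpath Q}) (x : KQ) : (msupp x `<=` S)%fset ->
  kq_rep x = \sum_(p <- S) x@_p *: path_rep p.
Proof.
move=> xS; rewrite /kq_rep (big_fset_incl _ xS) // => p _ /mcoeff_outdom ->.
by rewrite scale0r.
Qed.

Lemma kq_rep_linear : linear kq_rep.
Proof.
move=> k x y; have le_x := fsubset_trans (msuppZ_le k x) (fsubsetUl (msupp x) (msupp y)).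
rewrite (kq_repw (fsubsetUl (msupp x) (msupp y))) (kq_repw (fsubsetUr (msupp x) (msupp y))).
rewrite (@kq_repw (msupp x `|` msupp y)%fset).
  rewrite scaler_sumr -big_split; apply: eq_bigr => p _ /=.
  by rewrite mcoeffD mcoeffZ scalerDl scalerA.
apply: fsubset_trans (msuppD_le _ _) _.
by rewrite fsubUset fsubsetUr andbT.
Qed.

Lemma kq_rep_basis p : kq_rep (kq_basis K p) = path_rep p.
Proof.
rewrite (@kq_repw [fset p]%fset) ?msuppU_le // big_seq_fset1 mcoeffUU.
by rewrite scale1r.
Qed.

Lemma kq_rep1 : kq_rep 1 = one.
Proof.
pose r : {linear KQ -> F} := HB.pack kq_rep (GRing.isLinear.Build K KQ F _ kq_rep kq_rep_linear).
rewrite -E1 -[LHS]/(r (\sum_(v : vertex Q) kq_basis K (vertex_path v))) linear_sum.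
by apply: eq_bigr => v _; rewrite [LHS]kq_rep_basis.
Qed.

Lemma kq_repM x y : kq_rep (x * y) = mul (kq_rep x) (kq_rep y).
Proof.
pose r : {linear KQ -> F} := HB.pack kq_rep (GRing.isLinear.Build K KQ F _ kq_rep kq_rep_linear).
have rE z : r z = kq_rep z by [].
rewrite -rE -[x * y]/(kq_mul x y) linear_sum [in RHS]/kq_rep.
rewrite mul_suml; apply: eq_bigr => p _; rewrite linear_sum mulZl mul_sumr scaler_sumr.
apply: eq_bigr => q _; rewrite linearZ /= mulZr scalerA; congr (_ *: _).
rewrite [RHS]path_rep_mul; case: (qcomp p q) => [u|] /=; first exact: kq_rep_basis.
by rewrite -rE linear0.
Qed.

End PathRepresentation.

Section RegularAction.
Variables (K : fieldType) (A : falgType K) (n : nat) (ar : rel 'I_n) (f : 'I_n -> 'I_n -> nat).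
Variables (d : 'I_n -> nat) (e x : 'I_n -> A) (al : 'I_n -> 'I_n -> A).
Hypotheses (ee : forall i, e i * e i = e i) (eo : forall i j, i != j -> e i * e j = 0).
Hypotheses (e1 : \sum_i e i = 1) (ex : forall i, e i * x i = x i) (xe : forall i, x i * e i = x i).
Hypotheses (xn : forall i, x i ^+ d i = 0) (ea : forall i j, ar i j -> e i * al i j = al i j).
Hypotheses (ae : forall i j, ar i j -> al i j * e j = al i j).
Hypothesis xa : forall i j, ar i j -> x i ^+ f j i * al i j = al i j * x j ^+ f i j.

Lemma regular_gls_action :
  @gls_action K n ar f d A (fun i v => v * e i) (fun i v => v * x i) (fun i j v => v * al i j).
Proof.
split.
- by move=> i k u v; rewrite mulrDl scalerAl.
- by move=> i k u v; rewrite mulrDl scalerAl.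
- by move=> i j k u v; rewrite mulrDl scalerAl.
- by move=> i v; rewrite -mulrA ee.
- by move=> i j v ij; rewrite -mulrA eo ?mulr0.
- by move=> v; rewrite -mulr_sumr e1 mulr1.
- by move=> i v; rewrite -mulrA ex.
- by move=> i v; rewrite -mulrA xe.
- by move=> i v; rewrite iter_rmul xn mulr0.
- by move=> i j v ij; rewrite -mulrA ea.
- by move=> i j v ij; rewrite -mulrA ae.
- by move=> i j v ij; rewrite !iter_rmul -!mulrA xa.
Qed.

Lemma opp_exp (a : A) k : (a : A^c) ^+ k = a ^+ k.
Proof. by elim: k => // k IH; rewrite exprSr exprS IH. Qed.

Lemma opp_gen (V : {vspace A^c}) :
  (forall S : {vspace A}, (forall a b, a \in S -> b \in S -> a * b \in S) ->
    (forall i, e i \in S) -> (forall i, x i \in S) ->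
    (forall i j, ar i j -> al i j \in S) -> S = fullv) ->
  (forall a b : A^c, a \in V -> b \in V -> a * b \in V) ->
  (forall i, (e i : A^c) \in V) -> (forall i, (x i : A^c) \in V) ->
  (forall i j, ar j i -> (al j i : A^c) \in V) -> V = fullv.
Proof.
move=> gen VM Ve Vx Va; apply: (gen V) => // [a b aV bV|i j ij]; first exact: (VM b a).
exact: Va.
Qed.

Lemma regular_gen (V : {vspace A}) :
  (forall S : {vspace A}, (forall a b, a \in S -> b \in S -> a * b \in S) ->
    (forall i, e i \in S) -> (forall i, x i \in S) ->
    (forall i j, ar i j -> al i j \in S) -> S = fullv) ->
  1 \in V -> (forall v i, v \in V -> v * e i \in V) ->
  (forall v i, v \in V -> v * x i \in V) ->
  (forall v i j, ar i j -> v \in V -> v * al i j \in V) -> V = fullv.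
Proof.
move=> gen V1 Ve Vx Va; pose P a := forall v, v \in V -> v * a \in V.
have [||S SP] := @vspace_exists K A P.
- by move=> v _; rewrite mulr0 mem0v.
- by move=> k a b Pa Pb v vV; rewrite mulrDr -scalerAr memvD ?memvZ ?Pa ?Pb.
have S1 : S = fullv.
  apply: gen => [a b /SP Pa /SP Pb|i|i|i j ij]; apply/SP => v vV.
  + by rewrite mulrA Pb ?Pa.
  + exact: Ve.
  + exact: Vx.
  + exact: Va.
apply/eqP; rewrite eqEsubv subvf; apply/subvP=> a _.
have /SP/(_ 1 V1) : a \in S by rewrite S1 memvf.
by rewrite mul1r.
Qed.

End RegularAction.

Section OppositeAction.
Variables (K : fieldType) (A : falgType K) (n : nat) (ar : rel 'I_n) (f : 'I_n -> 'I_n -> nat).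
Variables (d : 'I_n -> nat) (e x : 'I_n -> A) (al : 'I_n -> 'I_n -> A).
Hypotheses (ee : forall i, e i * e i = e i) (eo : forall i j, i != j -> e i * e j = 0).
Hypotheses (e1 : \sum_i e i = 1) (ex : forall i, e i * x i = x i) (xe : forall i, x i * e i = x i).
Hypotheses (xn : forall i, x i ^+ d i = 0) (ea : forall i j, ar i j -> e i * al i j = al i j).
Hypotheses (ae : forall i j, ar i j -> al i j * e j = al i j).
Hypothesis xa : forall i j, ar i j -> x i ^+ f j i * al i j = al i j * x j ^+ f i j.

Lemma regular_gls_action_opp : @gls_action K n (fun i j => ar j i) f d A^c
  (fun i v => v * (e i : A^c)) (fun i v => v * (x i : A^c)) (fun i j v => v * (al j i : A^c)).
Proof.
refine (@regular_gls_action K A^c n (fun i j => ar j i) f d e x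
    (fun i j => al j i) ee _ e1 xe ex _ _ _ _).
- by move=> i j ij; apply: eo; rewrite eq_sym.
- by move=> i; rewrite opp_exp.
- by move=> i j; apply: ae.
- by move=> i j; apply: ea.
- by move=> i j ji; rewrite (opp_exp (x i)) (opp_exp (x j)); apply/esym/xa.
Qed.

End OppositeAction.

Section GlsAlgebra.
Variables (R : realFieldType) (n : nat) (Phi : root_system R n) (alpha : 'I_n -> 'cV[R]_n).
Variables (c : 'M[R]_n) (C : 'M[int]_n) (d : 'I_n -> nat) (K : fieldType) (H : falgType K).
Local Notation Q := (gls_quiver Phi alpha c).
Local Notation KQ := (path_algebra K Q).
Local Notation ar := (coxeter_arrow Phi alpha c).
Local Notation f := (fun i j => `|C i j|%N).
Variable pi : {rmorphism KQ -> H}.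
Hypotheses (pi_scale : scalable pi) (pi_surj : forall a, exists x, pi x = a).
Hypothesis pi_ker : forall x, pi x = 0 <-> ideal_generated (gls_relation C d) x.

Let piP k x y : pi (k *: x + y) = k *: pi x + pi y.
Proof. by rewrite rmorphD pi_scale. Qed.

Definition gls_e (i : 'I_n) : H := pi (kq_basis K (vertex_path (i : vertex Q))).
Definition gls_x (i : 'I_n) : H := pi (gls_loop Phi alpha K c i).
(** Extended by 0 to pairs without an arrow, so that the family is indexed by all pairs and carries
    no proofs. *)
Definition gls_a (i j : 'I_n) : H :=
  if (insub (i, j) : option {u : 'I_n * 'I_n | ar u.1 u.2}) is Some u then pi (kq_basis K (arrow_path (inr u : arrow Q))) else 0.

Lemma gls_aE i j (h : ar i j) : gls_a i j = pi (gls_arrow K h).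
Proof.
rewrite /gls_a; case: insubP => [u _ uE|/negP[]//]; rewrite /gls_arrow.
by rewrite (_ : u = exist _ (i, j) h) //; apply: val_inj.
Qed.

Section Representation.
Variables (F : lmodType K) (mul : F -> F -> F) (one : F).
Hypotheses (mull : forall b, linear (mul^~ b)) (mulr : forall a, linear (mul a)).
Hypotheses (mulA : associative mul) (mul1l : left_id one mul) (mul1r : right_id one mul).
Variables (E X : 'I_n -> F) (L : 'I_n -> 'I_n -> F).
Hypotheses (EE : forall v, mul (E v) (E v) = E v).
Hypotheses (E0 : forall v w, v != w -> mul (E v) (E w) = 0).
Hypotheses (E1 : \sum_v E v = one).
Hypotheses (EX : forall i, mul (E i) (X i) = X i) (XE : forall i, mul (X i) (E i) = X i).
Hypotheses (EL : forall i j, ar i j -> mul (E i) (L i j) = L i j).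
Hypotheses (LE : forall i j, ar i j -> mul (L i j) (E j) = L i j).
Hypothesis nilX : forall i, iter (d i) (mul (X i)) one = 0.
Hypothesis commX : forall i j, ar i j -> mul (iter (f j i) (mul (X i)) one) (L i j)
  = mul (L i j) (iter (f i j) (mul (X j)) one).

Lemma gls_rep : exists rho : H -> F,
  [/\ linear rho, rho 1 = one & forall a b, rho (a * b) = mul (rho a) (rho b)] /\
  [/\ forall i, rho (gls_e i) = E i, forall i, rho (gls_x i) = X i
    & forall i j, ar i j -> rho (gls_a i j) = L i j].
Proof.
pose op (a : arrow Q) : F := match a with inl i => X i | inr u => L (val u).1 (val u).2 end.
have opl a : mul (E (@source Q a)) (op a) = op a.
  by case: a => [i|[[i j] ij]] /=; [exact: EX|exact: EL].
have opr a : mul (op a) (E (@target Q a)) = op a.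
  by case: a => [i|[[i j] ij]] /=; [exact: XE|exact: LE].
pose r : KQ -> F := kq_rep mul (E : vertex Q -> F) op.
have rlin : linear r := kq_rep_linear mul (E : vertex Q -> F) op.
have r1 : r 1 = one := kq_rep1 mul op E1.
have rM x y : r (x * y) = mul (r x) (r y) := kq_repM mull mulr mulA (E := E : vertex Q -> F) EE E0 opl x y.
have rB x y : r (x - y) = r x - r y.
  by rewrite (_ : x - y = (-1) *: y + x) ?rlin ?scaleN1r addrC.
have r0 : r 0 = 0 by rewrite -(subrr 0) rB subrr.
have rD x y : r (x + y) = r x + r y by rewrite -[x]scale1r rlin !scale1r.
pose mulL b : {linear F -> F} := HB.pack (mul^~ b) (GRing.isLinear.Build K F F _ (mul^~ b) (mull b)).
pose mulR a : {linear F -> F} := HB.pack (mul a) (GRing.isLinear.Build K F F _ (mul a) (mulr a)).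
have rv i : r (kq_basis K (vertex_path i)) = E i by exact: kq_rep_basis.
have ra a : r (kq_basis K (arrow_path a)) = op a.
  by rewrite [LHS]kq_rep_basis /path_rep /= opr.
clearbody r.
have rX x k : r (x ^+ k) = iter k (mul (r x)) one.
  by elim: k => [|k IH]; rewrite ?expr0 // exprS rM IH.
have rJ x : ideal_generated (gls_relation C d) x -> r x = 0.
  move=> /(_ (fun y => r y = 0)); apply; first split.
  - exact: r0.
  - by move=> y z y0 z0; rewrite rD y0 z0 addr0.
  - move=> y z w z0; rewrite !rM z0 (_ : mul (r y) 0 = 0); last exact: (linear0 (mulR _)).
    exact: (linear0 (mulL _)).
  move=> s [i|i j h]; first by rewrite rX ra nilX.
  have rl k m : r (gls_loop Phi alpha K c k ^+ m) = iter m (mul (X k)) one.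
    by rewrite rX ra.
  have rh : r (gls_arrow K h) = L i j by exact: ra.
  apply: etrans (rB _ _) _; apply/eqP; rewrite subr_eq0; apply/eqP.
  apply: etrans (rM _ _) _; apply: etrans _ (esym (rM _ _)).
  apply: etrans (congr2 mul (rl _ _) rh) _; apply: etrans _ (esym (congr2 mul rh (rl _ _))).
  exact: commX.
have [s sP] := choice pi_surj.
have rsE x : r (s (pi x)) = r x.
  apply/eqP; rewrite -subr_eq0 -rB; apply/eqP/rJ/pi_ker.
  by rewrite rmorphB sP subrr.
exists (r \o s); split; split.
- move=> k a b; rewrite -(sP a) -(sP b) -piP /= !rsE; exact: rlin.
- by rewrite -(rmorph1 pi) /= rsE.
- by move=> a b; rewrite -(sP a) -(sP b) -rmorphM /= !rsE rM.
- by move=> i; rewrite /= rsE rv.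
- by move=> i; rewrite /= rsE ra.
- by move=> i j h; rewrite (gls_aE h) /= rsE ra.
Qed.

End Representation.

Lemma gls_gen (V : {vspace H}) : (forall a b, a \in V -> b \in V -> a * b \in V) ->
  (forall i, gls_e i \in V) -> (forall i, gls_x i \in V) ->
  (forall i j, ar i j -> gls_a i j \in V) -> V = fullv.
Proof.
move=> VM Ve Vx Va; apply/eqP; rewrite eqEsubv subvf; apply/subvP=> a _.
have [y <-] := pi_surj a; rewrite (kq_expand y) rmorph_sum memv_suml // => p _.
rewrite pi_scale memvZ //.
have Vop (b : arrow Q) : pi (kq_basis K (arrow_path b)) \in V.
  case: b => [i|[[i j] ij]]; first exact: Vx.
  by have := Va i j ij; rewrite (gls_aE ij).
case: p => [[v s] /= ok].
elim: s v ok => [|b s IH] v ok.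
  by rewrite (_ : @QPath Q (v, [::]) ok = vertex_path v) ?Ve //; apply: val_inj.
have /andP[/eqP bv] := ok; rewrite -/(composable (target b) s) => ok'.
have -> : kq_basis K (@QPath Q (v, b :: s) ok) = kq_basis K (arrow_path b) * kq_basis K (@QPath Q (target b, s) ok').
  rewrite [RHS]kq_mulBB; have [|r -> rE] := @qcompE Q (arrow_path b) (@QPath Q (target b, s) ok'); first by [].
  by congr kq_basis; apply: val_inj; rewrite rE; congr pair; exact: esym bv.
by rewrite rmorphM; apply: VM; [exact: Vop|exact: IH].
Qed.

Lemma gls_relations : [/\ forall i, gls_e i * gls_e i = gls_e i,
    forall i j, i != j -> gls_e i * gls_e j = 0 & \sum_i gls_e i = 1] /\
  [/\ forall i, gls_e i * gls_x i = gls_x i, forall i, gls_x i * gls_e i = gls_x i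
    & forall i, gls_x i ^+ d i = 0] /\
  [/\ forall i j, ar i j -> gls_e i * gls_a i j = gls_a i j,
      forall i j, ar i j -> gls_a i j * gls_e j = gls_a i j
    & forall i j, ar i j -> gls_x i ^+ f j i * gls_a i j = gls_a i j * gls_x j ^+ f i j].
Proof.
have bM p q : pi (kq_basis K p) * pi (kq_basis K q) = pi (kq_opt K (qcomp p q)).
  by rewrite -rmorphM [X in pi X]kq_mulBB.
have src (b : arrow Q) : gls_e (@source Q b) * pi (kq_basis K (arrow_path b)) = pi (kq_basis K (arrow_path b)).
  by rewrite bM qcomp_vl eqxx.
have tgt (b : arrow Q) : pi (kq_basis K (arrow_path b)) * gls_e (@target Q b) = pi (kq_basis K (arrow_path b)).
  by rewrite bM qcomp_vr eqxx.
have rel s : gls_relation C d s -> pi s = 0.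
  by move=> Ss; apply/pi_ker => J _; apply.
split; [|split]; split.
- by move=> i; rewrite bM qcomp_vl eqxx.
- by move=> i j ij; rewrite bM qcomp_vl (negPf ij) rmorph0.
- by rewrite -(rmorph1 pi) -rmorph_sum.
- by move=> i; apply: (src (inl i)).
- by move=> i; apply: (tgt (inl i)).
- by move=> i; rewrite -rmorphXn rel //; left.
- by move=> i j ij; rewrite (gls_aE ij); apply: (src (inr (exist _ (i, j) ij))).
- by move=> i j ij; rewrite (gls_aE ij); apply: (tgt (inr (exist _ (i, j) ij))).
- move=> i j ij.
  move: (gls_a i j) (gls_aE ij) => a ->.
  have xM k m z : gls_x k ^+ m * pi z = pi (gls_loop Phi alpha K c k ^+ m * z).
    by rewrite rmorphM rmorphXn.
  have Mx k m z : pi z * gls_x k ^+ m = pi (z * gls_loop Phi alpha K c k ^+ m).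
    by rewrite rmorphM rmorphXn.
  have := rel _ (@gls_commutation _ _ _ _ K c C d i j ij); rewrite rmorphB => /eqP; rewrite subr_eq0 => /eqP E.
  exact: etrans (xM _ _ _) (etrans E (esym (Mx _ _ _))).
Qed.

Lemma gls_action_lfun (r : rel 'I_n) (W : vectType K) (E X : 'I_n -> W -> W) (L : 'I_n -> 'I_n -> W -> W) :
  gls_action r f d E X L -> exists E' X' : 'I_n -> 'End(W), exists L' : 'I_n -> 'I_n -> 'End(W),
  [/\ forall i v, E' i v = E i v, forall i v, X' i v = X i v & forall i j v, L' i j v = L i j v].
Proof.
move=> ga; have [E' E'E] := choice (fun i => lfun_exists (ga_linE ga i)).
have [X' X'E] := choice (fun i => lfun_exists (ga_linX ga i)).
have [L' L'E] := choice (fun p : 'I_n * 'I_n => lfun_exists (ga_linL ga p.1 p.2)).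
by exists E', X', (fun i j => L' (i, j)); split=> // i j v; rewrite L'E.
Qed.

(** In a right action the left factor acts first, so End(W) is taken with the product [h \o g] of g
    and h. *)
Lemma gls_presentation_right : gls_presentation ar f d gls_e gls_x gls_a.
Proof.
have [[ee eo e1] [[ex xe xn] [ea ae xa]]] := gls_relations.
split; [exact: regular_gls_action|by move=> V; apply: regular_gen; apply: gls_gen|].
move=> W E X L ga; have [E' [X' [L' [E'E X'E L'E]]]] := gls_action_lfun ga.
pose mul (g h : 'End(W)) := (h \o g)%VF.
have mulE g h v : mul g h v = h (g v) by rewrite comp_lfunE.
have iterE i k v : iter k (mul (X' i)) \1%VF v = iter k (X i) v.
  elim: k v => [|k IH] v; first by rewrite id_lfunE.
  by rewrite [in RHS]iterSr /= mulE X'E IH.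
have [||||||||||||rho [[rl r1 rM] [re rx ra]]] := @gls_rep 'End(W) mul \1%VF _ _ _ E' X' L'.
- by move=> h k g g'; rewrite /mul comp_lfunDr comp_lfunZr.
- by move=> h k g g'; rewrite /mul comp_lfunDl comp_lfunZl.
- by move=> g h k; rewrite /mul comp_lfunA.
- by move=> i; apply/lfunP=> v; rewrite mulE !E'E (ga_idem ga).
- by move=> i j ij; apply/lfunP=> v; rewrite mulE !E'E (ga_orth ga) // zero_lfunE.
- apply/lfunP=> v; rewrite sum_lfunE id_lfunE -[RHS](ga_sum ga).
  by apply: eq_bigr => i _; rewrite E'E.
- by move=> i; apply/lfunP=> v; rewrite mulE X'E E'E (ga_loopl ga).
- by move=> i; apply/lfunP=> v; rewrite mulE X'E E'E (ga_loopr ga).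
- by move=> i j ij; apply/lfunP=> v; rewrite mulE E'E !L'E (ga_src ga).
- by move=> i j ij; apply/lfunP=> v; rewrite mulE E'E !L'E (ga_tgt ga).
- by move=> i; apply/lfunP=> v; rewrite iterE (ga_nilp ga) zero_lfunE.
- by move=> i j ij; apply/lfunP=> v; rewrite !mulE !iterE !L'E (ga_comm ga).
exists (fun v a => rho a v); split; split.
- by move=> a k v w; rewrite linearP.
- by move=> v k a b; rewrite rl add_lfunE scale_lfunE.
- by move=> v; rewrite r1 id_lfunE.
- by move=> v a b; rewrite rM mulE.
- by move=> i v; rewrite re E'E.
- by move=> i v; rewrite rx X'E.
- by move=> i j v ij; rewrite ra // L'E.
Qed.

(** A right action of the opposite algebra multiplies operators in the order of composition, and the
    roles of source and target are exchanged. *)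
Lemma gls_presentation_left :
  @gls_presentation K n (fun i j => ar j i) f d H^c gls_e gls_x (fun i j => gls_a j i).
Proof.
have [[ee eo e1] [[ex xe xn] [ea ae xa]]] := gls_relations.
split.
- exact: regular_gls_action_opp.
- move=> V; apply: regular_gen => S; apply: opp_gen.
  exact: gls_gen.
move=> W E X L ga; have [E' [X' [L' [E'E X'E L'E]]]] := gls_action_lfun ga.
have iterE i k v : iter k (comp_lfun (X' i)) \1%VF v = iter k (X i) v.
  elim: k v => [|k IH] v; first by rewrite id_lfunE.
  by rewrite /= comp_lfunE X'E IH.
have [||||||||||||rho [[rl r1 rM] [re rx ra]]] :=
    @gls_rep 'End(W) (@comp_lfun _ _ _ _) \1%VF _ _ _ E' X' (fun i j => L' j i).
- by move=> h k g g'; rewrite comp_lfunDl comp_lfunZl.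
- by move=> h k g g'; rewrite comp_lfunDr comp_lfunZr.
- by move=> g h k; rewrite comp_lfunA.
- by move=> i; apply/lfunP=> v; rewrite comp_lfunE !E'E (ga_idem ga).
- by move=> i j ij; apply/lfunP=> v; rewrite comp_lfunE !E'E (ga_orth ga) 1?eq_sym // zero_lfunE.
- apply/lfunP=> v; rewrite sum_lfunE id_lfunE -[RHS](ga_sum ga).
  by apply: eq_bigr => i _; rewrite E'E.
- by move=> i; apply/lfunP=> v; rewrite comp_lfunE X'E E'E (ga_loopr ga).
- by move=> i; apply/lfunP=> v; rewrite comp_lfunE X'E E'E (ga_loopl ga).
- by move=> i j ij; apply/lfunP=> v; rewrite comp_lfunE E'E !L'E (ga_tgt ga).
- by move=> i j ij; apply/lfunP=> v; rewrite comp_lfunE E'E !L'E (ga_src ga).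
- by move=> i; apply/lfunP=> v; rewrite iterE (ga_nilp ga) zero_lfunE.
- by move=> i j ij; apply/lfunP=> v; rewrite !comp_lfunE !iterE !L'E (ga_comm ga).
exists (fun v a => rho a v); split; split.
- by move=> a k v w; rewrite linearP.
- by move=> v k a b; rewrite rl add_lfunE scale_lfunE.
- by move=> v; rewrite r1 id_lfunE.
- by move=> v a b; rewrite -comp_lfunE -rM.
- by move=> i v; rewrite re E'E.
- by move=> i v; rewrite rx X'E.
- by move=> i j v ij; rewrite ra // L'E.
Qed.

End GlsAlgebra.

(** * Root systems *)

Section RootSystemBase.
Variables (R : realFieldType) (n : nat) (Phi : root_system R n) (alpha : 'I_n -> 'cV[R]_n).
Hypothesis halpha : is_base Phi alpha.
Local Notation G := (gram Phi).
Local Notation s := (simple_reflection Phi alpha).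
Local Notation ip := (bilin G).
Implicit Types x y z : 'cV[R]_n.

Lemma bilinC x y : ip x y = ip y x.
Proof.
have E : (x^T *m G *m y)^T = y^T *m G *m x by rewrite !trmx_mul trmxK gram_sym mulmxA.
by rewrite /bilin -E [RHS]mxE.
Qed.

Lemma bilinBr x y z : ip x (y - z) = ip x y - ip x z.
Proof. by rewrite /bilin mulmxBr mxE [X in _ + X]mxE. Qed.

Lemma bilinZr k x y : ip x (k *: y) = k * ip x y.
Proof. by rewrite /bilin -scalemxAr mxE. Qed.

Lemma bilin_sumr (I : finType) (F : I -> 'cV[R]_n) x : ip x (\sum_i F i) = \sum_i ip x (F i).
Proof. by rewrite /bilin mulmx_sumr summxE. Qed.

Lemma simple_neq0 i : alpha i != 0.
Proof.
have [ar _ _] := halpha; apply: contraNneq (roots_neq0 Phi) => a0.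
by rewrite -a0 ar.
Qed.

Lemma simple_pos i : 0 < ip (alpha i) (alpha i).
Proof. exact/gram_pos/simple_neq0. Qed.

Lemma reflE i x : s i *m x = x - (2 / ip (alpha i) (alpha i) * ip (alpha i) x) *: alpha i.
Proof.
rewrite /simple_reflection /reflection mulmxBl mul1mx -scalemxAl -scalerA; congr (_ - _ *: _).
rewrite -!mulmxA; apply/colP=> r; rewrite !mxE big_ord1.
by rewrite /bilin -!mulmxA [RHS]mulrC.
Qed.

Lemma simple_coord : exists la : 'I_n -> 'cV[R]_n -> R,
  [/\ forall i k x y, la i (k *: x + y) = k * la i x + la i y,
      forall i j, la i (alpha j) = (i == j)%:R & forall x, x = \sum_i la i x *: alpha i].
Proof.
have [_ ba _] := halpha; pose b := [tuple alpha i | i < n].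
have bE : b = codom alpha :> seq _ by rewrite codomE.
rewrite -bE in ba; have bi (i : 'I_n) : b`_i = alpha i by rewrite -tnth_nth tnth_mktuple.
exists (coord b); split.
- by move=> i k x y; rewrite linearP.
- by move=> i j; rewrite -bi coord_free ?(basis_free ba) // eq_sym.
- move=> x; rewrite {1}(coord_basis ba (memvf x)).
  by apply: eq_bigr => i _; rewrite bi.
Qed.

Lemma commuting_reflections i j : ip (alpha i) (alpha j) = 0 -> s i *m s j = s j *m s i.
Proof.
move=> ij0; have ji0 : ip (alpha j) (alpha i) = 0 by rewrite bilinC.
suff H x : s i *m s j *m x = s j *m s i *m x.
  by apply/row_matrixP => r; apply/rowP=> k; have /colP/(_ r) := H (delta_mx k 0); rewrite -!colE !mxE.
rewrite -!mulmxA !reflE !bilinBr !bilinZr ij0 ji0 !mulr0 !subr0.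
by rewrite -!addrA [X in _ + X]addrC.
Qed.

Lemma prod_cat (p q : seq 'I_n) : \big[mulmx/1%:M]_(i <- p ++ q) s i =
  \big[mulmx/1%:M]_(i <- p) s i *m \big[mulmx/1%:M]_(i <- q) s i.
Proof.
by elim: p => [|i p IH]; rewrite ?big_nil ?mul1mx // !big_cons IH mulmxA.
Qed.

Section Expression.
Variables (w : seq 'I_n) (uw : uniq w).

Lemma prod_coord (la : 'I_n -> 'cV[R]_n -> R) (p : seq 'I_n) r x :
  (forall i k x y, la i (k *: x + y) = k * la i x + la i y) ->
  (forall i j, la i (alpha j) = (i == j)%:R) -> r \notin p ->
  la r (\big[mulmx/1%:M]_(i <- p) s i *m x) = la r x.
Proof.
move=> lin dual; elim: p => [|i p IH]; first by rewrite big_nil mul1mx.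
rewrite inE negb_or big_cons => /andP[ri rp]; rewrite -mulmxA reflE.
by rewrite addrC -scaleNr lin dual (negPf ri) mulr0 add0r IH.
Qed.

Lemma prod_suffix j k x (p q : seq 'I_n) : w = p ++ q ->
  \big[mulmx/1%:M]_(i <- w) s i *m x = x - k *: alpha j -> (j \in w) ->
  \big[mulmx/1%:M]_(i <- q) s i *m x = x - (k * (j \in q)%:R) *: alpha j.
Proof.
move=> wE wx jw; have [la [lin dual expand]] := simple_coord.
rewrite [LHS]expand [RHS]expand; apply: eq_bigr => r _; congr (_ *: _).
have laB y u v : la r (y - (u * v) *: alpha j) = la r y - u * v * (r == j)%:R.
  by rewrite addrC -scaleNr lin dual mulNr addrC.
have laB1 y u : la r (y - u *: alpha j) = la r y - u * (r == j)%:R.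
  by rewrite addrC -scaleNr lin dual mulNr addrC.
have [rq|rq] := boolP (r \in q); last first.
  rewrite (prod_coord x lin dual rq) laB; case: eqP => [rj|_]; last by rewrite mulr0 subr0.
  by rewrite -rj (negPf rq) mulr0 mul0r subr0.
have rp : r \notin p.
  by move: uw; rewrite wE cat_uniq => /and3P[_ /hasPn/(_ r rq)].
have := congr1 (la r) wx; rewrite wE prod_cat -mulmxA (prod_coord _ lin dual rp) => ->.
rewrite laB1 laB; case: eqP => [rj|_]; last by rewrite !mulr0.
by rewrite -rj rq !mulr1.
Qed.

(** Cut w just before and just after i. If i differs from j or k = 0, the two suffixes act on x in
    the same way, so s_i fixes the common value x - k [j after i] alpha_j, which is therefore
    orthogonal to alpha_i. *)
Lemma prod_pairing i j k x : \big[mulmx/1%:M]_(i <- w) s i *m x = x - k *: alpha j ->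
  i \in w -> j \in w -> (i != j) || (k == 0) ->
  ip (alpha i) x = k * (index i w < index j w)%:R * ip (alpha i) (alpha j).
Proof.
move=> wx iw jw ijk; have wE := cat_take_drop (index i w) w.
rewrite (drop_nth i) ?index_mem // nth_index // in wE.
set p := take _ _ in wE; set q := drop _ _ in wE.
have jq : i != j -> (j \in q) = (index i w < index j w)%N.
  move=> ij; move: uw; rewrite -wE cat_uniq /= negb_or => /and4P[up /andP[np _] iq uq].
  rewrite !index_cat (negPf np) /= eqxx addn0.
  move: jw; rewrite -{1}wE mem_cat inE eq_sym (negPf ij) /=.
  have [jp|jp] := boolP (j \in p); rewrite /= ?orbF => jq'.
    have /hasPn/(_ j) : ~~ has (mem p) q by move: (uw); rewrite -wE cat_uniq /= negb_or => /and3P[_ /andP[]].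
    rewrite ltnNge ltnW ?index_mem //= => H; apply/negP=> /H; by rewrite /= jp.
  by rewrite jq' addnS ltnS leq_addr.
have w1 : w = rcons p i ++ q by rewrite cat_rcons wE.
have q1 := prod_suffix w1 wx jw; have q2 := prod_suffix (esym wE) wx jw.
move: q2; rewrite big_cons -mulmxA q1 reflE => /eqP.
rewrite -subr_eq0 => /eqP H; move: H.
have -> : (j \in i :: q) = (j \in q) || (i == j) by rewrite inE orbC eq_sym.
set a := 2 / _; have a0 : a != 0 by rewrite mulf_neq0 ?invr_neq0 ?pnatr_eq0 // gt_eqF ?simple_pos.
move=> H; have {H} H : (a * ip (alpha i) (x - (k * (j \in q)%:R) *: alpha j)) *: alpha i = 0.
  case/orP: ijk => [ij|/eqP k0].
    by move: H; rewrite (negPf ij) orbF addrAC subrr add0r => /eqP; rewrite oppr_eq0 => /eqP.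
  by move: H; rewrite k0 !mul0r scale0r !subr0 addrAC subrr add0r => /eqP; rewrite oppr_eq0 => /eqP.
move/eqP: H; rewrite scaler_eq0 (negPf (simple_neq0 i)) orbF mulf_eq0 (negPf a0) /=.
rewrite bilinBr bilinZr subr_eq0 => /eqP ->.
by case/orP: ijk => [ij|/eqP ->]; [rewrite jq|rewrite !mul0r].
Qed.

End Expression.

Lemma coxeter_order (c : 'M[R]_n) w w' i j : coxeter_expression Phi alpha c w ->
  coxeter_expression Phi alpha c w' -> s i *m s j != s j *m s i ->
  (index i w < index j w)%N = (index i w' < index j w')%N.
Proof.
move=> /andP[pw /eqP cw] /andP[pw' /eqP cw'] ncomm.
have ij : i != j by apply: contraNneq ncomm => ->.
have G0 : ip (alpha i) (alpha j) != 0.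
  by apply: contraNneq ncomm => /commuting_reflections ->.
have uw : uniq w by rewrite (perm_uniq pw) enum_uniq.
have uw' : uniq w' by rewrite (perm_uniq pw') enum_uniq.
have mw r : r \in w by rewrite (perm_mem pw) mem_enum.
have mw' r : r \in w' by rewrite (perm_mem pw') mem_enum.
have [la [_ _ expand]] := simple_coord.
(* A vector fixed by c is orthogonal to all simple roots, by [prod_pairing] with k = 0, and hence
   zero. *)
have c1 : 1%:M - c \in unitmx.
  rewrite -unitmx_tr -row_free_unit -kermx_eq0; apply/eqP/row_matrixP => r.
  rewrite row0; set u := row r _; have ku : u *m (1%:M - c)^T = 0.
    by apply/eqP; rewrite -sub_kermx row_sub.
  have cu : (1%:M - c) *m u^T = 0 by rewrite -[LHS]trmxK trmx_mul trmxK ku trmx0.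
  have cx : c *m u^T = u^T - 0 *: alpha i.
    by move/eqP: cu; rewrite mulmxBl mul1mx subr_eq0 scale0r subr0 => /eqP.
  rewrite cw in cx.
  have u0 r' : ip (alpha r') (u^T) = 0.
    by rewrite (prod_pairing uw cx (mw r') (mw i)) ?eqxx ?orbT // !mul0r.
  have : ip (u^T) (u^T) = 0.
    rewrite {2}[u^T]expand bilin_sumr big1 // => r' _.
    by rewrite bilinZr bilinC u0 mulr0.
  move=> uu; apply/eqP; apply: contraT => un.
  have /(gram_pos Phi) : u^T != 0 by apply: contraNneq un => uT; rewrite -[u]trmxK uT trmx0.
  by rewrite uu ltxx.
(* This vector is determined by c and j alone, so both expressions must read the same order off
   it. *)
pose x := invmx (1%:M - c) *m alpha j.
have cx : c *m x = x - 1 *: alpha j.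
  have : (1%:M - c) *m x = alpha j by rewrite mulmxA mulmxV // mul1mx.
  by rewrite mulmxBl mul1mx scale1r => <-; rewrite opprB addrC subrK.
have cx' := cx; rewrite cw in cx; rewrite cw' in cx'.
have := prod_pairing uw' cx' (mw' i) (mw' j); rewrite (prod_pairing uw cx (mw i) (mw j)) ?ij //.
move=> /(_ isT) /(mulIf G0); rewrite !mul1r.
by move/eqP; rewrite eqr_nat; do 2 case: (_ < _)%N.
Qed.

End RootSystemBase.

(** * Cartan integers and symmetrizers *)

Section CartanNumbers.
Variables (R : realFieldType) (n : nat) (Phi : root_system R n) (alpha : 'I_n -> 'cV[R]_n).
Hypothesis halpha : is_base Phi alpha.
Variables (C : 'M[int]_n) (hC : is_cartan_matrix Phi alpha C).
Variables (d : 'I_n -> nat) (hd : is_symmetrizer C d).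
Local Notation s := (simple_reflection Phi alpha).
Local Notation ip := (bilin (gram Phi)).

Lemma strict_cauchy_schwarz i j : i != j ->
  ip (alpha i) (alpha j) ^+ 2 < ip (alpha i) (alpha i) * ip (alpha j) (alpha j).
Proof.
move=> ij; have [la [lin dual _]] := simple_coord halpha.
set a := ip (alpha i) (alpha i); set b := ip (alpha j) (alpha j); set g := ip (alpha i) (alpha j).
have b0 : 0 < b := simple_pos halpha j.
(* Up to the factor b this is the component of alpha_i orthogonal to alpha_j; its squared norm is b
   (a b - g^2). *)
pose v := b *: alpha i - g *: alpha j.
have v0 : v != 0.
  apply: contraTneq b0 => v0; have := congr1 (la i) v0.
  rewrite /v -scaleNr lin dual eqxx mulr1 -[_ *: _]addr0 lin dual (negPf ij) mulr0 add0r.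
  have -> : la i 0 = 0.
    by have := lin i 1 0 0; rewrite scaler0 addr0 mul1r => /eqP; rewrite -subr_eq0 opprD addNKr oppr_eq0 => /eqP.
  by rewrite addr0 => ->; rewrite ltxx.
have := gram_pos Phi v0; rewrite {2}/v bilinBr !bilinZr bilinC [ip v (alpha j)]bilinC.
rewrite /v !bilinBr !bilinZr -/a -/b -/g [ip (alpha j) (alpha i)]bilinC -/g.
rewrite (_ : _ - _ = b * (a * b - g ^+ 2)); last by rewrite expr2; ring.
by rewrite pmulr_rgt0 // subr_gt0.
Qed.

Lemma cartan_neq0 i j : s i *m s j != s j *m s i -> C i j != 0.
Proof.
move=> nc; rewrite -(intr_eq0 R) hC !mulf_neq0 ?invr_eq0 ?pnatr_eq0 //.
  by apply: contraNneq nc => /(commuting_reflections (alpha := alpha)) ->.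
by rewrite gt_eqF ?(simple_pos halpha).
Qed.

(** The positive integers |C i j| and |C j i| have product below 4, so one of them is 1; then d_i |C
    i j| = d_j |C j i| gives k as the smaller of d_i and d_j. *)
Lemma cartan_factor i j : s i *m s j != s j *m s i ->
  exists k, (d i = k * `|C j i|)%N /\ (d j = k * `|C i j|)%N.
Proof.
move=> nc; have ij : i != j by apply: contraNneq nc => ->.
have a0 : (0 < `|C i j|)%N by rewrite absz_gt0 cartan_neq0.
have b0 : (0 < `|C j i|)%N by rewrite absz_gt0 cartan_neq0 // eq_sym.
have dd : (d i * `|C i j| = d j * `|C j i|)%N.
  have [_ /matrixP/(_ j i)] := hd; rewrite mxE !mul_diag_mx !mxE.
  by move=> /(congr1 absz); rewrite !abszM.
have ab : (`|C i j| * `|C j i| < 4)%N.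
  rewrite -abszM -ltz_nat; have ii := simple_pos halpha i; have jj := simple_pos halpha j.
  have E : (C i j * C j i)%:~R = 4 * (ip (alpha i) (alpha j) ^+ 2 / (ip (alpha i) (alpha i) * ip (alpha j) (alpha j))).
    rewrite intrM !hC [ip (alpha j) (alpha i)]bilinC expr2; field.
    by rewrite !gt_eqF.
  have p0 := mulr_gt0 ii jj.
  rewrite gez0_abs.
    rewrite -(ltr_int R) E -[X in _ < X]mulr1 ltr_pM2l ?ltr0n //.
    by rewrite ltr_pdivrMr // mul1r strict_cauchy_schwarz.
  by rewrite -(ler_int R) E mulr_ge0 ?ler0n // divr_ge0 ?sqr_ge0 // ltW.
move: a0 b0 dd ab; case: `|C i j|%N => [|[|a]] // _; case: `|C j i|%N => [|[|b]] // _ dd ab.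
- by exists (d j); rewrite muln1 in dd *; rewrite !muln1 in dd *.
- by exists (d j); rewrite !muln1 in dd *.
- by exists (d i); rewrite !muln1 in dd *.
- by have := @leq_mul 2 2 a.+2 b.+2 isT isT; rewrite leqNgt ab.
Qed.

End CartanNumbers.

Theorem proposition1p6 (R : realFieldType) (n : nat)
    (Phi : root_system R n) (alpha : 'I_n -> 'cV[R]_n)
    (halpha : is_base Phi alpha)
    (C : 'M[int]_n) (hC : is_cartan_matrix Phi alpha C)
    (d : 'I_n -> nat) (hd : is_symmetrizer C d)
    (c : 'M[R]_n) (hc : is_coxeter_element Phi alpha c)
    (K : fieldType) (H : falgType K)
    (hH : is_gls_algebra Phi alpha c C d H) :
  (* (1) *)
  [/\ forall M : rmodule H, basic_stt M -> basic_stt (dual M),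
      forall M M' : rmodule H, basic_stt M -> basic_stt M' ->
        (iso M M' <-> iso (dual M) (dual M'))
    & forall N : rmodule H^c, basic_stt N ->
        exists2 M : rmodule H, basic_stt M & iso (dual M) N] /\
  (* (2) *)
  (forall M M' : rmodule H, basic_stt M -> basic_stt M' ->
     (stt_arrow M M' \/ stt_arrow M' M <->
      stt_arrow (dual M) (dual M') \/ stt_arrow (dual M') (dual M))) /\
  (* (3) *)
  (forall M M' : rmodule H, stt_arrow M M' ->
     (nsummands M <> nsummands M' <-> stt_arrow (dual M) (dual M')) /\
     (nsummands M = nsummands M' <-> stt_arrow (dual M') (dual M))).
Proof.
have [pi [pi_scale pi_surj pi_ker]] := hH; have [w cw] := hc.
have right := gls_presentation_right pi_scale pi_surj pi_ker.
have left := gls_presentation_left pi_scale pi_surj pi_ker.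
set ar := coxeter_arrow Phi alpha c in right left.
have arP i j : ar i j -> (index i w < index j w)%N /\
    simple_reflection Phi alpha i *m simple_reflection Phi alpha j !=
    simple_reflection Phi alpha j *m simple_reflection Phi alpha i.
  move=> /andP[/existsP[w' /andP[cw' lt]] nc]; split=> //.
  by rewrite (coxeter_order halpha cw cw' nc).
have [d0 _] := hd; have /andP[pw _] := cw.
have mw i : i \in w by rewrite (perm_mem pw) mem_enum.
have idx_inj : injective (index^~ w).
  by move=> i j; apply: index_inj.
have f0 i j : ar i j -> (0 < `|C j i|)%N.
  by move=> /arP[_ nc]; rewrite absz_gt0 (cartan_neq0 halpha hC) // eq_sym.
have f0' i j : ar j i -> (0 < `|C j i|)%N.
  by move=> /arP[_ nc]; rewrite absz_gt0 (cartan_neq0 halpha hC).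
have df i j : ar i j -> exists k, (d i = k * `|C j i|)%N /\ (d j = k * `|C i j|)%N.
  by move=> /arP[_ nc]; apply: (cartan_factor halpha hC hd nc).
have df' i j : ar j i -> exists k, (d i = k * `|C j i|)%N /\ (d j = k * `|C i j|)%N.
  by move=> /df[k [k1 k2]]; exists k.
(* In the opposite algebra the arrows run backwards through w, so the rank is reversed; positions
   are at most n, so the subtraction is exact. *)
have ridx_inj : injective (fun i => n - index i w)%N.
  move=> i j E; apply: idx_inj; have sw : size w = n by rewrite (perm_size pw) size_enum_ord.
  have li k : (index k w <= n)%N by rewrite (leq_trans (index_size k w)) ?sw.
  by rewrite -(subKn (li i)) E subKn.
have tbr := gls_triangular_basis right idx_inj (fun i j ij => (arP i j ij).1) d0 f0 df.
have ridx_lt i j : ar j i -> (n - index i w < n - index j w)%N.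
  move=> /arP[lt _]; apply: ltn_sub2l (lt); apply: leq_trans lt _.
  by rewrite -[X in (_ <= X)%N](size_enum_ord n) -(perm_size pw) index_size.
have tbl := gls_triangular_basis left ridx_inj ridx_lt d0 f0' df'.
apply: tame_duality.
- exact: triangular_basis_tame tbr tbl _ _.
- exact: triangular_basis_tame tbl tbr _ _.
Qed.
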